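(* Let $0<\lambda<1$, $\beta>0$, $\sigma\ge 0$, $\alpha\ge 0$ and $p\in\{1,2,\infty\}$. For each $(N,d)$ let $X\in\mathbb{R}^{N\times d}$ have independent entries with distribution $N(0,1/N)$, let $\beta_0\in\mathbb{R}^d$ be deterministic, and let $Y=X\beta_0+\sigma\epsilon$, where $\epsilon\in\mathbb{R}^N$ has i.i.d. $N(0,1)$ entries independent of $X$. Consider the limit $N,d\to\infty$ with $d/N\to\lambda$ and $|\beta_0|^2/d\to\beta^2$. Let $\hat\beta$ be the $p$-bias constrained estimator with regularization strength $\alpha$ computed from $(X,Y)$, and let $$MSE=\mathbb{E}_{x\sim N(0,I_d/N)}\left(\langle x,\beta_0\rangle-\langle x,\hat\beta\rangle\right)^2 .$$ Then in this limit the average test error $\mathbb{E}_{X,Y}MSE$ converges to $$Err_p(\alpha)=\lambda\int\left[\beta^2\left(1-\frac{x}{f_\alpha(x)}\right)^2+\sigma^2\frac{x}{f_\alpha(x)^2}\right]\mu^{\lambda}_{MP}(dx),$$ where $f_\alpha(x)=\max(x,\alpha)$ if $p=1$, $f_\alpha(x)=x+\alpha$ if $p=2$, and $f_\alpha(x)=x(1+\alpha)$ if $p=\infty$.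
   Context: For $X\in\mathbb{R}^{N\times d}$ with $G=X^TX$ invertible and $G=U\,\mathrm{diag}(\sigma_1,\dots,\sigma_d)U^T$ an orthogonal diagonalization, the $p$-bias constrained estimator with regularization strength $\alpha$ is $\hat\beta=\hat G^{-1}X^TY$, where $\hat G=U\,\mathrm{diag}(\max(\sigma_i,\alpha))U^T$ for $p=1$ (nuclear), $\hat G=G+\alpha I_d$ for $p=2$ (ridge), and $\hat G=(1+\alpha)G$ for $p=\infty$ (spectral). (In the limit considered $d<N$ eventually, so $G$ is almost surely invertible.) Inside $MSE$ the expectation is over the test point $x$, independent of $(X,Y)$, with $(X,Y)$ held fixed. $\mu^\lambda_{MP}$ is the Marchenko–Pastur distribution with parameter $\lambda\in(0,1)$: it has density $\frac{\sqrt{(\lambda_+-x)(x-\lambda_-)}}{2\pi\lambda x}$ on $[\lambda_-,\lambda_+]$, with $\lambda_\pm=(1\pm\sqrt\lambda)^2$. *)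

(* Defs.v *)
From HB Require Import structures.
From mathcomp Require Import all_boot all_order all_algebra.
From mathcomp Require Import all_classical all_reals all_analysis.
From mathcomp Require Import measurable_realfun.

Set Implicit Arguments.
Unset Strict Implicit.
Unset Printing Implicit Defensive.
Import Order.TTheory GRing.Theory Num.Theory.
Import numFieldNormedType.Exports.
Local Open Scope classical_set_scope.
Local Open Scope ring_scope.

Section estimator.
Context {R : realType}.

(* The library norm on matrices is the sup norm, hence explicit Euclidean
   inner products. *)
Definition dotc d (u v : 'cV[R]_d) : R := \sum_(i < d) u i 0 * v i 0.

(* p = 1, p = 2, p = oo *)
Inductive penalty := Nuclear | Ridge | Spectral.

Definition gram N d (X : 'M[R]_(N, d)) : 'M[R]_d := X^T *m X.

Definition orthogonal_diagonalization d (G : 'M[R]_d)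
    (Us : 'M[R]_d * 'rV[R]_d) : Prop :=
  Us.1^T *m Us.1 = 1%:M /\ G = Us.1 *m diag_mx Us.2 *m Us.1^T.

(* An orthogonal diagonalization chosen once and for all; one exists whenever
   [G] is symmetric, and the default value is irrelevant. *)
Definition diagonalization d (G : 'M[R]_d) : 'M[R]_d * 'rV[R]_d :=
  xget (1%:M, 0) [set Us | orthogonal_diagonalization G Us].

(* For [Nuclear] the result does not depend on the chosen diagonalization. *)
Definition biased_gram (p : penalty) (alpha : R) d (G : 'M[R]_d) : 'M[R]_d :=
  match p with
  | Nuclear =>
      let U := (diagonalization G).1 in
      let s := (diagonalization G).2 in
      U *m diag_mx (\row_i Num.max (s 0 i) alpha) *m U^T
  | Ridge => G + alpha%:M
  | Spectral => (1 + alpha) *: G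
  end.

(* [invmx] is total, and meaningless on a singular matrix; with [0 <= alpha]
   [biased_gram] can only be singular when [gram X] is. *)
Definition bias_constrained_estimator (p : penalty) (alpha : R) N d
    (X : 'M[R]_(N, d)) (Y : 'cV[R]_N) : 'cV[R]_d :=
  invmx (biased_gram p alpha (gram X)) *m X^T *m Y.

End estimator.

Section random_families.
Context {disp : measure_display} {T : measurableType disp} {R : realType}.

Definition mutually_independent (P : probability T R) (I : finType)
    (Z : I -> {RV P >-> R}) : Prop :=
  forall (J : {set I}) (B : I -> set R),
    (forall i, i \in J -> measurable (B i)) ->
    (P (\bigcap_(i in [set` J]) (Z i @^-1` B i))
     = \prod_(i in J) P (Z i @^-1` B i))%E.

Definition generated_sigma_algebra (P : probability T R) (I : finType)
    (Z : I -> {RV P >-> R}) : set (set T) :=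
  <<s \bigcup_(i in [set: I]) g_sigma_algebra_preimage (Z i) >>.

Definition independent_families (P : probability T R) (I J : finType)
    (Z : I -> {RV P >-> R}) (W : J -> {RV P >-> R}) : Prop :=
  forall A B : set T, generated_sigma_algebra Z A ->
    generated_sigma_algebra W B -> (P (A `&` B) = P A * P B)%E.

(* [v] is the variance, whereas [normal_prob] takes a standard deviation. *)
Definition iid_centered_normal (P : probability T R) (I : finType)
    (Z : I -> {RV P >-> R}) (v : R) : Prop :=
  mutually_independent Z /\
  forall i (A : set R), measurable A ->
    distribution P (Z i) A = normal_prob 0 (Num.sqrt v) A.

Definition random_matrix (P : probability T R) m n
    (Z : 'I_m -> 'I_n -> {RV P >-> R}) (w : T) : 'M[R]_(m, n) :=
  \matrix_(i < m, j < n) Z i j w.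

Definition random_vector (P : probability T R) n
    (Z : 'I_n -> {RV P >-> R}) (w : T) : 'cV[R]_n := \col_(i < n) Z i w.

Definition test_mse (Q : probability T R) d (x : 'I_d -> {RV Q >-> R})
    (beta0 b : 'cV[R]_d) : \bar R :=
  ('E_Q[(fun w => (dotc (random_vector x w) beta0
                   - dotc (random_vector x w) b) ^+ 2)%R])%E.

End random_families.

Section marchenko_pastur.
Context {R : realType}.
Implicit Types lambda x : R.

Definition mp_left lambda : R := (1 - Num.sqrt lambda) ^+ 2.
Definition mp_right lambda : R := (1 + Num.sqrt lambda) ^+ 2.

Definition mp_pdf lambda x : R :=
  if x \in `[mp_left lambda, mp_right lambda] then
    Num.sqrt ((mp_right lambda - x) * (x - mp_left lambda))
      / (2 * pi * lambda * x)
  else 0.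

Lemma mp_pdf_ge0 lambda x : 0 <= mp_pdf lambda x.
Proof.
rewrite /mp_pdf; case: ifPn => //; rewrite in_itv/= => /andP[lx xr].
have x0 : 0 <= x by apply: le_trans lx; exact: sqr_ge0.
have [l0|l0] := leP 0 lambda.
  by rewrite divr_ge0 ?sqrtr_ge0// !mulr_ge0// ltW// pi_gt0.
have r1 : mp_right lambda = 1 by rewrite /mp_right ltr0_sqrtr// addr0 expr1n.
have l1 : mp_left lambda = 1 by rewrite /mp_left ltr0_sqrtr// subr0 expr1n.
have -> : x = 1 by apply/eqP; rewrite eq_le -{1}r1 xr -{1}l1 lx.
by rewrite r1 subrr mul0r sqrtr0 mul0r.
Qed.

Lemma measurable_mp_pdf lambda : measurable_fun [set: R] (mp_pdf lambda).
Proof.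
have -> : mp_pdf lambda =
    (fun x => if (mp_left lambda <= x) && (x <= mp_right lambda) then
       Num.sqrt ((mp_right lambda - x) * (x - mp_left lambda))
       * ((2 * pi * lambda)^-1 * x `^ (-1)) else 0).
  apply/funext => x; rewrite /mp_pdf in_itv/=; case: ifPn => // /andP[lx _].
  by rewrite powR_inv1 ?invfM// (le_trans _ lx)// sqr_ge0.
apply: measurable_fun_ifT => //.
  by apply: measurable_and; exact: measurable_fun_ler.
apply: measurable_funM; last first.
  by apply: measurable_funM => //; exact: measurable_powR.
apply: measurableT_comp.
  by apply: continuous_measurable_fun => x; exact: sqrt_continuous.
by apply: measurable_funM; exact: measurable_funB.
Qed.

Definition marchenko_pastur lambda : set _ -> \bar R :=
  fun V => (\int[lebesgue_measure]_(x in V) (mp_pdf lambda x)%:E)%E.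

Section measure.
Variable lambda : R.

Let mp0 : marchenko_pastur lambda set0 = 0%E.
Proof. by rewrite /marchenko_pastur integral_set0. Qed.

Let mp_ge0 A : (0 <= marchenko_pastur lambda A)%E.
Proof. by apply: integral_ge0 => x _; rewrite lee_fin mp_pdf_ge0. Qed.

Let mp_sigma_additive : semi_sigma_additive (marchenko_pastur lambda).
Proof.
move=> /= A mA tA mUA.
rewrite /marchenko_pastur/= ge0_integral_bigcup//=.
- apply: is_cvg_ereal_nneg_natsum_cond => n _ _.
  by apply: integral_ge0 => /= x ?; rewrite lee_fin mp_pdf_ge0.
- apply/measurable_EFinP; apply: measurable_funTS; exact: measurable_mp_pdf.
- by move=> x _; rewrite lee_fin mp_pdf_ge0.
Qed.

HB.instance Definition _ := isMeasure.Build _ _ _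
  (marchenko_pastur lambda) mp0 mp_ge0 mp_sigma_additive.

End measure.

Definition spectral_map (p : penalty) (alpha x : R) : R :=
  match p with
  | Nuclear => Num.max x alpha
  | Ridge => x + alpha
  | Spectral => x * (1 + alpha)
  end.

Definition limit_error (p : penalty) (lambda beta sigma alpha : R) : \bar R :=
  (lambda%:E * \int[marchenko_pastur lambda]_x
     (beta ^+ 2 * (1 - x / spectral_map p alpha x) ^+ 2
      + sigma ^+ 2 * (x / spectral_map p alpha x ^+ 2))%:E)%E.

End marchenko_pastur.

(* Main.v *)
(* Averaging over the noise gives
     E MSE = (d/N) E [(|beta0|^2/d) b^T h1(G) b + sigma^2 (1/d) tr h2(G)],
   where b is the unit vector along beta0, h1(x) = (1 - x/f(x))^2 and h2(x) = x/f(x)^2.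
   It therefore suffices to find the limits of E b^T h(G) b and E (1/d) tr h(G).
   For h(x) = 1/(x+t), Gaussian integration by parts in every entry of X shows that
   u = b^T (G+t)^-1 b and m = (1/d) tr (G+t)^-1 satisfy
     E S (1 - (1 + t - lambda) u - lambda t m u) -> 0   for S = 1 and S = m.
   Averaging over an orthonormal basis replaces u by m, and the combination
   m* - m of the two test functions forces m -> m* in mean square, m* being the
   positive root of the limiting equation; then E u -> m* too.  As m*(t) is the
   Stieltjes transform of the Marchenko-Pastur law, the limits follow for every
   uniform limit on [0, oo) of combinations of constants and resolvent kernels,
   an algebra containing h1 and h2 in the ridge and nuclear cases with alpha > 0.
   In the remaining cases the estimator is a multiple of least squares, and the
   limit of E (1/d) tr G^-1 comes from (1 - d/N - 1/N) E u <= 1, uniformly in t. *)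
Require Import Defs.
From HB Require Import structures.
From mathcomp Require Import all_boot all_order all_algebra.
From mathcomp Require Import all_classical all_reals all_analysis.
From mathcomp Require Import measurable_realfun perm spectral ring lra.
From mathcomp.real_closed Require complex.

Set Implicit Arguments.
Unset Strict Implicit.
Unset Printing Implicit Defensive.
Import Order.TTheory GRing.Theory Num.Theory.
Import numFieldNormedType.Exports.
Local Open Scope classical_set_scope.
Local Open Scope ring_scope.

(** * Symmetric matrices and functional calculus *)

(** Expectations do not close the loop equation, because it contains [E m u] rather than [E m E u].
    A second obstacle is measurability. Diagonalizations are obtained by choice, so neither
    eigenvalues nor eigenvectors are known to be measurable. Entries of the resolvent are rational
    functions of the entries of [X], hence measurable, and this passes to other functions of the
    Gram matrix through the same inductive closure that carries boundedness and the limits. Finally,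
    [1/x] is unbounded at [0] and lies outside that closure. For [S = 1] the loop equation has a
    single error term, between [0] and [u / N], which is what makes the bound on [E u] uniform in
    [t]. This bound yields both the almost sure invertibility of [G] and the monotone limit as [t]
    decreases to [0]. *)

Section spectral_theorem.
Import complex.
Context {R : realType}.

Lemma dotcE d (u v : 'cV[R]_d) : (u^T *m v) 0 0 = dotc u v.
Proof. by rewrite mxE; apply: eq_bigr => i _; rewrite mxE. Qed.

Lemma dotc_ge0 d (u : 'cV[R]_d) : 0 <= dotc u u.
Proof. by apply: sumr_ge0 => i _; rewrite -expr2 sqr_ge0. Qed.

Lemma dotc_eq0 d (u : 'cV[R]_d) : (dotc u u == 0) = (u == 0).
Proof.
apply/eqP/eqP => [u0|->]; last by rewrite /dotc big1// => i _; rewrite !mxE mul0r.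
apply/matrixP => i j; rewrite ord1 mxE; apply/eqP; rewrite -sqrf_eq0 expr2.
move: u0 => /eqP; rewrite psumr_eq0; last by move=> k _; rewrite -expr2 sqr_ge0.
by move=> /allP /(_ i); rewrite mem_index_enum => /(_ isT).
Qed.

(** The spectral theorem over the complex closure serves only to see that one eigenvalue is real.
    Being a root of the characteristic polynomial, it descends to [R] because the embedding is
    injective. *)
Lemma symmetric_real_eigenvalue n (G : 'M[R]_n.+1) : G^T = G ->
  exists a : R, eigenvalue G a.
Proof.
move=> Gsym.
pose C : numClosedFieldType := complex R.
pose f : {rmorphism R -> C} := real_complex R.
pose A : 'M[C]_n.+1 := map_mx f G.
have cf (x : R) : (f x)^* = f x by apply/CrealP/complex_realP; exists x.
have Aherm : A \is hermsymmx.
  apply/is_hermitianmxP; rewrite expr0 scale1r; apply/matrixP => i j.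
  by rewrite !mxE -[in RHS]Gsym mxE cf.
have /mxOverP /(_ 0 0) := hermitian_spectral_diag_real Aherm.
have /hermitian_normalmx /orthomx_spectralP := Aherm.
set P := spectralmx A; set D := spectral_diag A => AE.
have Pu : P \in unitmx by exact: spectral_unit.
move=> /complex_realP[a D0]; exists a.
rewrite eigenvalue_root_char -(fmorph_root f).
rewrite map_char_poly -/A -eigenvalue_root_char.
apply/eigenvalueP; exists (row 0 P).
  rewrite AE !mulmxA -row_mul mulmxV// row1.
  rewrite -rowE.
  have -> : row 0 (diag_mx D) = D 0 0 *: delta_mx 0 0.
    apply/rowP => j; rewrite !mxE eqxx /=.
    by have [_|_] := eqVneq j 0; rewrite ?mulr1n ?mulr1// mulr0n mulr0.
  by rewrite -scalemxAl -rowE D0.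
apply/negP => /eqP P0.
have : row 0 P *m invmx P = 0 by rewrite P0 mul0mx.
rewrite -row_mul mulmxV// => /rowP /(_ 0); rewrite !mxE eqxx => /eqP.
by rewrite oner_eq0.
Qed.

(** Householder reflection in the hyperplane orthogonal to [e - v]; it exchanges [e] and [v] because
    they have the same length. *)
Lemma reflection_to n (e v : 'cV[R]_n) : dotc e e = 1 -> dotc v v = 1 ->
  exists Q : 'M[R]_n, [/\ Q^T = Q, Q *m Q = 1%:M & Q *m e = v].
Proof.
move=> e1 v1; have [<-|ev] := eqVneq e v.
  by exists 1%:M; rewrite trmx1 !mul1mx.
pose w := e - v; pose k := 2 / dotc w w.
have ww0 : dotc w w != 0 by rewrite dotc_eq0 subr_eq0.
have wwE : w^T *m w = (dotc w w)%:M.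
  by rewrite [LHS]mx11_scalar dotcE.
have weE : w^T *m e = (dotc w w / 2)%:M.
  rewrite [LHS]mx11_scalar dotcE; congr (_%:M).
  have -> : dotc w w = dotc e e + dotc v v - 2 * dotc v e.
    rewrite /dotc mulr_sumr -big_split/= -sumrB; apply: eq_bigr => i _.
    by rewrite !mxE; ring.
  have -> : dotc w e = dotc e e - dotc v e.
    by rewrite /dotc -sumrB; apply: eq_bigr => i _; rewrite !mxE; ring.
  by rewrite e1 v1; field.
exists (1%:M - k *: (w *m w^T)); split.
- by rewrite linearB linearZ/= trmx1 trmx_mul trmxK.
- rewrite mulmxBl mul1mx mulmxBr mulmx1 -scalemxAl -scalemxAr.
  have -> : w *m w^T *m (w *m w^T) = dotc w w *: (w *m w^T).
    by rewrite mulmxA -(mulmxA w w^T w) wwE mul_mx_scalar -scalemxAl.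
  rewrite !scalerA; have -> : k * k * dotc w w = k + k.
    by rewrite /k; field.
  by rewrite scalerDl opprB addrK subrK.
- rewrite mulmxBl mul1mx -scalemxAl -mulmxA weE mul_mx_scalar scalerA.
  by rewrite /k mulrA divfK// divff ?pnatr_eq0// scale1r opprB addrC subrK.
Qed.

(** Deflation: conjugating by a reflection that carries the first basis vector to a unit eigenvector
    makes the matrix block diagonal, and the induction hypothesis diagonalizes the lower block. *)
Lemma symmetric_orthogonal_diagonalization n (G : 'M[R]_n) : G^T = G ->
  exists Us, orthogonal_diagonalization G Us.
Proof.
elim: n G => [|n IH] G Gsym.
  by exists (1%:M, 0); split; apply/matrixP => -[].
have [a /eigenvalueP[u uG u0]] := symmetric_real_eigenvalue Gsym.
pose c := Num.sqrt (dotc u^T u^T).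
have uu0 : 0 < dotc u^T u^T.
  by rewrite lt_neqAle dotc_ge0 eq_sym dotc_eq0 trmx_eq0 u0.
have c0 : c != 0 by rewrite gt_eqF// sqrtr_gt0.
have cc : c ^+ 2 = dotc u^T u^T by rewrite sqr_sqrtr// ltW.
pose v : 'cV[R]_(1 + n) := c^-1 *: u^T.
have v1 : dotc v v = 1.
  transitivity ((c^-1) ^+ 2 * dotc u^T u^T); last by rewrite -cc -exprMn mulVf// expr1n.
  rewrite /dotc mulr_sumr; apply: eq_bigr => i _; rewrite !mxE; ring.
have Gv : (G : 'M[R]_(1 + n)) *m v = a *: v.
  rewrite -scalemxAr scalerA [a * _]mulrC -scalerA; congr (_ *: _).
  by rewrite -[in LHS]Gsym -trmx_mul uG linearZ.
pose e : 'cV[R]_(1 + n) := delta_mx (lshift n 0) 0.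
have e1 : dotc e e = 1.
  rewrite /dotc (bigD1 (lshift n 0))//= big1 ?addr0 => [|i i0].
    by rewrite !mxE !eqxx mulr1.
  by rewrite !mxE (negbTE i0) mul0r.
have [Q [Qs QQ Qe]] := reflection_to e1 v1.
have [B BQ] : exists B : 'M[R]_(1 + n), B = Q *m G *m Q by eexists.
have Bs : B^T = B by rewrite BQ !trmx_mul Qs Gsym mulmxA.
have Be : B *m e = a *: e.
  rewrite BQ -mulmxA Qe -mulmxA Gv -scalemxAr; congr (_ *: _).
  by rewrite -Qe mulmxA QQ mul1mx.
have Bcol i : B i (lshift n 0) = a * e i 0.
  by have /matrixP /(_ i 0) := Be; rewrite -colE !mxE => ->.
have BE : B = block_mx a%:M 0 0 (drsubmx B).
  rewrite -[LHS]submxK; congr block_mx; apply/matrixP => i j.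
  - by rewrite !ord1 !mxE Bcol !mxE !eqxx /= mulr1.
  - rewrite !mxE (ord1 i) -[B in LHS]Bs mxE Bcol !mxE.
    by rewrite eq_rlshift mulr0.
  - by rewrite !mxE (ord1 j) Bcol !mxE eq_rlshift mulr0.
have drs : (drsubmx B)^T = drsubmx B by rewrite trmx_drsub Bs.
have [[U s] [/= UU Us]] := IH _ drs.
pose V : 'M[R]_(1 + n) := block_mx 1%:M 0 0 U.
have VV : V^T *m V = 1%:M.
  rewrite tr_block_mx mulmx_block !trmx0 trmx1 !(mulmx1, mul1mx, mulmx0, mul0mx).
  by rewrite !(addr0, add0r) UU -scalar_mx_block.
exists (Q *m V, row_mx a%:M s); split => /=.
  by rewrite trmx_mul Qs mulmxA -(mulmxA V^T) QQ mulmx1.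
rewrite trmx_mul Qs !mulmxA -2!(mulmxA Q).
have -> : V *m diag_mx (row_mx a%:M s) *m V^T = B.
  rewrite BE Us diag_mx_row tr_block_mx /V !mulmx_block !trmx0 trmx1.
  rewrite !(mulmx1, mul1mx, mulmx0, mul0mx, addr0, add0r) -mulmxA.
  congr block_mx.
  by apply/matrixP => i j; rewrite !ord1 !mxE eqxx.
by rewrite BQ !mulmxA QQ mul1mx -mulmxA QQ mulmx1.
Qed.

End spectral_theorem.

Section functional_calculus.
Context {R : realType}.
Implicit Types (f g : R -> R).

Lemma trmx_gram N d (X : 'M[R]_(N, d)) : (gram X)^T = gram X.
Proof. by rewrite trmx_mul trmxK. Qed.

Lemma diagonalizationP d (G : 'M[R]_d) : G^T = G ->
  orthogonal_diagonalization G (diagonalization G).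
Proof.
move=> /symmetric_orthogonal_diagonalization exU.
exact: (xgetPex (1%:M, 0) exU).
Qed.

(** Built on the same chosen [diagonalization] as [biased_gram], so that the nuclear case is an
    instance of it by conversion. *)
Definition fcalc f d (G : 'M[R]_d) : 'M[R]_d :=
  let Us := diagonalization G in
  Us.1 *m diag_mx (\row_i f (Us.2 0 i)) *m Us.1^T.

Definition eigval d (G : 'M[R]_d) (i : 'I_d) : R := (diagonalization G).2 0 i.

(** Mass that the spectral measure of [G] at the vector [b] puts on the [i]-th eigenvalue. *)
Definition spectral_weight d (G : 'M[R]_d) (b : 'cV[R]_d) (i : 'I_d) : R :=
  (((diagonalization G).1^T *m b) i 0) ^+ 2.

Lemma fcalc_entry f d (G : 'M[R]_d) i j : fcalc f G i j =
  \sum_k (diagonalization G).1 i k * f (eigval G k) * (diagonalization G).1 j k.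
Proof.
rewrite /fcalc mul_mx_diag mxE; apply: eq_bigr => k _.
by rewrite !mxE.
Qed.

Lemma fcalcD f g d (G : 'M[R]_d) :
  fcalc (fun x => f x + g x) G = fcalc f G + fcalc g G.
Proof.
apply/matrixP => i j; rewrite [RHS]mxE !fcalc_entry -big_split; apply: eq_bigr => k _ /=.
ring.
Qed.

Lemma fcalcZ c f d (G : 'M[R]_d) : fcalc (fun x => c * f x) G = c *: fcalc f G.
Proof.
apply/matrixP => i j; rewrite [RHS]mxE !fcalc_entry mulr_sumr; apply: eq_bigr => k _ /=.
ring.
Qed.

Lemma trmx_fcalc f d (G : 'M[R]_d) : (fcalc f G)^T = fcalc f G.
Proof. by rewrite /fcalc !trmx_mul trmxK tr_diag_mx mulmxA. Qed.

Section symmetric.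
Variables (d : nat) (G : 'M[R]_d).
Hypothesis Gsym : G^T = G.
Let U := (diagonalization G).1.

Let UTU : U^T *m U = 1%:M. Proof. exact: (diagonalizationP Gsym).1. Qed.
Let UUT : U *m U^T = 1%:M. Proof. exact: mulmx1C. Qed.

Lemma fcalc_id : fcalc id G = G.
Proof.
rewrite [RHS](diagonalizationP Gsym).2 /fcalc; congr (_ *m diag_mx _ *m _).
by apply/rowP => i; rewrite mxE.
Qed.

Lemma fcalcM f g : fcalc f G *m fcalc g G = fcalc (fun x => f x * g x) G.
Proof.
rewrite /fcalc -/U !mulmxA -(mulmxA _ U^T U) UTU mulmx1 -(mulmxA U) mulmx_diag.
by congr (_ *m diag_mx _ *m _); apply/rowP => i; rewrite !mxE.
Qed.

Lemma fcalc_cst c : fcalc (fun=> c) G = c%:M.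
Proof.
rewrite /fcalc -/U; have -> : diag_mx (\row_(i < d) c) = c%:M.
  by rewrite -diag_const_mx; congr diag_mx; apply/rowP => i; rewrite !mxE.
by rewrite mul_mx_scalar -scalemxAl UUT scalemx1.
Qed.

Lemma eq_fcalc f g : (forall i, f (eigval G i) = g (eigval G i)) ->
  fcalc f G = fcalc g G.
Proof.
move=> fg; apply/matrixP => i j; rewrite !fcalc_entry.
by apply: eq_bigr => k _; rewrite fg.
Qed.

Lemma fcalc_unitmx f : (forall i, f (eigval G i) != 0) -> fcalc f G \in unitmx.
Proof.
move=> f0; suff : fcalc f G *m fcalc (fun x => (f x)^-1) G = 1%:M.
  by move=> /mulmx1_unit[].
by rewrite fcalcM -(fcalc_cst 1); apply: eq_fcalc => i; rewrite divff.
Qed.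

Lemma invmx_fcalc f : (forall i, f (eigval G i) != 0) ->
  invmx (fcalc f G) = fcalc (fun x => (f x)^-1) G.
Proof.
move=> f0; have fu := fcalc_unitmx f0.
rewrite -[RHS]mul1mx -(mulVmx fu) -mulmxA fcalcM.
rewrite (_ : fcalc (fun x => f x * (f x)^-1) G = 1%:M) ?mulmx1//.
by rewrite -(fcalc_cst 1); apply: eq_fcalc => i; rewrite divff.
Qed.

Lemma spectral_weight_ge0 b i : 0 <= spectral_weight G b i.
Proof. exact: sqr_ge0. Qed.

Lemma sum_spectral_weight b : \sum_i spectral_weight G b i = dotc b b.
Proof.
transitivity (dotc (U^T *m b) (U^T *m b)).
  by apply: eq_bigr => i _; rewrite -expr2.
by rewrite -!dotcE trmx_mul trmxK mulmxA -(mulmxA b^T) UUT mulmx1.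
Qed.

Lemma dotc_fcalc f b :
  dotc b (fcalc f G *m b) = \sum_i spectral_weight G b i * f (eigval G i).
Proof.
have -> : dotc b (fcalc f G *m b) =
    dotc (U^T *m b) (diag_mx (\row_i f (eigval G i)) *m (U^T *m b)).
  by rewrite -!dotcE /fcalc -/U trmx_mul trmxK !mulmxA.
apply: eq_bigr => i _; rewrite mul_diag_mx /spectral_weight -/U.
by rewrite [X in _ * X]mxE [X in _ * (X * _)]mxE mulrCA mulrC -expr2.
Qed.

Lemma mxtrace_fcalc f : \tr (fcalc f G) = \sum_i f (eigval G i).
Proof.
rewrite /fcalc -/U mxtrace_mulC mulmxA UTU mul1mx mxtrace_diag.
by apply: eq_bigr => i _; rewrite mxE.
Qed.

End symmetric.

Lemma dotc_gram N d (X : 'M[R]_(N, d)) (u v : 'cV_d) :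
  dotc u (gram X *m v) = dotc (X *m u) (X *m v).
Proof. by rewrite -!dotcE trmx_mul !mulmxA. Qed.

(** The [i]-th eigenvalue is the squared length of [X u], where [u] is the [i]-th column of the
    orthogonal matrix. *)
Lemma eigval_gram_ge0 N d (X : 'M[R]_(N, d)) i : 0 <= eigval (gram X) i.
Proof.
set G := gram X; have [UU GE] := diagonalizationP (trmx_gram X).
set U := (diagonalization (gram X)).1 in UU GE.
have : 0 <= dotc (X *m col i U) (X *m col i U) by exact: dotc_ge0.
rewrite -dotc_gram {1}GE -dotcE colE.
rewrite trmx_mul !mulmxA -(mulmxA _ U^T) UU mulmx1 -(mulmxA _ U^T) UU mulmx1.
by rewrite trmx_delta -colE mxE -rowE mxE mxE eqxx.
Qed.

(** The resolvent at the point [-t], off the spectrum when [0 < t]. Written with [invmx] rather than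
    [fcalc], it is visibly a rational function of the entries of [X], which gives its measurability
    and its derivative. *)
Definition resolvent N d (X : 'M[R]_(N, d)) (t : R) : 'M[R]_d :=
  invmx (gram X + t%:M).

Lemma gramD_fcalc N d (X : 'M[R]_(N, d)) t :
  gram X + t%:M = fcalc (fun x => x + t) (gram X).
Proof. by rewrite fcalcD fcalc_cst ?fcalc_id//; exact: trmx_gram. Qed.

Lemma gramD_unitmx N d (X : 'M[R]_(N, d)) t : 0 < t -> gram X + t%:M \in unitmx.
Proof.
move=> t0; rewrite gramD_fcalc fcalc_unitmx//; first exact: trmx_gram.
by move=> i; rewrite gt_eqF// ltr_wpDl// eigval_gram_ge0.
Qed.

Lemma resolvent_fcalc N d (X : 'M[R]_(N, d)) t : 0 < t ->
  resolvent X t = fcalc (fun x => (x + t)^-1) (gram X).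
Proof.
move=> t0; rewrite /resolvent gramD_fcalc invmx_fcalc//; first exact: trmx_gram.
by move=> i; rewrite gt_eqF// ltr_wpDl// eigval_gram_ge0.
Qed.

Lemma trmx_resolvent N d (X : 'M[R]_(N, d)) t : (resolvent X t)^T = resolvent X t.
Proof. by rewrite /resolvent trmx_inv linearD/= trmx_gram tr_scalar_mx. Qed.

End functional_calculus.

(** * Measurability of matrix operations *)

Section measurable_matrix.
Context {R : realType} d (T : measurableType d).

(** Writing [x^-1] as [x * (x^2)^-1] reduces to a real power of a nonnegative number; at [0] the
    factor [x] restores the convention [0^-1 = 0]. *)
Lemma measurable_inv : measurable_fun [set: R] (@GRing.inv R).
Proof.
rewrite (_ : GRing.inv = fun x : R => x * (x ^+ 2) `^ (-1)).
  apply: measurable_funM => //; apply: (measurableT_comp (measurable_powR _)).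
  exact: measurable_funX.
apply/funext => x; rewrite powR_inv1 ?sqr_ge0// expr2 invfM mulrA.
by have [->|x0] := eqVneq x 0; rewrite ?invr0 ?mulr0// divff// mul1r.
Qed.

Definition measurable_mx m n (M : T -> 'M[R]_(m, n)) :=
  forall i j, measurable_fun [set: T] (fun w => M w i j).

Lemma measurable_mulmx m n p (M : T -> 'M[R]_(m, n)) (M' : T -> 'M[R]_(n, p)) :
  measurable_mx M -> measurable_mx M' -> measurable_mx (fun w => M w *m M' w).
Proof.
move=> mM mM' i j; under eq_fun do rewrite mxE.
by apply: measurable_sum => k; exact: measurable_funM.
Qed.

Lemma measurable_trmx m n (M : T -> 'M[R]_(m, n)) :
  measurable_mx M -> measurable_mx (fun w => (M w)^T).
Proof. by move=> mM i j; under eq_fun do rewrite mxE; exact: mM. Qed.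

Lemma measurable_addmx m n (M M' : T -> 'M[R]_(m, n)) :
  measurable_mx M -> measurable_mx M' -> measurable_mx (fun w => M w + M' w).
Proof.
by move=> mM mM' i j; under eq_fun do rewrite mxE; exact: measurable_funD.
Qed.

Lemma measurable_scalemx m n (c : T -> R) (M : T -> 'M[R]_(m, n)) :
  measurable_fun [set: T] c ->
  measurable_mx M -> measurable_mx (fun w => c w *: M w).
Proof.
by move=> mc mM i j; under eq_fun do rewrite mxE; exact: measurable_funM.
Qed.

Lemma measurable_cstmx m n (M : 'M[R]_(m, n)) : measurable_mx (fun=> M).
Proof. by move=> i j. Qed.

Lemma measurable_det n (M : T -> 'M[R]_n) : measurable_mx M ->
  measurable_fun [set: T] (fun w => \det (M w)).
Proof.
move=> mM; apply: measurable_sum => s; apply: measurable_funM => //.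
by apply: measurable_prod => i _; exact: mM.
Qed.

(** Cramer's formula where the determinant is nonzero; elsewhere [invmx] returns its argument, which
    is measurable too. *)
Lemma measurable_invmx n (M : T -> 'M[R]_n) : measurable_mx M ->
  measurable_mx (fun w => invmx (M w)).
Proof.
move=> mM i j; have mdet := measurable_det mM.
have -> : (fun w => invmx (M w) i j) = fun w => if \det (M w) == 0 then M w i j
    else (\det (M w))^-1 * ((-1) ^+ (j + i) * \det (row' j (col' i (M w)))).
  apply/funext => w; rewrite /invmx unitmxE unitfE; case: eqP => //= _.
  by rewrite !mxE.
apply: measurable_fun_ifT; last 2 first.
- exact: mM.
- apply: measurable_funM; first exact: (measurableT_comp measurable_inv).
  apply: measurable_funM => //; apply: measurable_det => k l.
  by under eq_fun do rewrite !mxE; exact: mM.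
- by apply: measurable_fun_eqr => //.
Qed.

Lemma measurable_gram m n (M : T -> 'M[R]_(m, n)) : measurable_mx M ->
  measurable_mx (fun w => gram (M w)).
Proof. by move=> mM; apply: measurable_mulmx => //; exact: measurable_trmx. Qed.

Lemma measurable_resolvent m n (M : T -> 'M[R]_(m, n)) t : measurable_mx M ->
  measurable_mx (fun w => resolvent (M w) t).
Proof.
move=> mM; apply: measurable_invmx; apply: measurable_addmx.
  exact: measurable_gram.
exact: measurable_cstmx.
Qed.

Lemma measurable_mxtrace n (M : T -> 'M[R]_n) : measurable_mx M ->
  measurable_fun [set: T] (fun w => \tr (M w)).
Proof. by move=> mM; apply: measurable_sum => i; exact: mM. Qed.

Lemma measurable_dotc n (u v : T -> 'cV[R]_n) :
  measurable_mx u -> measurable_mx v ->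
  measurable_fun [set: T] (fun w => dotc (u w) (v w)).
Proof.
move=> mu mv; apply: measurable_sum => i.
by apply: measurable_funM; [exact: mu|exact: mv].
Qed.

End measurable_matrix.

(** * Gaussian integration by parts *)

Section density.
Context d (T : measurableType d) {R : realType}.
Variables (mu nu : {measure set T -> \bar R}) (p : T -> R).
Hypotheses (p0 : forall x, 0 <= p x) (mp : measurable_fun [set: T] p).
Hypothesis nuE : forall A, measurable A -> nu A = (\int[mu]_(x in A) (p x)%:E)%E.
Import HBNNSimple.
Local Open Scope ereal_scope.

(** Simple functions come first; monotone convergence and the splitting into positive and negative
    parts then extend the change of density to all measurable functions. *)
Lemma nnsfun_integral_density (h : {nnsfun T >-> R}) :
  \int[nu]_x (h x)%:E = \int[mu]_x ((h x)%:E * (p x)%:E).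
Proof.
transitivity (\int[nu]_x
    (\sum_(y \in range h) (y * \1_(h @^-1` [set y]) x)%:E)).
  by apply: eq_integral => t _; rewrite /= fimfunE -fsumEFin.
rewrite ge0_integral_fsum//; last 2 first.
- by move=> r; apply/measurable_EFinP; exact: measurable_funM.
- by move=> m y _; exact: nnfun_muleindic_ge0.
transitivity (\int[mu]_x (\sum_(y \in range h)
    (y * \1_(h @^-1` [set y]) x)%:E * (p x)%:E)); last first.
  apply: eq_integral => x _.
  rewrite -ge0_mule_fsuml => [|y]; last exact: nnfun_muleindic_ge0.
  by rewrite fsumEFin // -(fimfunE _ x).
rewrite ge0_integral_fsum//; last 2 first.
- move=> y; apply: emeasurable_funM; apply/measurable_EFinP => //.
  exact: measurable_funM.
- move=> m y _; apply: mule_ge0; last by rewrite lee_fin.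
  exact: nnfun_muleindic_ge0.
apply: eq_fsbigr => r rh; rewrite integralZl_indic_nnsfun//.
move: rh; rewrite inE => -[y _ yr].
have r0 : (0 <= r)%R by rewrite -yr.
under [RHS]eq_integral do rewrite EFinM -muleA.
rewrite [RHS]ge0_integralZl//; last 2 first.
- by apply: emeasurable_funM; exact/measurable_EFinP.
- by move=> x _; rewrite mule_ge0// lee_fin.
congr (_ * _); rewrite integral_indic// setIT nuE//.
rewrite integral_mkcond; apply: eq_integral => x _.
rewrite patchE indicE; case: ifPn => xA; first by rewrite mul1e.
by rewrite mul0e.
Qed.

Lemma ge0_integral_density (g : T -> \bar R) : (forall x, 0 <= g x) ->
  measurable_fun [set: T] g ->
  \int[nu]_x g x = \int[mu]_x (g x * (p x)%:E).
Proof.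
move=> g0 mg; pose h := nnsfun_approx measurableT mg.
have hg x : EFin \o h ^~ x @ \oo --> g x by exact: cvg_nnsfun_approx.
have nd x : {homo (fun n => (h n x)%:E) : n m / (n <= m)%N >-> n <= m}.
  by move=> n m nm; rewrite lee_fin; exact/lefP/nd_nnsfun_approx.
have nuh : (fun n => \int[nu]_x (h n x)%:E) @ \oo --> \int[nu]_x g x.
  have := @cvg_monotone_convergence _ _ _ nu _ measurableT (fun n x => (h n x)%:E).
  rewrite (eq_integral g) => [|x _]; last by apply/cvg_lim => //; exact: hg.
  apply.
  - by move=> n; exact/measurable_EFinP.
  - by move=> n x _; rewrite lee_fin.
  - by move=> x _ n m; exact: nd.
have muh : (fun n => \int[mu]_x ((h n x)%:E * (p x)%:E)) @ \oo -->
    \int[mu]_x (g x * (p x)%:E).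
  have := @cvg_monotone_convergence _ _ _ mu _ measurableT
    (fun n x => (h n x)%:E * (p x)%:E).
  rewrite (eq_integral (fun x => g x * (p x)%:E)) => [|x _]; last first.
    by apply/cvg_lim => //; apply: cvgeZr => //; exact: hg.
  apply => //.
  - by move=> n; apply: emeasurable_funM; exact/measurable_EFinP.
  - by move=> n x _; rewrite mule_ge0// lee_fin.
  - by move=> x _ n m nm; rewrite lee_wpmul2r ?lee_fin// -lee_fin nd.
have E : (fun n => \int[nu]_x (h n x)%:E) =
    (fun n => \int[mu]_x ((h n x)%:E * (p x)%:E)).
  by apply/funext => n; exact: nnsfun_integral_density.
by rewrite -E in muh; exact: (cvg_unique _ nuh muh).
Qed.

Lemma integrable_density (g : T -> R) : measurable_fun [set: T] g ->
  mu.-integrable [set: T] (fun x => (g x * p x)%:E) ->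
  nu.-integrable [set: T] (EFin \o g).
Proof.
move=> mg /integrableP[_ goo]; apply/integrableP; split.
  exact/measurable_EFinP.
rewrite ge0_integral_density//; last exact/measurableT_comp/measurable_EFinP.
rewrite (eq_integral (fun x => `|(g x * p x)%:E|))// => x _.
by rewrite EFinM abseM (gee0_abs (_ : 0 <= (p x)%:E)) ?lee_fin.
Qed.

Lemma integral_density (g : T -> R) : measurable_fun [set: T] g ->
  \int[nu]_x (g x)%:E = \int[mu]_x (g x * p x)%:E.
Proof.
move=> mg; rewrite integralE [RHS]integralE.
have mg' : measurable_fun [set: T] (fun x => (g x)%:E) by exact/measurable_EFinP.
rewrite !ge0_integral_density//; [|exact: measurable_funeneg|exact: measurable_funepos].
have pmax (a c : R) : (0 <= c)%R -> (Num.max (a * c) 0 = Num.max a 0 * c)%R.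
  move=> c0; have [a0|a0] := leP a 0%R; first by rewrite mul0r max_r// mulr_le0_ge0.
  by rewrite max_l// mulr_ge0// ltW.
congr (_ - _); apply: eq_integral => x _.
- by rewrite !funeposE -!EFin_max -EFinM pmax.
- by rewrite !funenegE -!EFinN -!EFin_max -EFinM -mulNr pmax.
Qed.

End density.

Section gaussian.
Context {R : realType}.
Variable s : R.
Hypothesis s0 : s != 0.
Local Notation leb := (@lebesgue_measure R).
Local Notation p := (normal_pdf 0 s).
Local Notation q := (normal_pdf 0 (Num.sqrt 2 * s)).

Let s20 : 0 < s ^+ 2. Proof. by rewrite exprn_even_gt0. Qed.
Let r0 : Num.sqrt 2 * s != 0 :> R.
Proof. by rewrite mulf_neq0// gt_eqF// sqrtr_gt0. Qed.

(** The factor [1 + 4 s^2] bounds [(1 + z^2) exp (- z^2 / (4 s^2))]; the quotient accounts for the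
    two different peaks. *)
Definition tail_cst : R :=
  (1 + 4 * s ^+ 2) * (normal_peak s / normal_peak (Num.sqrt 2 * s)).

Lemma tail_cst_ge0 : 0 <= tail_cst.
Proof.
rewrite mulr_ge0 ?divr_ge0 ?normal_peak_ge0// addr_ge0// mulr_ge0//.
exact: sqr_ge0.
Qed.

(** Half of the Gaussian exponent absorbs the polynomial factor, through [1 + y <= exp y] at
    [y = z^2 / (4 s^2)]. The other half is the exponent of a Gaussian of deviation [sqrt 2 * s],
    which is still integrable. *)
Lemma normal_pdf_tail z : (1 + z ^+ 2) * p z <= tail_cst * q z.
Proof.
rewrite !normal_pdfE// /normal_fun !subr0 /tail_cst.
rewrite exprMn sqr_sqrtr//.
have pk : 0 < normal_peak (Num.sqrt 2 * s) by exact: normal_peak_gt0.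
set y := z ^+ 2 / (4 * s ^+ 2).
have -> : - z ^+ 2 / (s ^+ 2 *+ 2) = - y - y by rewrite /y; field.
have -> : - z ^+ 2 / (2 * s ^+ 2 *+ 2) = - y by rewrite /y; field.
rewrite expRD.
have y0 : 0 <= y by rewrite divr_ge0 ?sqr_ge0// mulr_ge0// ltW.
have ey : (1 + z ^+ 2) * expR (- y) <= 1 + 4 * s ^+ 2.
  rewrite expRN ler_pdivrMr ?expR_gt0//.
  apply: (@le_trans _ _ ((1 + 4 * s ^+ 2) * (1 + y))).
    have -> : (1 + 4 * s ^+ 2) * (1 + y) = 1 + 4 * s ^+ 2 + y + z ^+ 2.
      by rewrite /y; field.
    by rewrite lerD2r -addrA lerDl addr_ge0// mulr_ge0// ltW.
  rewrite ler_wpM2l ?expR_ge1Dx// addr_ge0// mulr_ge0// ltW//.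
have -> : (1 + 4 * s ^+ 2) * (normal_peak s / normal_peak (Num.sqrt 2 * s)) *
    (normal_peak (Num.sqrt 2 * s) * expR (- y)) =
    (1 + 4 * s ^+ 2) * (normal_peak s * expR (- y)).
  by field; rewrite gt_eqF.
rewrite [leLHS](_ : _ = ((1 + z ^+ 2) * expR (- y)) * (normal_peak s * expR (- y)));
  last by ring.
by rewrite ler_wpM2r// mulr_ge0 ?expR_ge0// normal_peak_ge0.
Qed.

Lemma integrable_quadratic_growth (g : R -> R) C : 0 <= C ->
  measurable_fun [set: R] g -> (forall z, `|g z| <= C * (1 + z ^+ 2)) ->
  leb.-integrable [set: R] (fun z => (g z * p z)%:E).
Proof.
move=> C0 mg gC.
apply: (@le_integrable _ _ _ leb _ measurableT _
    (fun z => (C * tail_cst)%:E * (q z)%:E)%E).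
- by apply/measurable_EFinP; apply: measurable_funM => //; exact: measurable_normal_pdf.
- move=> z _ /=; rewrite lee_fin normrM (ger0_norm (normal_pdf_ge0 _ _ _)).
  apply: (@le_trans _ _ (C * (1 + z ^+ 2) * p z)).
    by rewrite ler_wpM2r// normal_pdf_ge0.
  rewrite -mulrA; apply: (@le_trans _ _ (C * (tail_cst * q z))).
    by rewrite ler_wpM2l// normal_pdf_tail.
  by rewrite mulrA ler_norm.
- by apply: integrableZl => //; exact: integrable_normal_pdf.
Qed.

Lemma is_derive_normal_pdf (z : R) : is_derive z 1 p (- (z / s ^+ 2) * p z).
Proof.
rewrite normal_pdfE//.
have -> : - (z / s ^+ 2) * (normal_peak s * normal_fun 0 s z) =
   normal_peak s * (expR (- (z - 0) ^+ 2 / (s ^+ 2 *+ 2)) *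
     (- (2 * z) / (s ^+ 2 *+ 2))).
  by rewrite /normal_fun; field.
rewrite /normal_fun; apply: is_deriveZ.
have -> : (fun x : R => expR (- (x - 0) ^+ 2 / (s ^+ 2 *+ 2))) =
   expR \o (fun x => - (x ^+ 2) / (s ^+ 2 *+ 2)).
  by apply/funext => x /=; rewrite subr0.
rewrite subr0; apply: is_derive1_comp.
by apply: is_derive_eq; rewrite /GRing.scale/=; field.
Qed.

Section by_parts.
Variables (F F' : R -> R) (C : R).
Hypotheses (C0 : 0 <= C) (dF : forall z : R, is_derive z 1 F (F' z)).
Hypotheses (cF' : continuous F').
Hypotheses (FC : forall z, `|F z| <= C * (1 + `|z|)).
Hypotheses (F'C : forall z, `|F' z| <= C).

Let cF : continuous F.
Proof.
move=> z; apply: differentiable_continuous.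
exact/derivable1_diffP/(@ex_derive _ _ _ _ _ _ _ (dF z)).
Qed.

Let mF : measurable_fun [set: R] F. Proof. exact: continuous_measurable_fun. Qed.
Let mF' : measurable_fun [set: R] F'. Proof. exact: continuous_measurable_fun. Qed.

Let le_norm1 (z : R) : `|z| * (1 + `|z|) <= 2 * (1 + z ^+ 2).
Proof.
rewrite -(real_normK (num_real z)); move: (normr_ge0 z) => /=; move: `|z| => y y0.
by have := sqr_ge0 (y - 1); nra.
Qed.

Lemma normal_byparts_integrable :
  leb.-integrable [set: R] (fun z => (z * F z * p z)%:E) /\
  leb.-integrable [set: R] (fun z => (F' z * p z)%:E).
Proof.
split.
  apply: (@integrable_quadratic_growth _ (C * 2)).
  - by rewrite mulr_ge0.
  - exact: measurable_funM.
  - move=> z; rewrite normrM -mulrA.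
    apply: (@le_trans _ _ (`|z| * (C * (1 + `|z|)))); first by rewrite ler_wpM2l.
    by rewrite mulrCA ler_wpM2l.
apply: (@integrable_quadratic_growth _ C) => // z.
apply: (le_trans (F'C z)); rewrite ler_peMr// lerDl sqr_ge0//.
Qed.

(** Since [p' = - (z / s^2) p], the integrand that separates the two sides of Stein's identity is
    the exact derivative of [G], and [G] vanishes at infinity. *)
Let g z : R := (z * F z - s ^+ 2 * F' z) * p z.
Let G z : R := - s ^+ 2 * (F z * p z).

Let dG (z : R) : is_derive z 1 G (g z).
Proof.
have dp := is_derive_normal_pdf z.
have dFz := dF z.
have : is_derive z 1 (fun z => F z * p z) (F z *: (- (z / s ^+ 2) * p z) + p z *: F' z).
  exact: is_deriveM.
move=> h; have : is_derive z 1 G (- s ^+ 2 *: (F z *: (- (z / s ^+ 2) * p z) + p z *: F' z)).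
  exact: is_deriveZ.
rewrite /g /GRing.scale/=; congr is_derive.
by field.
Qed.

Let cp : continuous p. Proof. exact: continuous_normal_pdf. Qed.

Let cg : continuous g.
Proof.
move=> z; apply: cvgM; last exact: cp.
by apply: cvgB; apply: cvgM; [exact: cvg_id|exact: cF|exact: cvg_cst|exact: cF'].
Qed.

Let ig : leb.-integrable [set: R] (EFin \o g).
Proof.
have [i1 i2] := normal_byparts_integrable.
have -> : EFin \o g = (fun z => (z * F z * p z)%:E - (s ^+ 2)%:E * (F' z * p z)%:E)%E.
  by apply/funext => z; rewrite /= /g; congr EFin; ring.
by apply: integrableB => //; exact: integrableZl.
Qed.

(** The endpoints use [n.+1] so that the interval is nondegenerate from [n = 0] on. *)
Let FTC n : (\int[leb]_(z in `[(- n.+1%:R)%R, n.+1%:R%R]) (g z)%:E =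
  (G n.+1%:R - G (- n.+1%:R))%:E)%E.
Proof.
rewrite (@continuous_FTC2 _ g G).
- by rewrite EFinB.
- by rewrite ltrNl -subr_gt0 opprK addr_gt0.
- by apply: continuous_subspaceT => z; exact: cg.
- have cG z : {for z, continuous G}.
    by apply: differentiable_continuous; apply/derivable1_diffP; exact: ex_derive.
  split.
  + by move=> z _; exact: ex_derive.
  + by apply: cvg_at_right_filter; exact: cG.
  + by apply: cvg_at_left_filter; exact: cG.
- by move=> z _; rewrite derive1E; exact: derive_val.
Qed.

(** [F] grows at most linearly and [(1 + |z|)^2 <= 2 (1 + z^2)], so the quadratic tail bound leaves
    one factor [1 + |z|] to spare: enough decay for the boundary terms. *)
Let Gbound z : `|G z| <= s ^+ 2 * (2 * C * tail_cst * normal_peak (Num.sqrt 2 * s)) * (1 + `|z|)^-1.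
Proof.
rewrite /G normrM normrN (ger0_norm (ltW s20)) -[leRHS]mulrA ler_wpM2l ?(ltW s20)//.
rewrite normrM (ger0_norm (normal_pdf_ge0 _ _ _)).
rewrite ler_pdivlMr ?ltr_wpDr//.
apply: (@le_trans _ _ (C * (1 + `|z|) * p z * (1 + `|z|))).
  by rewrite ler_wpM2r ?addr_ge0// ler_wpM2r// normal_pdf_ge0.
apply: (@le_trans _ _ (2 * C * ((1 + z ^+ 2) * p z))).
  rewrite [leLHS](_ : _ = C * p z * (1 + `|z|) ^+ 2); last by ring.
  rewrite [leRHS](_ : _ = C * p z * (2 * (1 + z ^+ 2))); last by ring.
  rewrite ler_wpM2l ?mulr_ge0 ?normal_pdf_ge0//.
  rewrite -(real_normK (num_real z)); move: `|z| => y.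
  by have := sqr_ge0 (y - 1); nra.
rewrite -[leRHS]mulrA ler_wpM2l ?mulr_ge0//.
apply: (le_trans (normal_pdf_tail z)); rewrite ler_wpM2l ?tail_cst_ge0//.
exact: normal_pdf_ub.
Qed.

Let G0 : (fun n => G n.+1%:R - G (- n.+1%:R)) @ \oo --> (0 : R).
Proof.
pose K := s ^+ 2 * (2 * C * tail_cst * normal_peak (Num.sqrt 2 * s)).
have K0 : 0 <= K.
  apply: mulr_ge0; first exact: ltW.
  apply: mulr_ge0; last exact: normal_peak_ge0.
  by apply: mulr_ge0 (tail_cst_ge0); exact: mulr_ge0.
apply: norm_cvg0; apply: (@squeeze_cvgr _ _ _ _ (fun=> 0) (fun n => (2 * K) * n.+1%:R^-1)).
- near=> n; rewrite normr_ge0/=.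
  apply: (le_trans (ler_normB _ _)).
  have h (y : R) : `|y| = n.+1%:R -> `|G y| <= K / n.+1%:R.
    move=> yn; apply: (le_trans (Gbound y)); rewrite ler_wpM2l// yn.
    by rewrite lef_pV2 ?posrE ?lerDr// ltr_wpDr.
  rewrite mulrDl mul1r mulrDl lerD ?h// ?normrN ger0_norm//.
- exact: cvg_cst.
- by rewrite -[0](mulr0 (2 * K)); apply: cvgM; [exact: cvg_cst|exact: cvg_harmonic].
Unshelve. all: by end_near. Qed.

(** Dominated convergence along the intervals of [FTC], with [g] itself as the dominating
    function. *)
Lemma normal_byparts_leb : (\int[leb]_z (g z)%:E = 0)%E.
Proof.
pose gn n := (EFin \o g) \_ `[- n.+1%:R, n.+1%:R : R].
have mg : measurable_fun [set: R] (EFin \o g) by case/integrableP : ig.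
have mgn n : measurable_fun [set: R] (gn n).
  by apply/(measurable_restrictT _ _).1 => //; exact: measurable_funTS.
have gng : {ae leb, forall z, [set: R] z -> gn ^~ z @ \oo --> (EFin \o g) z}.
  apply: aeW => z _; apply: cvg_near_cst; near=> n.
  rewrite /gn patchE ifT// inE/= in_itv/= -ler_norml.
  apply: (@le_trans _ _ n%:R); last by rewrite ler_nat.
  by near: n; exact: nbhs_infty_ger.
have gnle : {ae leb, forall z n, [set: R] z -> (`|gn n z| <= (abse \o (EFin \o g)) z)%E}.
  apply: aeW => z n _; rewrite /gn patchE; case: ifP => // _.
  by rewrite abse0; exact: abse_ge0.
have [_ _ lim] := @dominated_convergence _ _ _ leb _ measurableT _ _ _ mgn mg gng
  (integrable_abse ig) gnle.
apply: (cvg_unique _ lim) => //.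
have -> : (fun n => \int[leb]_x gn n x)%E = (fun n => (G n.+1%:R - G (- n.+1%:R))%:E).
  by apply/funext => n; rewrite -integral_mkcond FTC.
by apply: cvg_EFin; [exact: nearW|exact: G0].
Unshelve. all: by end_near. Qed.

Local Notation gam := (normal_prob 0 s).

Lemma normal_integrable_byparts :
  gam.-integrable [set: R] (fun z => (z * F z)%:E) /\
  gam.-integrable [set: R] (fun z => (F' z)%:E).
Proof.
have [i1 i2] := normal_byparts_integrable.
split.
  apply: (@integrable_density _ _ _ leb gam p) => //.
  - exact: normal_pdf_ge0.
  - exact: measurable_normal_pdf.
  - exact: measurable_funM.
apply: (@integrable_density _ _ _ leb gam p) => //.
- exact: normal_pdf_ge0.
- exact: measurable_normal_pdf.
Qed.

Lemma normal_byparts :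
  (\int[gam]_z (z * F z)%:E = (s ^+ 2)%:E * \int[gam]_z (F' z)%:E)%E.
Proof.
have [i1 i2] := normal_byparts_integrable.
rewrite (@integral_density _ _ _ leb gam p)//; last 3 first.
- exact: normal_pdf_ge0.
- exact: measurable_normal_pdf.
- exact: measurable_funM.
rewrite (@integral_density _ _ _ leb gam p)//; last 2 first.
- exact: normal_pdf_ge0.
- exact: measurable_normal_pdf.
rewrite -integralZl//.
have i2' : leb.-integrable [set: R] (fun z => (s ^+ 2)%:E * (F' z * p z)%:E)%E.
  exact: integrableZl.
have fA := integrable_fin_num measurableT i1.
have fB := integrable_fin_num measurableT i2'.
have : (\int[leb]_z (z * F z * p z)%:E -
    \int[leb]_z ((s ^+ 2)%:E * (F' z * p z)%:E) = 0)%E.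
  rewrite -integralB// -normal_byparts_leb; apply: eq_integral => z _.
  by rewrite /= /g; congr EFin; ring.
rewrite -(fineK fA) -(fineK fB) -EFinB => -[] /eqP.
by rewrite subr_eq0 => /eqP ->.
Qed.

End by_parts.

End gaussian.

(** * Independence, conditioning on coordinates, and Stein's lemma for a Gaussian family *)

Section independent_pair.
Context d d1 d2 (T : measurableType d) (T1 : measurableType d1)
  (T2 : measurableType d2) {R : realType} (P : probability T R).
Variables (W : {mfun T >-> T1}) (V : {mfun T >-> T2}).
Hypothesis WV : forall A B, measurable A -> measurable B ->
  (P (W @^-1` A `&` V @^-1` B) = P (W @^-1` A) * P (V @^-1` B))%E.

Definition joint (w : T) := (W w, V w).

Let mWV : measurable_fun [set: T] joint.
Proof. exact: measurable_fun_pair. Qed.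
HB.instance Definition _ := isMeasurableFun.Build _ _ _ _ joint mWV.

Lemma joint_distribution A : measurable A ->
  (distribution P W \x distribution P V)%E A =
  distribution P joint A.
Proof.
apply: product_measure_unique => A1 A2 mA1 mA2.
by rewrite /distribution /pushforward -WV.
Qed.

Lemma integrable_joint (f : T1 * T2 -> R) : measurable_fun setT f ->
  P.-integrable setT (fun w => (f (W w, V w))%:E) ->
  (distribution P W \x distribution P V)%E.-integrable setT (EFin \o f).
Proof.
move=> mf intf.
have mf' : measurable_fun setT (EFin \o f) by exact/measurable_EFinP.
have /integrableP[_ foo] : (pushforward P joint).-integrable setT (EFin \o f).
  by apply: integrable_pushforward => //; rewrite preimage_setT.
apply/integrableP; split => //; apply: le_lt_trans foo.
rewrite le_eqVlt; apply/orP; left; apply/eqP.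
by apply: eq_measure_integral => A mA _; exact: joint_distribution.
Qed.

Lemma integral_joint (f : T1 * T2 -> R) : measurable_fun setT f ->
  P.-integrable setT (fun w => (f (W w, V w))%:E) ->
  (\int[P]_w (f (W w, V w))%:E =
   \int[distribution P W]_x \int[distribution P V]_y (f (x, y))%:E)%E.
Proof.
move=> mf intf.
have mf' : measurable_fun setT (EFin \o f) by exact/measurable_EFinP.
transitivity (\int[pushforward P joint]_z (f z)%:E)%E.
  by rewrite integral_pushforward//= ?preimage_setT.
transitivity (\int[(distribution P W \x distribution P V)%E]_z (f z)%:E)%E.
  by apply: eq_measure_integral => A mA _; exact/esym/joint_distribution.
rewrite -(@integral12_prod_meas1 _ _ _ _ _ (distribution P W) (distribution P V)
  (EFin \o f))//; exact: integrable_joint.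
Qed.

(** By Tonelli for the product law, integrability of each factor is enough; no second moments
    enter. *)
Lemma integrable_joint_prod (u : T1 -> R) (v : T2 -> R) :
  measurable_fun setT u -> measurable_fun setT v ->
  P.-integrable setT (EFin \o (u \o W)) ->
  P.-integrable setT (EFin \o (v \o V)) ->
  P.-integrable setT (fun w => (u (W w) * v (V w))%:E).
Proof.
move=> mu mv iu iv.
have mf : measurable_fun setT (fun z : T1 * T2 => `|(u z.1 * v z.2)%:E|%E).
  apply: measurableT_comp => //; apply/measurable_EFinP; apply: measurable_funM.
    exact: measurableT_comp.
  exact: measurableT_comp.
apply/integrableP; split.
  apply/measurable_EFinP; apply: measurable_funM; exact: measurableT_comp.
have -> : (\int[P]_w `|(u (W w) * v (V w))%:E| =
   \int[distribution P W]_x \int[distribution P V]_y `|(u x * v y)%:E|)%E.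
  transitivity (\int[pushforward P joint]_z `|(u z.1 * v z.2)%:E|)%E.
    by rewrite ge0_integral_pushforward ?preimage_setT.
  transitivity (\int[(distribution P W \x distribution P V)%E]_z `|(u z.1 * v z.2)%:E|)%E.
    by apply: eq_measure_integral => A mA _; exact/esym/joint_distribution.
  rewrite -(fubini_tonelli1 (fun z : T1 * T2 => `|(u z.1 * v z.2)%:E|%E))//.
have mav : measurable_fun [set: T2] (fun y => `|(v y)%:E|%E).
  by apply: measurableT_comp => //; exact/measurable_EFinP.
have mau : measurable_fun [set: T1] (fun y => `|(u y)%:E|%E).
  by apply: measurableT_comp => //; exact/measurable_EFinP.
have -> : (\int[distribution P W]_x \int[distribution P V]_y `|(u x * v y)%:E| =
   (\int[P]_w `|(u (W w))%:E|) * \int[P]_w `|(v (V w))%:E|)%E.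
  under eq_integral => x _.
    under eq_integral do rewrite EFinM abseM.
    rewrite ge0_integralZl//; over.
  rewrite ge0_integralZr//; last exact: integral_ge0.
  by congr (_ * _)%E; rewrite ge0_integral_pushforward ?preimage_setT.
move: iu iv => /integrableP[_ iu] /integrableP[_ iv].
by apply: lte_mul_pinfty => //; [exact: integral_ge0|rewrite ge0_fin_numE//; exact: integral_ge0].
Qed.

Lemma integral_joint_prod (u : T1 -> R) (v : T2 -> R) :
  measurable_fun setT u -> measurable_fun setT v ->
  P.-integrable setT (EFin \o (u \o W)) ->
  P.-integrable setT (EFin \o (v \o V)) ->
  (\int[P]_w (u (W w) * v (V w))%:E =
   (\int[P]_w (u (W w))%:E) * \int[P]_w (v (V w))%:E)%E.
Proof.
move=> mu mv iu iv.
have iu' : (distribution P W).-integrable setT (EFin \o u).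
  by apply: integrable_pushforward => //; exact/measurable_EFinP.
have iv' : (distribution P V).-integrable setT (EFin \o v).
  by apply: integrable_pushforward => //; exact/measurable_EFinP.
rewrite (integral_joint (f := fun z => u z.1 * v z.2))//=; last 2 first.
- by apply: measurable_funM; exact: measurableT_comp.
- exact: integrable_joint_prod.
have -> : (\int[P]_w (v (V w))%:E = \int[distribution P V]_y (v y)%:E)%E.
  rewrite integral_pushforward ?preimage_setT//.
  exact/measurable_EFinP.
have -> : (\int[P]_w (u (W w))%:E = \int[distribution P W]_y (u y)%:E)%E.
  rewrite integral_pushforward ?preimage_setT//.
  exact/measurable_EFinP.
have fv := integrable_fin_num measurableT iv'.
rewrite -(fineK fv) -integralZr//; apply: eq_integral => x _.
rewrite /= fineK// -integralZl//.
Qed.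

End independent_pair.

Section resampling.
Context d (T : measurableType d) {R : realType} (P : probability T R).
Context (I : finType) (Z : I -> {RV P >-> R}).
Hypothesis Zind : mutually_independent Z.
Variable i : I.

(** Pi-system generating the sigma-algebra of all coordinates other than [i]. Those coordinates are
    then encoded as the identity map [idT] into [T] with this coarser sigma-algebra, which avoids a
    product of copies of [R] indexed by a finite type. *)
Definition others_rectangle : set (set T) :=
  [set A | exists2 B : I -> set R, (forall j, measurable (B j)) &
    A = [set w | forall j, j != i -> B j (Z j w)]].

Let mrect : others_rectangle `<=` measurable.
Proof.
move=> _ [B mB ->].
have -> : [set w | forall j, j != i -> B j (Z j w)] =
    \bigcap_(j in [set` [set~ i]%SET]) (Z j @^-1` B j).
  apply/seteqP; split => w /= h j; first by rewrite /= !inE; exact: h.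
  by move=> ji; apply: h; rewrite /= !inE.
apply: fin_bigcap_measurable => // j _.
by rewrite -[X in measurable X]setTI; exact: measurable_funP.
Qed.

Let rectI : setI_closed others_rectangle.
Proof.
move=> _ _ [B mB ->] [C mC ->]; exists (fun j => B j `&` C j).
  by move=> j; exact: measurableI.
apply/seteqP; split => w /=; first by move=> [h1 h2] j ji; split; [exact: h1|exact: h2].
by move=> h; split => j ji; have [] := h j ji.
Qed.

Let rectT : others_rectangle setT.
Proof. by exists (fun=> setT) => //; apply/seteqP; split. Qed.

Let idT : T -> g_sigma_algebraType others_rectangle := id.

Let midT : measurable_fun [set: T] idT.
Proof.
move=> _ A mA; rewrite setTI.
by apply: (smallest_sub (@sigma_algebra_measurable _ T) mrect).
Qed.
HB.instance Definition _ := isMeasurableFun.Build _ _ _ _ idT midT.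

Lemma measurable_others j : j != i ->
  measurable_fun [set: g_sigma_algebraType others_rectangle] (Z j).
Proof.
move=> ji _ B mB; rewrite setTI; apply: sub_sigma_algebra.
exists (fun k => if k == j then B else setT); first by move=> k; case: ifP.
apply/seteqP; split => w /=.
  by move=> BZ k ki; case: eqP => // ->.
by move=> /(_ j ji); rewrite eqxx.
Qed.

(** For fixed [B] both sides are finite measures in [A], namely [mrestr] and [mscale] of [P]. They
    agree on the pi-system of rectangles by mutual independence, hence on the sigma-algebra it
    generates. *)
Lemma others_independent A B : <<s others_rectangle >> A -> measurable B ->
  (P (A `&` Z i @^-1` B) = P A * P (Z i @^-1` B))%E.
Proof.
move=> mA mB.
have mD : measurable (Z i @^-1` B).
  by rewrite -[X in measurable X]setTI; exact: measurable_funP.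
have fD : P (Z i @^-1` B) \is a fin_num by exact: fin_num_measure.
have f0 : 0 <= fine (P (Z i @^-1` B)) by rewrite fine_ge0.
have -> : (P (A `&` Z i @^-1` B) = mrestr P mD A)%E by [].
have -> : (P A * P (Z i @^-1` B) = mscale (NngNum f0) P A)%E.
  by rewrite /mscale/= fineK// muleC.
move: A mA; apply: (g_sigma_algebra_measure_unique others_rectangle mrect (fun=> setT)) => //.
- by apply: bigcup_const; exists 0%N.
- move=> A' [C mC A'E].
  transitivity (P A' * P (Z i @^-1` B))%E; last by rewrite muleC -{1}(fineK fD).
  rewrite -[LHS]/(P (A' `&` Z i @^-1` B)) A'E.
  have := Zind (J := [set: I]%SET) (B := fun j => if j == i then B else C j).
  have := Zind (J := [set~ i]%SET) (B := C).
  move=> /(_ (fun j _ => mC j)) EC.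
  move=> /(_ ltac:(by move=> j _; case: ifP)) EB.
  have -> : [set w | forall j, j != i -> C j (Z j w)] =
      \bigcap_(j in [set` [set~ i]%SET]) (Z j @^-1` C j).
    apply/seteqP; split => w /= h j; first by rewrite /= !inE; exact: h.
    by move=> ji; apply: h; rewrite /= !inE.
  rewrite EC.
  have -> : \bigcap_(j in [set` [set~ i]%SET]) (Z j @^-1` C j) `&` Z i @^-1` B =
    \bigcap_(j in [set` [set: I]%SET]) (Z j @^-1` (if j == i then B else C j)).
    apply/seteqP; split => w /=.
      move=> [h1 h2] j _ /=; case: eqP => [->//|/eqP ji].
      by apply: h1; rewrite /= !inE.
    move=> h; split; last by have := h i; rewrite /= eqxx inE; apply.
    move=> j; rewrite /= !inE => ji.
    by have := h j; rewrite /= (negbTE ji) inE; apply.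
  rewrite EB (bigD1 i)//= eqxx muleC; congr (_ * _)%E.
  apply: eq_big => [j|j]; first by rewrite !inE.
  by rewrite !inE => /negbTE ->.
- move=> _; rewrite -[X in (X < _)%E]/(P (setT `&` Z i @^-1` B)).
  by rewrite setTI ltey_eq fD.
Qed.

Definition resample (w : T) (z : R) : I -> R :=
  fun j => if j == i then z else Z j w.

Lemma resample_id w : resample w (Z i w) = Z ^~ w.
Proof. by apply/funext => j; rewrite /resample; case: eqP => [->|]. Qed.

(* [F] is measurable for the product sigma-algebra *)
Definition measurable_functional (F : (I -> R) -> R) :=
  forall d' (S : measurableType d') (Y : I -> S -> R),
    (forall j, measurable_fun [set: S] (Y j)) ->
    measurable_fun [set: S] (fun s => F (Y ^~ s)).

(** Freezes every coordinate but [i], so that a one-dimensional identity can be applied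
    conditionally on the others. *)
Lemma integral_resample (F : (I -> R) -> R) : measurable_functional F ->
  P.-integrable setT (fun w => (F (Z ^~ w))%:E) ->
  (\int[P]_w (F (Z ^~ w))%:E =
   \int[P]_w \int[distribution P (Z i)]_z (F (resample w z))%:E)%E.
Proof.
move=> mF iF.
pose f (wz : g_sigma_algebraType others_rectangle * R) := F (resample wz.1 wz.2).
have mf : measurable_fun setT f.
  apply: mF => j; rewrite /resample.
  have [ji|ji] := eqVneq j i; first exact: measurable_snd.
  by apply: measurableT_comp => //; exact: measurable_others.
have ind A B : measurable A -> measurable B ->
    (P (idT @^-1` A `&` Z i @^-1` B) = P (idT @^-1` A) * P (Z i @^-1` B))%E.
  exact: others_independent.
have E w : F (Z ^~ w) = f (idT w, Z i w) by rewrite /f/= resample_id.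
have iF' : P.-integrable setT (fun w => (f (idT w, Z i w))%:E).
  rewrite (_ : (fun w => _) = fun w => (F (Z ^~ w))%:E)//.
  by apply/funext => w; rewrite E.
under eq_integral do rewrite E.
rewrite (integral_joint ind mf iF').
pose g := fubini_F (distribution P (Z i)) (EFin \o f).
have ig : (distribution P idT).-integrable setT g.
  exact/integrable_fubini_F/(integrable_joint ind).
have mg := measurable_int _ ig.
rewrite [LHS](integral_pushforward midT mg) ?preimage_setT//.
apply/integrableP; split.
  by apply: measurableT_comp => //; exact: midT.
move/integrableP : ig => [_]; apply: le_lt_trans.
rewrite ge0_integral_pushforward ?preimage_setT//.
exact: measurableT_comp.
Qed.

End resampling.

Section gaussian_family.
Context d (T : measurableType d) {R : realType} (P : probability T R).
Context (I : finType) (Z : I -> {RV P >-> R}) (v : R).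
Hypotheses (v0 : 0 < v) (Znormal : iid_centered_normal Z v).

Let s0 : Num.sqrt v != 0. Proof. by rewrite gt_eqF// sqrtr_gt0. Qed.
Let s2 : Num.sqrt v ^+ 2 = v. Proof. by rewrite sqr_sqrtr// ltW. Qed.
Local Notation gam := (normal_prob 0 (Num.sqrt v)).

(* [normal_prob] lives on [measurableTypeR R], whose display differs from the
   one of [R] although the measurable sets are the same. *)
Let idR : R -> measurableTypeR R := id.

Let midR : measurable_fun [set: R] idR. Proof. by move=> _ A mA; rewrite setTI. Qed.

Lemma ge0_integral_coordinate i (g : R -> \bar R) : (forall z, 0 <= g z)%E ->
  measurable_fun [set: R] g ->
  (\int[distribution P (Z i)]_z g z = \int[gam]_z g z)%E.
Proof.
move=> g0 mg.
transitivity (\int[pushforward (distribution P (Z i)) idR]_z g z)%E.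
  by rewrite (ge0_integral_pushforward midR) ?preimage_setT.
by apply: eq_measure_integral => A mA _; exact: Znormal.2.
Qed.

Lemma integral_coordinate i (g : R -> \bar R) : measurable_fun [set: R] g ->
  (\int[distribution P (Z i)]_z g z = \int[gam]_z g z)%E.
Proof.
move=> mg; rewrite integralE [RHS]integralE.
by congr (_ - _)%E; apply: ge0_integral_coordinate => //;
  [exact: measurable_funepos|exact: measurable_funeneg].
Qed.

Lemma integrable_coordinate i (g : R -> R) : measurable_fun setT g ->
  gam.-integrable setT (EFin \o g) -> P.-integrable setT (EFin \o (g \o Z i)).
Proof.
move=> mg /integrableP[_ goo]; apply/integrableP; split.
  by apply/measurable_EFinP; exact: measurableT_comp.
apply: le_lt_trans goo; rewrite -(ge0_integral_coordinate i)//; last first.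
  by apply: measurableT_comp => //; exact/measurable_EFinP.
rewrite ge0_integral_pushforward ?preimage_setT//.
by apply: measurableT_comp => //; exact/measurable_EFinP.
Qed.

Lemma integral_coordinate_comp i (g : R -> R) : measurable_fun setT g ->
  gam.-integrable setT (EFin \o g) ->
  (\int[P]_w (g (Z i w))%:E = \int[gam]_z (g z)%:E)%E.
Proof.
move=> mg ig; rewrite -(integral_coordinate i); last exact/measurable_EFinP.
rewrite integral_pushforward ?preimage_setT//.
- exact/measurable_EFinP.
- exact: integrable_coordinate.
Qed.

(** Stein's identity yields the moments: [F = 1] gives the mean and [F = id] the variance. *)
Let id_moments :
  [/\ gam.-integrable setT (EFin \o @id R),
      (\int[gam]_z z%:E = 0)%E,
      gam.-integrable setT (fun z => (z * z)%:E) &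
      (\int[gam]_z (z * z)%:E = v%:E)%E].
Proof.
have d1 (z : R) : is_derive z 1 (fun=> 1 : R) 0 by exact: is_derive_cst.
have d2 (z : R) : is_derive z 1 (@id R) 1 by exact: is_derive_id.
have c0 (c : R) : continuous (fun _ : R => c) by exact: cst_continuous.
have b1 (z : R) : `|1| <= 1 * (1 + `|z|) :> R by rewrite normr1 mul1r lerDl.
have b2 (z : R) : `|z| <= 1 * (1 + `|z|) by rewrite mul1r lerDr.
have b3 (z : R) : `|0 : R| <= 1 by rewrite normr0.
have b4 (z : R) : `|1 : R| <= 1 by rewrite normr1.
have [i1 _] := normal_integrable_byparts s0 ler01 d1 (c0 0) b1 b3.
have E1 := normal_byparts s0 ler01 d1 (c0 0) b1 b3.
have [i2 _] := normal_integrable_byparts s0 ler01 d2 (c0 1) b2 b4.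
have E2 := normal_byparts s0 ler01 d2 (c0 1) b2 b4.
split => //.
- by under [X in integrable _ _ X]eq_fun do rewrite /= -[X in X%:E]mulr1.
- under eq_integral do rewrite -[X in X%:E]mulr1.
  by rewrite E1 integral0 mule0.
- rewrite E2 s2 integral_cst// mul1e.
  by rewrite [X in (_ * X)%E](@probability_setT _ _ _ gam) mule1.
Qed.

Lemma gaussian_integrable i : P.-integrable setT (fun w => (Z i w)%:E).
Proof. by have [h _ _ _] := id_moments; exact: (integrable_coordinate i _ h). Qed.

Lemma gaussian_mean i : (\int[P]_w (Z i w)%:E = 0)%E.
Proof.
have [h E _ _] := id_moments.
by rewrite (integral_coordinate_comp i (g := id)).
Qed.

Lemma coordinates_independent i j A B : i != j -> measurable A -> measurable B ->
  (P (Z i @^-1` A `&` Z j @^-1` B) = P (Z i @^-1` A) * P (Z j @^-1` B))%E.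
Proof.
move=> ij mA mB.
have := Znormal.1 [set i; j]%SET (fun k => if k == i then A else B).
move=> /(_ ltac:(by move=> k _; case: ifP)).
rewrite big_setU1 ?inE//= big_set1 eqxx eq_sym (negbTE ij) => <-.
congr (P _); apply/seteqP; split => w /=.
  move=> [Aw Bw] k /=; rewrite !inE => /orP[|] /eqP ->; first by rewrite eqxx.
  by rewrite eq_sym (negbTE ij).
move=> h; have := h i; have := h j.
by rewrite /= !inE !eqxx orbT eq_sym (negbTE ij) => /(_ isT) ? /(_ isT).
Qed.

Lemma gaussian_covariance i j :
  P.-integrable setT (fun w => (Z i w * Z j w)%:E) /\
  (\int[P]_w (Z i w * Z j w)%:E = (v *+ (i == j))%:E)%E.
Proof.
have [h E h2 E2] := id_moments.
have [<-|ij] := eqVneq i j.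
  split.
    apply: (integrable_coordinate i (g := fun z => z * z)) => //.
    exact: measurable_funM.
  rewrite (integral_coordinate_comp i (g := fun z => z * z))//.
  exact: measurable_funM.
have ind A B := @coordinates_independent i j A B ij.
have mid := @measurable_id _ R setT.
have ii := gaussian_integrable i; have ij' := gaussian_integrable j.
split; first exact: (integrable_joint_prod ind mid mid ii ij').
by rewrite (integral_joint_prod ind mid mid ii ij') gaussian_mean mul0e mulr0n.
Qed.

Definition update (f : I -> R) (i : I) (z : R) : I -> R :=
  fun j => if j == i then z else f j.

(** One-dimensional integration by parts with the other coordinates frozen: [update (Z ^~ w) i] and
    [resample Z i w] are the same function by conversion. Bounds on [F] and [F'] provide
    integrability on both sides. *)
Lemma stein i (F F' : (I -> R) -> R) (C : R) : 0 <= C ->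
  measurable_functional F -> measurable_functional F' ->
  (forall f z, is_derive (z : R) 1 (fun z => F (update f i z)) (F' (update f i z))) ->
  (forall f, continuous (fun z => F' (update f i z))) ->
  (forall f, `|F f| <= C) -> (forall f, `|F' f| <= C) ->
  [/\ P.-integrable setT (fun w => (Z i w * F (Z ^~ w))%:E),
      P.-integrable setT (fun w => (F' (Z ^~ w))%:E) &
      \int[P]_w (Z i w * F (Z ^~ w)) = v * \int[P]_w F' (Z ^~ w)].
Proof.
move=> C0 mF mF' dF cF' FC F'C.
have mFZ : measurable_fun setT (fun w => F (Z ^~ w)) by exact: mF.
have mF'Z : measurable_fun setT (fun w => F' (Z ^~ w)) by exact: mF'.
have iZF : P.-integrable setT (fun w => (Z i w * F (Z ^~ w))%:E).
  apply: (@le_integrable _ _ _ P _ measurableT _ (fun w => (C%:E * (Z i w)%:E)%E)).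
  - by apply/measurable_EFinP; exact: measurable_funM.
  - move=> w _ /=; rewrite lee_fin !normrM mulrC ler_pM//.
    by rewrite (ger0_norm C0).
  - by apply: integrableZl => //; exact: gaussian_integrable.
have iF' : P.-integrable setT (fun w => (F' (Z ^~ w))%:E).
  apply: (@le_integrable _ _ _ P _ measurableT _ (fun w => C%:E)).
  - exact/measurable_EFinP.
  - by move=> w _ /=; rewrite lee_fin (ger0_norm C0).
  - exact: finite_measure_integrable_cst.
split => //.
pose H (f : I -> R) := f i * F f.
have mH : measurable_functional H.
  by move=> d' S Y mY; apply: measurable_funM => //; exact: mF.
pose H' (f : I -> R) := v * F' f.
have mH' : measurable_functional H'.
  by move=> d' S Y mY; apply: measurable_funM => //; exact: mF'.
have mres (K : (I -> R) -> R) w : measurable_functional K ->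
    measurable_fun setT (fun z => (K (resample Z i w z))%:E).
  move=> mK; apply/measurable_EFinP.
  apply: (mK _ _ (fun j (z : R) => if j == i then z else Z j w)) => j.
  by rewrite /=; have [_|_] := eqVneq j i.
rewrite -RintegralZl// /Rintegral; congr fine.
rewrite (@integral_resample _ _ _ P _ _ Znormal.1 i H)//.
rewrite [RHS](@integral_resample _ _ _ P _ _ Znormal.1 i H')//; last first.
  exact: integrableZl iF'.
apply: eq_integral => w _.
rewrite !integral_coordinate; [|exact: (mres _ w mH')|exact: (mres _ w mH)].
have growF z : `|F (update (Z ^~ w) i z)| <= C * (1 + `|z|).
  by apply: (le_trans (FC _)); rewrite ler_peMr// lerDl.
have growF' z : `|F' (update (Z ^~ w) i z)| <= C by [].
have := normal_byparts s0 C0 (dF (Z ^~ w)) (cF' _) growF growF'.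
have [_ ig] := normal_integrable_byparts s0 C0 (dF (Z ^~ w)) (cF' _) growF growF'.
rewrite s2 -integralZl// => <-; apply: eq_integral => z _.
by rewrite /H /resample /= eqxx.
Qed.

End gaussian_family.

(** * Loop equations for the resolvent *)

Section matrix_derivative.
Context {R : realType}.

Definition is_mxderive m n (z : R) (M : R -> 'M[R]_(m, n)) (dM : 'M[R]_(m, n)) :=
  forall i j, is_derive z 1 (fun z => M z i j) (dM i j).

Lemma is_derive_sum_ord n (f : 'I_n -> R -> R) (df : 'I_n -> R) (z : R) :
  (forall i, is_derive z 1 (f i) (df i)) ->
  is_derive z 1 (fun z => \sum_i f i z) (\sum_i df i).
Proof.
move=> h; have -> : (fun z => \sum_i f i z) = \sum_i f i.
  by apply/funext => y; rewrite fct_sumE.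
exact: is_derive_sum.
Qed.

Lemma is_derive_mul (f g : R -> R) (z df dg : R) :
  is_derive z 1 f df -> is_derive z 1 g dg ->
  is_derive z 1 (fun z => f z * g z) (df * g z + f z * dg).
Proof.
move=> hf hg; have := is_deriveM hf hg.
by rewrite /GRing.scale/= addrC (mulrC (g z)).
Qed.

Lemma is_mxderive_mul m n p z (M : R -> 'M[R]_(m, n)) (L : R -> 'M[R]_(n, p)) dM dL :
  is_mxderive z M dM -> is_mxderive z L dL ->
  is_mxderive z (fun z => M z *m L z) (dM *m L z + M z *m dL).
Proof.
move=> hM hL i j.
have -> : (fun z => (M z *m L z) i j) = (fun z => \sum_k M z i k * L z k j).
  by apply/funext => y; rewrite mxE.
have -> : (dM *m L z + M z *m dL) i j =
    \sum_k (dM i k * L z k j + M z i k * dL k j).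
  by rewrite !mxE big_split.
by apply: is_derive_sum_ord => k; exact: is_derive_mul.
Qed.

Lemma is_mxderive_cst m n z (M : 'M[R]_(m, n)) : is_mxderive z (fun=> M) 0.
Proof. by move=> i j; rewrite mxE; exact: is_derive_cst. Qed.

Lemma is_mxderive_add m n z (M L : R -> 'M[R]_(m, n)) dM dL :
  is_mxderive z M dM -> is_mxderive z L dL ->
  is_mxderive z (fun z => M z + L z) (dM + dL).
Proof.
move=> hM hL i j; rewrite mxE.
have -> : (fun z => (M z + L z) i j) = (fun z => M z i j + L z i j).
  by apply/funext => y; rewrite mxE.
exact: is_deriveD.
Qed.

Lemma is_mxderive_tr m n z (M : R -> 'M[R]_(m, n)) dM :
  is_mxderive z M dM -> is_mxderive z (fun z => (M z)^T) dM^T.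
Proof.
move=> hM i j; rewrite mxE.
have -> : (fun z => (M z)^T i j) = (fun z => M z j i).
  by apply/funext => y; rewrite mxE.
exact: hM.
Qed.

Lemma is_derive_mxtrace n z (M : R -> 'M[R]_n) dM :
  is_mxderive z M dM -> is_derive z 1 (fun z => \tr (M z)) (\tr dM).
Proof. by move=> hM; apply: is_derive_sum_ord => i; exact: hM. Qed.

Lemma derivable_prod_seq (I : Type) (r : seq I) (f : I -> R -> R) (z : R) :
  (forall i, derivable (f i) z 1) -> derivable (fun z => \prod_(i <- r) f i z) z 1.
Proof.
move=> h; elim: r => [|i r IH].
  have -> : (fun z => \prod_(i <- [::]) f i z) = cst 1.
    by apply/funext => y; rewrite big_nil.
  exact: derivable_cst.
have -> : (fun z => \prod_(j <- i :: r) f j z) = f i * (fun z => \prod_(j <- r) f j z).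
  by apply/funext => y; rewrite big_cons.
exact: derivableM.
Qed.

Lemma derivable_det n (M : R -> 'M[R]_n) z :
  (forall i j, derivable (fun z => M z i j) z 1) ->
  derivable (fun z => \det (M z)) z 1.
Proof.
move=> h; rewrite /determinant.
have -> : (fun z => \sum_(s : 'S_n) (-1) ^+ s * \prod_i M z i (s i)) =
    \sum_(s : 'S_n) ((fun=> (-1) ^+ s) * (fun z => \prod_i M z i (s i))).
  by apply/funext => y; rewrite fct_sumE.
elim/big_ind : _ => [|f g hf hg|s _].
- exact: derivable_cst.
- exact: derivableD.
- by apply: derivableM; [exact: derivable_cst|exact: derivable_prod_seq].
Qed.

Lemma derivable_invmx n (M : R -> 'M[R]_n) z : (forall z, M z \in unitmx) ->
  (forall i j, derivable (fun z => M z i j) z 1) ->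
  forall i j, derivable (fun z => invmx (M z) i j) z 1.
Proof.
move=> Mu h i j.
have -> : (fun z => invmx (M z) i j) =
   (fun z => (\det (M z))^-1) * (fun z => cofactor (M z) j i).
  by apply/funext => y; rewrite /invmx Mu !mxE.
apply: derivableM.
  apply: derivableV; last exact: derivable_det.
  by have := Mu z; rewrite unitmxE unitfE.
rewrite /cofactor; apply: derivableM; first exact: derivable_cst.
apply: derivable_det => k l; rewrite (_ : (fun z => _) = fun z => M z (lift j k) (lift i l))//.
by apply/funext => y; rewrite !mxE.
Qed.

(** Cramer's formula shows that the derivative exists; differentiating [invmx M *m M = 1] then
    identifies it. *)
Lemma is_mxderive_invmx n (M : R -> 'M[R]_n) z dM : (forall z, M z \in unitmx) ->
  is_mxderive z M dM ->
  is_mxderive z (fun z => invmx (M z)) (- (invmx (M z) *m dM *m invmx (M z))).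
Proof.
move=> Mu hM.
have dV i j : derivable (fun z => invmx (M z) i j) z 1.
  by apply: derivable_invmx => // k l; have := hM k l => ?; exact: ex_derive.
pose dL := \matrix_(i, j) ('D_1 (fun z => invmx (M z) i j) z).
have hL : is_mxderive z (fun z => invmx (M z)) dL.
  by move=> i j; rewrite mxE; exact/derivableP.
suff -> : - (invmx (M z) *m dM *m invmx (M z)) = dL by [].
have h1 := is_mxderive_mul hL hM.
have : dL *m M z + invmx (M z) *m dM = 0.
  apply/matrixP => i j; rewrite -[LHS](derive_val (is_derive := h1 i j)).
  have -> : (fun z => (invmx (M z) *m M z) i j) = cst ((1%:M : 'M[R]_n) i j).
    by apply/funext => y; rewrite mulVmx.
  by rewrite derive_cst mxE.
move/eqP; rewrite addr_eq0 => /eqP E.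
by rewrite -mulNmx -E mulmxK.
Qed.

End matrix_derivative.

Section euclidean_product.
Context {R : realType}.

Lemma dotc_delta n (i : 'I_n) : dotc (delta_mx i 0) (delta_mx i 0 : 'cV[R]_n) = 1.
Proof.
rewrite /dotc (bigD1 i)//= big1 ?addr0 => [|k ki]; rewrite !mxE.
  by rewrite !eqxx mulr1.
by rewrite (negbTE ki) mul0r.
Qed.

Lemma dotcC n (u v : 'cV[R]_n) : dotc u v = dotc v u.
Proof. by apply: eq_bigr => i _; rewrite mulrC. Qed.

Lemma dotcDr n (u v w : 'cV[R]_n) : dotc u (v + w) = dotc u v + dotc u w.
Proof. by rewrite /dotc -big_split; apply: eq_bigr => i _; rewrite mxE mulrDr. Qed.

Lemma dotcZr n c (u v : 'cV[R]_n) : dotc u (c *: v) = c * dotc u v.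
Proof. by rewrite /dotc mulr_sumr; apply: eq_bigr => i _; rewrite mxE mulrCA. Qed.

Lemma dotcBr n (u v w : 'cV[R]_n) : dotc u (v - w) = dotc u v - dotc u w.
Proof. by rewrite dotcDr -scaleN1r dotcZr mulN1r. Qed.

Lemma sqr_entry_le_dotc n (u : 'cV[R]_n) i : u i 0 ^+ 2 <= dotc u u.
Proof.
rewrite /dotc (bigD1 i)//= -expr2 lerDl sumr_ge0// => k _.
by rewrite -expr2 sqr_ge0.
Qed.

Lemma entry_le_dotc n (u : 'cV[R]_n) i : `|u i 0| <= 1 + dotc u u.
Proof.
apply: le_trans (_ : _ <= 1 + u i 0 ^+ 2) _; last by rewrite lerD2l sqr_entry_le_dotc.
rewrite -(real_normK (num_real (u i 0))); move: `|_| => y.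
by have := sqr_ge0 (y - 1); have := sqr_ge0 y; nra.
Qed.

Lemma dotc_sqrB n (u v : 'cV[R]_n) :
  dotc (u - v) (u - v) = dotc u u + dotc v v - 2 * dotc u v.
Proof. by rewrite dotcBr (dotcC _ u) (dotcC _ v) !dotcBr (dotcC v u); ring. Qed.

Lemma norm_dotc_le n (u v : 'cV[R]_n) : 2 * `|dotc u v| <= dotc u u + dotc v v.
Proof.
have h1 := dotc_ge0 (u - v); have h2 := dotc_ge0 (u + v).
have e1 := dotc_sqrB u v.
have e2 : dotc (u + v) (u + v) = dotc u u + dotc v v + 2 * dotc u v.
  by rewrite dotcDr (dotcC _ u) (dotcC _ v) !dotcDr (dotcC v u); ring.
have -> : 2 * `|dotc u v| = `|2 * dotc u v| by rewrite normrM ger0_norm.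
by rewrite ler_norml; apply/andP; split; lra.
Qed.

End euclidean_product.

Section resolvent_bounds.
Context {R : realType} (N d : nat) (X : 'M[R]_(N, d)) (t : R).
Hypothesis t0 : 0 < t.
Local Notation Rs := (resolvent X t).

Lemma resolventE (b : 'cV[R]_d) : b = gram X *m (Rs *m b) + t *: (Rs *m b).
Proof. by rewrite -mul_scalar_mx -mulmxDl mulmxA mulmxV ?gramD_unitmx// mul1mx. Qed.

Lemma dotc_resolvent (b : 'cV[R]_d) :
  dotc b (Rs *m b) = dotc (X *m (Rs *m b)) (X *m (Rs *m b)) + t * dotc (Rs *m b) (Rs *m b).
Proof. by rewrite {1}[b]resolventE dotcC dotcDr dotc_gram dotcZr. Qed.

(** With [R] the resolvent, inserting [b^T R b = |X R b|^2 + t |R b|^2] into [0 <= |b - t R b|^2]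
    gives [2 t |X R b|^2 + t^2 |R b|^2 <= |b|^2], and every upper bound follows from it. *)
Lemma dotc_resolvent_le (b : 'cV[R]_d) :
  [/\ 0 <= dotc b (Rs *m b), t * dotc b (Rs *m b) <= dotc b b,
      t ^+ 2 * dotc (Rs *m b) (Rs *m b) <= dotc b b &
      2 * t * dotc (X *m (Rs *m b)) (X *m (Rs *m b)) <= dotc b b].
Proof.
have E := dotc_resolvent b.
have h0 := dotc_ge0 (b - t *: (Rs *m b)).
have E2 : dotc (b - t *: (Rs *m b)) (b - t *: (Rs *m b)) =
    dotc b b - 2 * t * dotc b (Rs *m b) + t ^+ 2 * dotc (Rs *m b) (Rs *m b).
  by rewrite dotc_sqrB !dotcZr (dotcC (t *: _)) dotcZr; ring.
have h1 := dotc_ge0 (Rs *m b); have h2 := dotc_ge0 (X *m (Rs *m b)).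
rewrite E2 in h0; rewrite E in h0 *.
move: h0 h1 h2; move: (dotc b b) (dotc (Rs *m b) _) (dotc (X *m _) _) => B Y Z h0 h1 h2.
have h3 : 0 <= t * Y by rewrite mulr_ge0// ltW.
have h4 : 0 <= t * Z by rewrite mulr_ge0// ltW.
have h5 : 0 <= t * (t * Y) by rewrite mulr_ge0// ltW.
by split; nra.
Qed.

(** The diagonal entry [h] is the quadratic form of the resolvent at [c = X^T e_i], and also the
    [i]-th coordinate of [X R c]. The energy identity therefore gives [h^2 <= |X R c|^2 <= h]. *)
Lemma resolvent_leverage i : 0 <= (X *m Rs *m X^T) i i <= 1.
Proof.
pose c : 'cV[R]_d := X^T *m delta_mx i 0.
have E : (X *m Rs *m X^T) i i = (X *m (Rs *m c)) i 0.
  by rewrite /c !mulmxA -colE [RHS]mxE.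
have E2 : dotc c (Rs *m c) = (X *m (Rs *m c)) i 0.
  rewrite -dotcE /c trmx_mul trmxK -!mulmxA trmx_delta.
  by rewrite -rowE [LHS]mxE.
have := dotc_resolvent c; rewrite E2 E => E3.
have h1 := sqr_entry_le_dotc (X *m (Rs *m c)) i.
have h2 : 0 <= t * dotc (Rs *m c) (Rs *m c) by rewrite mulr_ge0 ?dotc_ge0// ltW.
have h3 := dotc_ge0 (X *m (Rs *m c)).
move: E3 h1 h2 h3; move: (dotc (X *m _) _) (_ i 0) (t * _) => a b e -> h1 h2 h3.
by apply/andP; split; nra.
Qed.

End resolvent_bounds.

Section bounded_expectation.
Context d (T : measurableType d) {R : realType} (P : probability T R).

Lemma bounded_integrable (g : T -> R) C : measurable_fun [set: T] g ->
  (forall w, `|g w| <= C) -> P.-integrable setT (EFin \o g).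
Proof.
move=> mg gC; apply: (@le_integrable _ _ _ P _ measurableT _ (fun w => C%:E)).
- exact/measurable_EFinP.
- by move=> w _ /=; rewrite lee_fin (le_trans (gC w))// ler_norm.
- exact: finite_measure_integrable_cst.
Qed.

Lemma nneg_bounded_integrable (g : T -> R) C : measurable_fun [set: T] g ->
  (forall w, 0 <= g w <= C) -> P.-integrable setT (EFin \o g).
Proof.
move=> mg gC; apply: (@bounded_integrable _ C) => // w.
by have /andP[g0 g1] := gC w; rewrite ger0_norm.
Qed.

Lemma Rintegral_sum (I : Type) (r : seq I) (g : I -> T -> R) :
  (forall i, P.-integrable setT (EFin \o g i)) ->
  P.-integrable setT (fun w => (\sum_(i <- r) g i w)%:E) /\
  \int[P]_w (\sum_(i <- r) g i w) = \sum_(i <- r) \int[P]_w g i w.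
Proof.
move=> ig; elim: r => [|i r [IH1 IH2]].
  under [X in integrable _ _ X]eq_fun do rewrite big_nil.
  split; first exact: finite_measure_integrable_cst.
  rewrite big_nil; under eq_Rintegral do rewrite big_nil.
  by rewrite Rintegral_cst// mul0r.
under [X in integrable _ _ X]eq_fun do rewrite big_cons EFinD.
split; first by apply: integrableD => //; exact: ig.
rewrite big_cons -IH2; under eq_Rintegral do rewrite big_cons.
by rewrite RintegralD//; exact: ig.
Qed.

Lemma expectation_const (c : R) : \int[P]_w c = c.
Proof.
by rewrite Rintegral_cst// [X in fine X](@probability_setT _ _ _ P) mulr1.
Qed.

Lemma le_bounded_expectation (g : T -> R) C : measurable_fun [set: T] g ->
  (forall w, `|g w| <= C) -> `|\int[P]_w g w| <= C.
Proof.
move=> mg gC; have ig := bounded_integrable mg gC.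
apply: le_trans (le_normr_Rintegral measurableT ig) _.
rewrite -[leRHS]expectation_const.
apply: le_Rintegral => //.
- by apply: (bounded_integrable (C := C)) => [|w]; [exact: measurableT_comp|rewrite normr_id].
- exact: finite_measure_integrable_cst.
Qed.

End bounded_expectation.

Section loop_equation.
Context d0 (T : measurableType d0) {R : realType} (P : probability T R).
Context (N d : nat) (Z : 'I_N * 'I_d -> {RV P >-> R}).
Hypotheses (N0 : (0 < N)%N) (Znormal : iid_centered_normal Z N%:R^-1).
Variable t : R.
Hypothesis t0 : 0 < t.

(** Flattens the double index, so that the entries of the matrix form a single Gaussian family to
    which [stein] applies. *)
Definition mx_of (f : 'I_N * 'I_d -> R) : 'M[R]_(N, d) := \matrix_(i, j) f (i, j).

Let X w := mx_of (Z ^~ w).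

Lemma measurable_mx_of d' (S : measurableType d') (Y : 'I_N * 'I_d -> S -> R) :
  (forall j, measurable_fun [set: S] (Y j)) ->
  measurable_mx (fun s => mx_of (Y ^~ s)).
Proof. by move=> mY i j; under eq_fun do rewrite mxE; exact: mY. Qed.

Let mX : measurable_mx X. Proof. by apply: measurable_mx_of => j. Qed.

Lemma is_mxderive_mx_of f ij z :
  is_mxderive z (fun z => mx_of (update f ij z)) (delta_mx ij.1 ij.2).
Proof.
move=> k l; case: ij => i j /=.
have -> : (fun z => mx_of (update f (i, j) z) k l) =
    fun z => if (k, l) == (i, j) then z else f (k, l).
  by apply/funext => y; rewrite mxE.
rewrite mxE -xpair_eqE; case: eqP => _; first exact: is_derive_id.
exact: is_derive_cst.
Qed.

Lemma is_mxderive_resolvent (M : R -> 'M[R]_(N, d)) z dM : is_mxderive z M dM ->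
  is_mxderive z (fun z => resolvent (M z) t)
   (- (resolvent (M z) t *m (dM^T *m M z + (M z)^T *m dM) *m resolvent (M z) t)).
Proof.
move=> hM; apply: is_mxderive_invmx => [y|]; first exact: gramD_unitmx.
have := is_mxderive_add (is_mxderive_mul (is_mxderive_tr hM) hM)
  (is_mxderive_cst z (t%:M : 'M[R]_d)).
by rewrite addr0.
Qed.

Lemma mul_delta_mx_entry m n p q (A : 'M[R]_(m, n)) (B : 'M[R]_(p, q)) i j k l :
  (A *m delta_mx j k *m B) i l = A i j * B k l.
Proof.
rewrite -mulmxA mxE (bigD1 j)//= big1 ?addr0 => [|a aj].
  rewrite mxE (bigD1 k)//= big1 ?addr0 => [|a ak]; first by rewrite mxE !eqxx mul1r.
  by rewrite mxE (negbTE ak) andbF mul0r.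
by rewrite mxE big1 ?mulr0// => b _; rewrite mxE (negbTE aj) mul0r.
Qed.

(** Partial derivative of [(Y R b)_i] in the entry [Y i j], with [R] the resolvent. The three terms
    come from the outer [Y], and from [Y^T] and [Y] inside the Gram matrix. *)
Definition stein_entry (b : 'cV[R]_d) (Y : 'M[R]_(N, d)) i j :=
  (resolvent Y t *m b) j 0 - (Y *m resolvent Y t) i j * (Y *m resolvent Y t *m b) i 0
  - (Y *m resolvent Y t *m Y^T) i i * (resolvent Y t *m b) j 0.

Lemma is_derive_stein_entry b f ij (z : R) :
  is_derive z 1 (fun z => (mx_of (update f ij z) *m
      resolvent (mx_of (update f ij z)) t *m b) ij.1 0)
    (stein_entry b (mx_of (update f ij z)) ij.1 ij.2).
Proof.
case: ij => i j /=; have hX := is_mxderive_mx_of f (i, j) z.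
have hR := is_mxderive_resolvent hX.
have := is_mxderive_mul (is_mxderive_mul hX hR) (is_mxderive_cst z b).
move=> /(_ i 0); congr is_derive; move: (mx_of _) => Y; rewrite /=.
set Q := resolvent Y t.
have -> : (delta_mx i j *m Q + Y *m - (Q *m ((delta_mx i j)^T *m Y +
      Y^T *m delta_mx i j) *m Q)) *m b + Y *m Q *m 0 =
    1%:M *m delta_mx i j *m (Q *m b) - Y *m Q *m delta_mx j i *m (Y *m Q *m b)
    - Y *m Q *m Y^T *m delta_mx i j *m (Q *m b).
  rewrite mulmx0 addr0 trmx_delta mul1mx mulmxN !(mulmxDl, mulmxDr, mulNmx).
  by rewrite !mulmxA opprD addrA.
have sub3 (A B C : 'cV[R]_N) : (A - B - C) i 0 = A i 0 - B i 0 - C i 0.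
  by rewrite !mxE.
by rewrite sub3 !mul_delta_mx_entry /stein_entry mxE eqxx mul1r.
Qed.

Lemma mxtrace_gram_resolvent (Y : 'M[R]_(N, d)) :
  \tr (Y *m resolvent Y t *m Y^T) = d%:R - t * \tr (resolvent Y t).
Proof.
rewrite mxtrace_mulC mulmxA -/(gram Y).
have <- : 1%:M - t *: resolvent Y t = gram Y *m resolvent Y t.
  rewrite -(@mulmxV _ _ (gram Y + t%:M)) ?gramD_unitmx//.
  by rewrite -/(resolvent Y t) mulmxDl mul_scalar_mx addrK.
by rewrite linearB/= mxtrace1 mxtraceZ.
Qed.

(** The trace of the resolvent, and with it the coupling between [u] and [m], arises from summing
    the leverages [(Y R Y^T)_ii]. *)
Lemma sum_stein_entry (b : 'cV[R]_d) (Y : 'M[R]_(N, d)) :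
  \sum_i \sum_j b j 0 * stein_entry b Y i j =
  N%:R * dotc b (resolvent Y t *m b)
  - dotc (Y *m (resolvent Y t *m b)) (Y *m (resolvent Y t *m b))
  - (d%:R - t * \tr (resolvent Y t)) * dotc b (resolvent Y t *m b).
Proof.
set Q := resolvent Y t; set u := dotc b (Q *m b).
transitivity (\sum_i (u - (Y *m (Q *m b)) i 0 * (Y *m (Q *m b)) i 0
   - (Y *m Q *m Y^T) i i * u)).
  apply: eq_bigr => i _.
  have -> : u - (Y *m (Q *m b)) i 0 * (Y *m (Q *m b)) i 0 - (Y *m Q *m Y^T) i i * u =
    u - (\sum_j (Y *m Q) i j * b j 0) * (Y *m (Q *m b)) i 0 - (Y *m Q *m Y^T) i i * u.
    by congr (_ - _ * _ - _); rewrite mulmxA mxE.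
  rewrite mulr_suml /u /dotc mulr_sumr -!sumrB; apply: eq_bigr => j _.
  by rewrite /stein_entry -/Q -mulmxA; ring.
rewrite !sumrB -mulr_suml sumr_const card_ord mulr_natl.
by rewrite -[X in X * u]/(\tr (Y *m Q *m Y^T)) mxtrace_gram_resolvent.
Qed.

(** Uniformity in [Y] is the point: it makes [stein] applicable. The value of [K] never reaches the
    quantitative estimates. *)
Lemma entries_bounded (b : 'cV[R]_d) : exists2 K, 0 <= K &
  forall (Y : 'M[R]_(N, d)) i j,
    [/\ `|(Y *m resolvent Y t *m b) i 0| <= K, `|(resolvent Y t *m b) j 0| <= K,
        `|(Y *m resolvent Y t) i j| <= K & `|stein_entry b Y i j| <= K].
Proof.
pose K1 := 1 + dotc b b / (2 * t) + dotc b b / t ^+ 2 + 1 / (2 * t).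
have b0 := dotc_ge0 b.
have h1 : 0 <= dotc b b / (2 * t) by rewrite divr_ge0// mulr_ge0// ltW.
have h2 : 0 <= dotc b b / t ^+ 2 by rewrite divr_ge0// exprn_ge0// ltW.
have h3 : 0 <= 1 / (2 * t) by rewrite divr_ge0// mulr_ge0// ltW.
have K10 : 0 <= K1 by rewrite /K1; lra.
have key (c : 'cV[R]_d) (Y : 'M[R]_(N, d)) i :
    `|(Y *m resolvent Y t *m c) i 0| <= 1 + dotc c c / (2 * t).
  rewrite -mulmxA; apply: le_trans (entry_le_dotc _ i) _; rewrite lerD2l.
  have [_ _ _ h] := dotc_resolvent_le Y t0 c.
  by rewrite ler_pdivlMr ?mulr_gt0// mulrC.
exists (K1 + K1 * K1 + K1) => [|Y i j]; first by rewrite !addr_ge0// mulr_ge0.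
have e1 : `|(Y *m resolvent Y t *m b) i 0| <= K1.
  by apply: le_trans (key b Y i) _; rewrite /K1; lra.
have e2 : `|(resolvent Y t *m b) j 0| <= K1.
  apply: le_trans (entry_le_dotc _ j) _.
  have [_ _ h _] := dotc_resolvent_le Y t0 b.
  have : dotc (resolvent Y t *m b) (resolvent Y t *m b) <= dotc b b / t ^+ 2.
    by rewrite ler_pdivlMr ?exprn_gt0// mulrC.
  by rewrite /K1; lra.
have e3 : `|(Y *m resolvent Y t) i j| <= K1.
  have := key (delta_mx j 0) Y i; rewrite -colE mxE.
  by rewrite dotc_delta => h; apply: le_trans h _; rewrite /K1; lra.
have e4 : `|stein_entry b Y i j| <= K1 + K1 * K1 + K1.
  rewrite /stein_entry; apply: le_trans (ler_normB _ _) _; apply: lerD.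
    apply: le_trans (ler_normB _ _) _; apply: lerD => //.
    by rewrite normrM ler_pM.
  have /andP[l0 l1] := resolvent_leverage Y t0 i.
  by rewrite normrM -[leRHS]mul1r ler_pM// ger0_norm.
have K2 : 0 <= K1 * K1 by rewrite mulr_ge0.
by split => //; lra.
Qed.

Lemma continuous_mxderive m n (M : R -> 'M[R]_(m, n)) (dM : R -> 'M[R]_(m, n)) i j :
  (forall z, is_mxderive z M (dM z)) -> continuous (fun z => M z i j).
Proof.
move=> h z; have := h z i j => ?.
by apply: differentiable_continuous; apply/derivable1_diffP; exact: ex_derive.
Qed.

Lemma continuous_stein_entry b f ij :
  continuous (fun z : R => stein_entry b (mx_of (update f ij z)) ij.1 ij.2).
Proof.
have hX z := is_mxderive_mx_of f ij z.
have hR z := is_mxderive_resolvent (hX z).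
have hb (z : R) := is_mxderive_cst z b.
have hXR z := is_mxderive_mul (hX z) (hR z).
have c1 := continuous_mxderive (fun z => is_mxderive_mul (hR z) (hb z)).
have c2 := continuous_mxderive hXR.
have c3 := continuous_mxderive (fun z => is_mxderive_mul (hXR z) (hb z)).
have c4 := continuous_mxderive (fun z => is_mxderive_mul (hXR z) (is_mxderive_tr (hX z))).
move=> z; apply: cvgB; first apply: cvgB; first exact: c1.
  by apply: cvgM; [exact: c2|exact: c3].
by apply: cvgM; [exact: c4|exact: c1].
Qed.

Lemma measurable_stein_entry d' (S : measurableType d') (M : S -> 'M[R]_(N, d)) b i j :
  measurable_mx M -> measurable_fun setT (fun s => stein_entry b (M s) i j).
Proof.
move=> mM; have mR := measurable_resolvent t mM; have mb := @measurable_cstmx _ _ S _ _ b.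
have mXR := measurable_mulmx mM mR.
apply: measurable_funB; first apply: measurable_funB.
- exact: measurable_mulmx.
- apply: measurable_funM; first exact: mXR.
  exact: measurable_mulmx.
- apply: measurable_funM; last exact: measurable_mulmx.
  by apply: measurable_mulmx => //; exact: measurable_trmx.
Qed.

(* Stein's lemma in each entry [X i j], applied to [b j * S X * (X R b) i] and summed. *)
Lemma loop_equation (S : 'M[R]_(N, d) -> R) (s : 'M[R]_(N, d) -> 'M[R]_(N, d)) (C : R)
    (b : 'cV[R]_d) : 0 <= C ->
  (forall d' (U : measurableType d') (M : U -> 'M[R]_(N, d)),
    measurable_mx M -> measurable_fun setT (fun w => S (M w))) ->
  (forall d' (U : measurableType d') (M : U -> 'M[R]_(N, d)),
    measurable_mx M -> measurable_mx (fun w => s (M w))) ->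
  (forall f ij (z : R), is_derive z 1 (fun z => S (mx_of (update f ij z)))
     (s (mx_of (update f ij z)) ij.1 ij.2)) ->
  (forall f ij, continuous (fun z : R => s (mx_of (update f ij z)) ij.1 ij.2)) ->
  (forall Y, `|S Y| <= C) -> (forall Y i j, `|s Y i j| <= C) ->
  \int[P]_w (S (X w) * (dotc b b - t * dotc b (resolvent (X w) t *m b))) =
  N%:R^-1 * \int[P]_w (S (X w) *
    (N%:R * dotc b (resolvent (X w) t *m b)
     - dotc (X w *m (resolvent (X w) t *m b)) (X w *m (resolvent (X w) t *m b))
     - (d%:R - t * \tr (resolvent (X w) t)) * dotc b (resolvent (X w) t *m b))
   + dotc (s (X w) *m b) (X w *m (resolvent (X w) t *m b))).
Proof.
move=> C0 mS ms dS cs SC sC.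
have [K K0 HK] := entries_bounded b.
pose F (ij : 'I_N * 'I_d) f :=
  b ij.2 0 * (S (mx_of f) * (mx_of f *m resolvent (mx_of f) t *m b) ij.1 0).
pose F' (ij : 'I_N * 'I_d) f :=
  b ij.2 0 * (s (mx_of f) ij.1 ij.2 * (mx_of f *m resolvent (mx_of f) t *m b) ij.1 0
     + S (mx_of f) * stein_entry b (mx_of f) ij.1 ij.2).
have mF ij : measurable_functional (F ij).
  move=> d' U Y mY; have mM := measurable_mx_of mY.
  apply: measurable_funM => //; apply: measurable_funM; first exact: mS.
  apply: measurable_mulmx; last exact: measurable_cstmx.
  by apply: measurable_mulmx => //; exact: measurable_resolvent.
have mF' ij : measurable_functional (F' ij).
  move=> d' U Y mY; have mM := measurable_mx_of mY.
  apply: measurable_funM => //; apply: measurable_funD.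
    apply: measurable_funM; first exact: ms.
    apply: measurable_mulmx; last exact: measurable_cstmx.
    by apply: measurable_mulmx => //; exact: measurable_resolvent.
  by apply: measurable_funM; [exact: mS|exact: measurable_stein_entry].
have dF ij f (z : R) : is_derive z 1 (fun z => F ij (update f ij z)) (F' ij (update f ij z)).
  have := is_derive_mul (dS f ij z) (is_derive_stein_entry b f ij z).
  exact: is_deriveZ.
have cF' ij f : continuous (fun z : R => F' ij (update f ij z)).
  move=> z; apply: cvgM; first exact: cvg_cst.
  apply: cvgD; apply: cvgM.
  - exact: cs.
  - have ? := is_derive_stein_entry b f ij z.
    by apply: differentiable_continuous; apply/derivable1_diffP; exact: ex_derive.
  - have ? := dS f ij z.
    by apply: differentiable_continuous; apply/derivable1_diffP; exact: ex_derive.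
  - exact: continuous_stein_entry.
pose B (ij : 'I_N * 'I_d) := `|b ij.2 0| * (C * K + C * K) : R.
have B0 ij : 0 <= B ij by rewrite mulr_ge0// addr_ge0// mulr_ge0.
have FB ij f : `|F ij f| <= B ij.
  have [e1 _ _ _] := HK (mx_of f) ij.1 ij.2.
  rewrite /F /B normrM ler_wpM2l// normrM.
  apply: (@le_trans _ _ (C * K)); first by rewrite ler_pM.
  by rewrite lerDl mulr_ge0.
have F'B ij f : `|F' ij f| <= B ij.
  have [e1 _ _ e4] := HK (mx_of f) ij.1 ij.2.
  rewrite /F' /B normrM ler_wpM2l//; apply: le_trans (ler_normD _ _) _.
  by rewrite !normrM lerD// ler_pM.
have N0' : 0 < (N%:R : R)^-1 by rewrite invr_gt0 ltr0n.
have st ij := stein N0' Znormal (B0 ij) (mF ij) (mF' ij) (dF ij) (cF' ij) (FB ij) (F'B ij).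
have i1 ij : P.-integrable setT (EFin \o (fun w => Z ij w * F ij (Z ^~ w))) by have [] := st ij.
have i2 ij : P.-integrable setT (EFin \o (fun w => F' ij (Z ^~ w))) by have [] := st ij.
have [_ E1] := Rintegral_sum (index_enum _) i1.
have [_ E2] := Rintegral_sum (index_enum _) i2.
transitivity (\int[P]_w (\sum_ij (Z ij w * F ij (Z ^~ w)))).
  apply: eq_Rintegral => w _; set Y := X w; set Q := resolvent Y t.
  (* Here [|b|^2 - t b^T R b = b^T G R b = (X b)^T (X R b)], which exhibits each Gaussian entry
     [X i j] as a factor. *)
  have -> : dotc b b - t * dotc b (Q *m b) = dotc (Y *m b) (Y *m (Q *m b)).
    by rewrite -dotc_gram {2}[b](resolventE Y t0) dotcDr dotcZr addrK.
  have -> : dotc (Y *m b) (Y *m (Q *m b)) =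
      \sum_i \sum_j Y i j * b j 0 * (Y *m Q *m b) i 0.
    by apply: eq_bigr => i _; rewrite mulmxA mxE mulr_suml.
  rewrite pair_bigA mulr_sumr; apply: eq_bigr => -[i j] _ /=.
  by rewrite /F -/Y -/(X w) -/Y -/Q /= /Y /X mxE; ring.
rewrite E1 (eq_bigr (fun ij => N%:R^-1 * \int[P]_w F' ij (Z ^~ w))); last first.
  by move=> ij _; have [] := st ij.
rewrite -mulr_sumr -E2; congr (_ * _); apply: eq_Rintegral => w _.
set Y := X w; set Q := resolvent Y t.
rewrite -sum_stein_entry mulr_sumr.
have -> : dotc (s Y *m b) (Y *m (Q *m b)) =
    \sum_i \sum_j s Y i j * b j 0 * (Y *m Q *m b) i 0.
  by apply: eq_bigr => i _; rewrite mulmxA mxE mulr_suml.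
rewrite -big_split -[LHS](pair_bigA _ (fun i j => F' (i, j) (Z ^~ w)))/=.
apply: eq_bigr => i _; rewrite mulr_sumr -big_split; apply: eq_bigr => j _ /=.
by rewrite /F' /= -/(X w) -/Y -/Q; ring.
Qed.

End loop_equation.

(** * Loop equations with explicit errors of order [1/N] *)

Section quantitative_loop.
Context d0 (T : measurableType d0) {R : realType} (P : probability T R).
Context (N d : nat) (Z : 'I_N * 'I_d -> {RV P >-> R}).
Hypotheses (N0 : (0 < N)%N) (d_gt0 : (0 < d)%N).
Hypothesis Znormal : iid_centered_normal Z N%:R^-1.
Variable t : R.
Hypothesis t0 : 0 < t.

Definition mean_trace (Y : 'M[R]_(N, d)) : R := d%:R^-1 * \tr (resolvent Y t).
Definition quad_resolvent (b : 'cV[R]_d) (Y : 'M[R]_(N, d)) : R :=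
  dotc b (resolvent Y t *m b).

Let X w := mx_of (Z ^~ w).
Let mX : measurable_mx X. Proof. by apply: measurable_mx_of => j. Qed.
Let c : R := d%:R / N%:R.
Let d1 : 0 < (d%:R : R). Proof. by rewrite ltr0n. Qed.
Let N1 : 0 < (N%:R : R). Proof. by rewrite ltr0n. Qed.
Let tV : 0 < t^-1. Proof. by rewrite invr_gt0. Qed.

Lemma quad_resolvent_bounds b Y : 0 <= quad_resolvent b Y <= dotc b b / t.
Proof.
have [h1 h2 _ _] := dotc_resolvent_le Y t0 b.
by rewrite /quad_resolvent h1 ler_pdivlMr// mulrC.
Qed.

Lemma mean_traceE Y :
  mean_trace Y = d%:R^-1 * \sum_j quad_resolvent (delta_mx j 0) Y.
Proof.
congr (_ * _); apply: eq_bigr => j _.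
rewrite /quad_resolvent -dotcE trmx_delta -colE -rowE.
by rewrite [RHS]mxE [RHS]mxE.
Qed.

Lemma mean_trace_bounds Y : 0 <= mean_trace Y <= t^-1.
Proof.
rewrite mean_traceE; apply/andP; split.
  rewrite mulr_ge0 ?invr_ge0 ?(ltW d1)// sumr_ge0// => j _.
  by have /andP[] := quad_resolvent_bounds (delta_mx j 0) Y.
rewrite mulrC ler_pdivrMr//.
apply: (@le_trans _ _ (\sum_(j < d) t^-1)).
  apply: ler_sum => j _; have /andP[_] := quad_resolvent_bounds (delta_mx j 0) Y.
  by rewrite dotc_delta mul1r.
by rewrite sumr_const card_ord mulr_natr.
Qed.

Lemma measurable_mean_trace d' (U : measurableType d') (M : U -> 'M[R]_(N, d)) :
  measurable_mx M -> measurable_fun setT (fun w => mean_trace (M w)).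
Proof.
move=> mM; apply: measurable_funM => //; apply: measurable_mxtrace.
exact: measurable_resolvent.
Qed.

Lemma measurable_quad_resolvent d' (U : measurableType d') (M : U -> 'M[R]_(N, d)) b :
  measurable_mx M -> measurable_fun setT (fun w => quad_resolvent b (M w)).
Proof.
move=> mM; apply: measurable_dotc; first exact: measurable_cstmx.
apply: measurable_mulmx; last exact: measurable_cstmx.
exact: measurable_resolvent.
Qed.

(** What is left of the loop equation for a unit vector, divided by [N], once the terms carrying an
    explicit [1/N] are moved to the other side; [c] stands for [d/N]. *)
Definition loop_defect (b : 'cV[R]_d) Y : R :=
  1 - (1 + t - c) * quad_resolvent b Y - c * t * mean_trace Y * quad_resolvent b Y.

Lemma measurable_loop_defect b :
  measurable_fun setT (fun w => loop_defect b (X w)).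
Proof.
have mu := measurable_quad_resolvent b mX; have mm := measurable_mean_trace mX.
apply: measurable_funB; first by apply: measurable_funB => //; exact: measurable_funM.
by apply: measurable_funM => //; exact: measurable_funM.
Qed.

Lemma loop_defect_bounded b Y : dotc b b = 1 ->
  `|loop_defect b Y| <= 1 + `|1 + t - c| * t^-1 + `|c| * t^-1.
Proof.
move=> b1; have /andP[] := quad_resolvent_bounds b Y; have /andP[] := mean_trace_bounds Y.
rewrite b1 mul1r /loop_defect; move: c (mean_trace Y) (quad_resolvent b Y) => e m u m0 m1 u0 u1.
apply: le_trans (ler_normB _ _) _; apply: lerD.
  apply: le_trans (ler_normB _ _) _.
  by rewrite normr1 lerD2l normrM ler_wpM2l// ger0_norm.
rewrite -!mulrA normrM ler_wpM2l// mulrA ger0_norm; last first.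
  by rewrite !mulr_ge0// ltW.
rewrite -[leRHS]mul1r ler_pM// ?mulr_ge0 ?(ltW t0)//.
by rewrite -(@divff _ t) ?gt_eqF// ler_pM2l.
Qed.

Definition gram_quad (b : 'cV[R]_d) (Y : 'M[R]_(N, d)) : R :=
  dotc (Y *m (resolvent Y t *m b)) (Y *m (resolvent Y t *m b)).

Lemma gram_quad_bounds b Y : dotc b b = 1 -> 0 <= gram_quad b Y <= (2 * t)^-1.
Proof.
move=> b1; rewrite dotc_ge0 /=; have [_ _ _] := dotc_resolvent_le Y t0 b.
by rewrite b1 -/(gram_quad b Y) => h; rewrite -[leRHS]mul1r ler_pdivlMr ?mulr_gt0// mulrC.
Qed.

Lemma measurable_gram_quad b : measurable_fun setT (fun w => gram_quad b (X w)).
Proof.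
have mRb := measurable_mulmx (measurable_resolvent t mX) (@measurable_cstmx _ _ T _ _ b).
by apply: measurable_dotc; exact: measurable_mulmx.
Qed.

Section test_function.
Variables (S : 'M[R]_(N, d) -> R) (s : 'M[R]_(N, d) -> 'M[R]_(N, d)) (C D : R).
Variable b : 'cV[R]_d.
Hypotheses (C0 : 0 <= C) (b1 : dotc b b = 1).
Hypothesis mS : forall d' (U : measurableType d') (M : U -> 'M[R]_(N, d)),
  measurable_mx M -> measurable_fun setT (fun w => S (M w)).
Hypothesis ms : forall d' (U : measurableType d') (M : U -> 'M[R]_(N, d)),
  measurable_mx M -> measurable_mx (fun w => s (M w)).
Hypothesis dS : forall f ij (z : R), is_derive z 1 (fun z => S (mx_of (update f ij z)))
  (s (mx_of (update f ij z)) ij.1 ij.2).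
Hypothesis cs : forall f ij,
  continuous (fun z : R => s (mx_of (update f ij z)) ij.1 ij.2).
Hypotheses (SC : forall Y, `|S Y| <= C) (sC : forall Y i j, `|s Y i j| <= C).
Hypothesis SD : forall Y, `|S Y| <= D.
Hypothesis sD : forall Y, `|dotc (s Y *m b) (Y *m (resolvent Y t *m b))| <= D.

Let e Y := dotc (s Y *m b) (Y *m (resolvent Y t *m b)).

Let me : measurable_fun setT
  (fun w => N%:R^-1 * (e (X w) - S (X w) * gram_quad b (X w))).
Proof.
have mSX := mS mX; have mq := measurable_gram_quad b.
have mRb := measurable_mulmx (measurable_resolvent t mX) (@measurable_cstmx _ _ T _ _ b).
apply: measurable_funM => //; apply: measurable_funB; last exact: measurable_funM.
apply: measurable_dotc; last exact: measurable_mulmx.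
by apply: measurable_mulmx; [exact: ms|exact: measurable_cstmx].
Qed.

Let be w : `|N%:R^-1 * (e (X w) - S (X w) * gram_quad b (X w))| <=
  N%:R^-1 * (D * (1 + (2 * t)^-1)).
Proof.
rewrite normrM ger0_norm ?invr_ge0 ?(ltW N1)// ler_wpM2l ?invr_ge0 ?(ltW N1)//.
rewrite mulrDr mulr1; apply: le_trans (ler_normB _ _) _; rewrite lerD ?sD//.
by rewrite normrM ler_pM//; have /andP[h1 h2] := gram_quad_bounds (X w) b1; rewrite ger0_norm.
Qed.

Lemma loop_identity : \int[P]_w (S (X w) * loop_defect b (X w)) =
  \int[P]_w (N%:R^-1 * (e (X w) - S (X w) * gram_quad b (X w))).
Proof.
have := loop_equation N0 Znormal t0 b C0 mS ms dS cs SC sC.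
rewrite -/X; set I1 := (X in X = _ -> _); set I2 := (X in _ = _ * X -> _) => E.
have mSX := mS mX; have mu := measurable_quad_resolvent b mX.
have ub w := quad_resolvent_bounds b (X w).
have i1 : P.-integrable setT (EFin \o (fun w => S (X w) * (1 - t * quad_resolvent b (X w)))).
  apply: (@bounded_integrable _ _ _ P _ (D * (1 + t * t^-1))) => [|w].
    by apply: measurable_funM => //; apply: measurable_funB => //; exact: measurable_funM.
  rewrite normrM ler_pM//; apply: le_trans (ler_normB _ _) _.
  rewrite normr1 lerD2l normrM (ger0_norm (ltW t0)) ler_pM2l//.
  by have /andP[h1 h2] := ub w; rewrite ger0_norm// -[leRHS]mul1r -b1.
have i2 : P.-integrable setT (EFin \o (fun w =>
    N%:R^-1 * (e (X w) - S (X w) * gram_quad b (X w)))) by exact: bounded_integrable be.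
have i3 : P.-integrable setT (EFin \o (fun w => S (X w) * loop_defect b (X w))).
  apply: (@bounded_integrable _ _ _ P _
      (D * (1 + `|1 + t - c| * t^-1 + `|c| * t^-1))) => [|w].
    by apply: measurable_funM => //; exact: measurable_loop_defect.
  by rewrite normrM ler_pM// loop_defect_bounded.
have i13 := integrableB measurableT i1 i3.
have i132 := integrableD measurableT i13 i2.
have I2E : N%:R^-1 * I2 = \int[P]_w (S (X w) * (1 - t * quad_resolvent b (X w))
    - S (X w) * loop_defect b (X w)
    + N%:R^-1 * (e (X w) - S (X w) * gram_quad b (X w))).
  apply: (@mulfI _ N%:R); first by rewrite gt_eqF.
  rewrite mulVKf ?gt_eqF// -RintegralZl//; apply: eq_Rintegral => w _.
  rewrite /loop_defect -/(gram_quad b (X w)) -/(e (X w)).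
  rewrite -/(quad_resolvent b (X w)) /mean_trace /c; field.
  by rewrite !gt_eqF.
have I1E : I1 = \int[P]_w (S (X w) * (1 - t * quad_resolvent b (X w))).
  by rewrite /I1 b1.
by rewrite I2E RintegralD// RintegralB// I1E in E; lra.
Qed.

(** [C] licenses integration by parts, whereas [D] is the constant that enters the error; this is
    why the two bounds on the test function are kept apart. *)
Lemma loop_estimate :
  `|\int[P]_w (S (X w) * loop_defect b (X w))| <= N%:R^-1 * (D * (1 + (2 * t)^-1)).
Proof. by rewrite loop_identity; exact: le_bounded_expectation. Qed.

End test_function.

(** The case [S = 1], stated as an equality: the error term lies between [0] and [u / N], and this
    finer information yields bounds uniform in [t]. *)
Lemma loop_identity_one b : dotc b b = 1 ->
  \int[P]_w loop_defect b (X w) = \int[P]_w (- (N%:R^-1 * gram_quad b (X w))).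
Proof.
move=> b1; have z0 Y : dotc ((0 : 'M[R]_(N, d)) *m b) Y = 0.
  by rewrite mul0mx /dotc big1// => i _; rewrite mxE mul0r.
have := @loop_identity (fun=> 1) (fun=> 0) 1 1 b ler01 b1.
under eq_Rintegral do rewrite mul1r.
under [X in _ -> _ = X]eq_Rintegral do rewrite -mulrN -[gram_quad _ _]mul1r -sub0r.
under [X in (_ -> _ -> _ -> _ -> _ -> _ -> _ -> _ -> _ = X) -> _]eq_Rintegral do rewrite z0.
apply => //.
- by move=> *; exact: measurable_cstmx.
- by move=> f ij z; rewrite mxE; exact: is_derive_cst.
- move=> f ij; under eq_fun do rewrite mxE.
  by move=> z; exact: cvg_cst.
- by move=> Y; rewrite normr1.
- by move=> Y i j; rewrite mxE normr0.
- by move=> Y; rewrite normr1.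
- by move=> Y; rewrite z0 normr0.
Qed.

Lemma loop_estimate_one b : dotc b b = 1 ->
  `|\int[P]_w loop_defect b (X w)| <= N%:R^-1 * (1 + (2 * t)^-1).
Proof.
move=> b1; rewrite loop_identity_one//; apply: le_bounded_expectation => [|w].
  by apply: measurableT_comp => //; apply: measurable_funM => //; exact: measurable_gram_quad.
have /andP[h1 h2] := gram_quad_bounds (X w) b1.
rewrite normrN normrM ger0_norm ?invr_ge0 ?(ltW N1)// ler_wpM2l ?invr_ge0 ?(ltW N1)//.
by rewrite ger0_norm// (le_trans h2)// lerDr.
Qed.

Let dmt (Y : 'M[R]_(N, d)) : 'M[R]_(N, d) :=
  (- (2 / d%:R)) *: (Y *m resolvent Y t *m resolvent Y t).

(** By cyclicity of the trace and symmetry of the resolvent [R], both halves of the derivative of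
    the Gram matrix contribute [(Y R^2)_ij]; hence the factor [2]. *)
Lemma is_derive_mean_trace f ij (z : R) :
  is_derive z 1 (fun z => mean_trace (mx_of (update f ij z)))
    (dmt (mx_of (update f ij z)) ij.1 ij.2).
Proof.
case: ij => i j; have hX := is_mxderive_mx_of f (i, j) z.
have := is_derive_mxtrace (is_mxderive_resolvent t0 hX) => h.
have : is_derive z 1 (fun z => mean_trace (mx_of (update f (i, j) z)))
   (d%:R^-1 *: \tr (- (resolvent (mx_of (update f (i, j) z)) t *m
       ((delta_mx i j)^T *m mx_of (update f (i, j) z) +
        (mx_of (update f (i, j) z))^T *m delta_mx i j) *m
       resolvent (mx_of (update f (i, j) z)) t))).
  exact: is_deriveZ.
congr is_derive; move: (mx_of _) => Y /=; rewrite /dmt mxE.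
set Q := resolvent Y t.
have tr_delta m n (A : 'M[R]_(m, n)) k l : \tr (A *m delta_mx l k) = A k l.
  rewrite /mxtrace (bigD1 k)//= mxE (bigD1 l)//= mxE !eqxx mulr1.
  rewrite big1 ?addr0 => [|a al]; last by rewrite mxE (negbTE al) mulr0.
  rewrite big1 ?addr0// => a ak; rewrite mxE big1// => e _.
  by rewrite mxE (negbTE ak) andbF mulr0.
have Qs : Q^T = Q by exact: trmx_resolvent.
rewrite linearN/= trmx_delta mulmxDr mulmxDl linearD/=.
have -> : \tr (Q *m (delta_mx j i *m Y) *m Q) = (Y *m Q *m Q) i j.
  transitivity (\tr ((Q *m delta_mx j i) *m (Y *m Q))); first by rewrite !mulmxA.
  by rewrite mxtrace_mulC !mulmxA tr_delta.
have -> : \tr (Q *m (Y^T *m delta_mx i j) *m Q) = (Y *m Q *m Q) i j.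
  rewrite mxtrace_mulC !mulmxA tr_delta.
  have -> : (Y *m Q *m Q) i j = (Y *m Q *m Q)^T j i by rewrite [RHS]mxE.
  by rewrite !trmx_mul Qs mulmxA.
by rewrite /GRing.scale/=; ring.
Qed.

(** [t^-1] bounds [m]. The other two terms bound [|Y R b|^2] and [|Y R^2 b|^2], whose sum dominates
    the pairing of the gradient of [m] with [Y R b]. *)
Definition trace_error : R := t^-1 + (2 * t)^-1 + (2 * t ^+ 3)^-1.
Local Notation DT := trace_error.

(** Multiplying the defect by [m] adds only a gradient term, bounded uniformly in the dimensions, so
    the error stays of order [1/N]. This is what controls the fluctuations of [m]. *)
Lemma loop_estimate_mean_trace b : dotc b b = 1 ->
  `|\int[P]_w (mean_trace (X w) * loop_defect b (X w))| <= N%:R^-1 * (DT * (1 + (2 * t)^-1)).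
Proof.
move=> b1.
have d2 : 0 < 2 / (d%:R : R) <= 2.
  by rewrite divr_gt0//= ler_pdivrMr// ler_peMr// ler1n.
have key (a : 'cV[R]_d) (Y : 'M[R]_(N, d)) : dotc a a = 1 ->
    dotc (Y *m (resolvent Y t *m (resolvent Y t *m a)))
      (Y *m (resolvent Y t *m (resolvent Y t *m a))) <= (2 * t ^+ 3)^-1.
  move=> a1; have [_ _ h1 _] := dotc_resolvent_le Y t0 a.
  have [_ _ _ h2] := dotc_resolvent_le Y t0 (resolvent Y t *m a).
  rewrite -[leRHS]mul1r ler_pdivlMr ?mulr_gt0 ?exprn_gt0// mulrC.
  rewrite [leRHS](esym a1); apply: le_trans h1.
  rewrite [leLHS](_ : _ = t ^+ 2 * (2 * t * dotc (Y *m (resolvent Y t *m (resolvent Y t *m a)))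
      (Y *m (resolvent Y t *m (resolvent Y t *m a)))))//; last by ring.
  by rewrite ler_wpM2l// exprn_ge0// ltW.
(* In the first constant, [t^-1] bounds [m], and the rest bounds an entry of [dmt] through
   [2/d <= 2] and [|y| <= 1 + y^2]. *)
apply: (@loop_estimate mean_trace dmt (t^-1 + 2 * (1 + (2 * t ^+ 3)^-1)) DT b) => //.
- by rewrite addr_ge0 ?(ltW tV)// mulr_ge0// addr_ge0// invr_ge0 mulr_ge0// exprn_ge0// ltW.
- by move=> *; exact: measurable_mean_trace.
- move=> d' U M mM; apply: measurable_scalemx => //.
  have mR := measurable_resolvent t mM.
  by apply: measurable_mulmx => //; exact: measurable_mulmx.
- exact: is_derive_mean_trace.
- move=> f ij; have hX z := is_mxderive_mx_of f ij z.
  have hR z := is_mxderive_resolvent t0 (hX z).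
  have h z := is_mxderive_mul (is_mxderive_mul (hX z) (hR z)) (hR z).
  have cts := continuous_mxderive h.
  have -> : (fun z : R => dmt (mx_of (update f ij z)) ij.1 ij.2) =
     (fun z => - (2 / d%:R) * (mx_of (update f ij z) *m resolvent (mx_of (update f ij z)) t
        *m resolvent (mx_of (update f ij z)) t) ij.1 ij.2).
    by apply/funext => z; rewrite [LHS]mxE.
  by move=> z; apply: cvgM; [exact: cvg_cst|exact: cts].
- move=> Y; have /andP[h1 h2] := mean_trace_bounds Y.
  rewrite ger0_norm// (le_trans h2)// lerDl mulr_ge0// addr_ge0// invr_ge0.
  by rewrite mulr_ge0// exprn_ge0// ltW.
- move=> Y i j; rewrite /dmt mxE normrM normrN.
  have /andP[p1 p2] := d2; rewrite (ger0_norm (ltW p1)).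
  apply: (@le_trans _ _ (2 * (1 + (2 * t ^+ 3)^-1))); last by rewrite lerDr ltW.
  apply: ler_pM => //; rewrite ?(ltW p1)//.
  have -> : (Y *m resolvent Y t *m resolvent Y t) i j =
     (Y *m (resolvent Y t *m (resolvent Y t *m (delta_mx j 0 : 'cV[R]_d)))) i 0.
    by rewrite !mulmxA -colE [RHS]mxE.
  apply: le_trans (entry_le_dotc _ i) _; rewrite lerD2l.
  by apply: key; exact: dotc_delta.
- move=> Y; have /andP[h1 h2] := mean_trace_bounds Y.
  rewrite ger0_norm// (le_trans h2)// /trace_error -addrA lerDl addr_ge0// invr_ge0.
    by rewrite mulr_ge0// ltW.
  by rewrite mulr_ge0// exprn_ge0// ltW.
- move=> Y; rewrite /dmt -scalemxAl dotcC dotcZr normrM normrN.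
  have /andP[p1 p2] := d2; rewrite (ger0_norm (ltW p1)) -!mulmxA.
  have [_ _ _ h1] := dotc_resolvent_le Y t0 b.
  have h2 := key b Y b1.
  apply: le_trans (ler_wpM2r (normr_ge0 _) p2) _.
  apply: le_trans (norm_dotc_le _ _) _.
  have : dotc (Y *m (resolvent Y t *m b)) (Y *m (resolvent Y t *m b)) <= (2 * t)^-1.
    by rewrite -[leRHS]mul1r ler_pdivlMr ?mulr_gt0// mulrC (le_trans h1)// b1.
  by rewrite /trace_error; move: tV h2; lra.
Qed.

Definition trace_defect Y : R :=
  1 - (1 + t - c) * mean_trace Y - c * t * mean_trace Y ^+ 2.

Lemma trace_defectE Y :
  trace_defect Y = d%:R^-1 * \sum_j loop_defect (delta_mx j 0) Y.
Proof.
rewrite /trace_defect /loop_defect 2!sumrB -!mulr_sumr sumr_const card_ord.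
rewrite expr2 [in LHS]mean_traceE -!mean_traceE.
have -> : \sum_j quad_resolvent (delta_mx j 0) Y = d%:R * mean_trace Y.
  by rewrite mean_traceE mulVKf// gt_eqF.
by field; rewrite gt_eqF.
Qed.

(* The errors are uniform in the unit vector, so they survive averaging over a basis. *)
Lemma average_estimate (S : 'M[R]_(N, d) -> R) C B :
  (forall d' (U : measurableType d') (M : U -> 'M[R]_(N, d)),
    measurable_mx M -> measurable_fun setT (fun w => S (M w))) ->
  (forall Y, `|S Y| <= C) ->
  (forall b, dotc b b = 1 -> `|\int[P]_w (S (X w) * loop_defect b (X w))| <= B) ->
  `|\int[P]_w (S (X w) * trace_defect (X w))| <= B.
Proof.
move=> mS SC SB.
have ij j : P.-integrable setT
    (EFin \o (fun w => S (X w) * loop_defect (delta_mx j 0) (X w))).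
  apply: (@bounded_integrable _ _ _ P _ (C * (1 + `|1 + t - c| * t^-1 + `|c| * t^-1))) => [|w].
    by apply: measurable_funM; [exact: mS|exact: measurable_loop_defect].
  by rewrite normrM ler_pM//; exact/loop_defect_bounded/dotc_delta.
have ii j : P.-integrable setT
    (EFin \o (fun w => d%:R^-1 * (S (X w) * loop_defect (delta_mx j 0) (X w)))).
  exact: (integrableZl measurableT d%:R^-1 (ij j)).
have [_ E] := Rintegral_sum (index_enum _) ii.
have -> : \int[P]_w (S (X w) * trace_defect (X w)) =
    \sum_j d%:R^-1 * \int[P]_w (S (X w) * loop_defect (delta_mx j 0) (X w)).
  transitivity (\sum_(j < d) \int[P]_w (d%:R^-1 * (S (X w) * loop_defect (delta_mx j 0) (X w)))).
    rewrite -E; apply: eq_Rintegral => w _.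
    by rewrite trace_defectE mulrCA !mulr_sumr; apply: eq_bigr => j _; ring.
  by apply: eq_bigr => j _; rewrite RintegralZl.
rewrite -mulr_sumr normrM ger0_norm ?invr_ge0 ?(ltW d1)//.
rewrite mulrC ler_pdivrMr//; apply: le_trans (ler_norm_sum _ _ _) _.
apply: (@le_trans _ _ (\sum_(j < d) B)).
  by apply: ler_sum => j _; exact/SB/dotc_delta.
by rewrite sumr_const card_ord mulr_natr.
Qed.

End quantitative_loop.

(** * The limiting quadratic equation and the limits at fixed [t] *)

Section stieltjes_root.
Context {R : realType}.
Implicit Types lambda t : R.

(* The positive root of [lambda t m^2 + (1 + t - lambda) m = 1]. *)
Definition mp_stieltjes lambda t : R :=
  2 / (1 + t - lambda + Num.sqrt ((1 + t - lambda) ^+ 2 + 4 * lambda * t)).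

Lemma mp_stieltjes_gt0 lambda t : lambda < 1 -> 0 <= t -> 0 < mp_stieltjes lambda t.
Proof.
move=> l1 t0; rewrite divr_gt0// ltr_wpDr ?sqrtr_ge0//; lra.
Qed.

Lemma mp_stieltjesE lambda t : 0 < lambda -> lambda < 1 -> 0 <= t ->
  lambda * t * mp_stieltjes lambda t ^+ 2 + (1 + t - lambda) * mp_stieltjes lambda t = 1.
Proof.
move=> l0 l1 t0; rewrite /mp_stieltjes.
set a := 1 + t - lambda; set s := Num.sqrt _.
have a0 : 0 < a by rewrite /a; lra.
have s0 : 0 <= s by exact: sqrtr_ge0.
have E : s ^+ 2 = a ^+ 2 + 4 * lambda * t.
  by rewrite sqr_sqrtr// addr_ge0 ?sqr_ge0// !mulr_ge0// ltW.
have as0 : a + s != 0 by rewrite gt_eqF// ltr_wpDr.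
(* Eliminating [lambda * t] in favour of the square root turns the quadratic equation into a
   rational identity in [a] and [s]. *)
have lt : lambda * t = (s ^+ 2 - a ^+ 2) / 4 by rewrite E; field.
by rewrite lt; field.
Qed.

End stieltjes_root.

Section concentration.
Context d0 (T : measurableType d0) {R : realType} (P : probability T R).
Context (N d : nat) (Z : 'I_N * 'I_d -> {RV P >-> R}).
Hypotheses (N0 : (0 < N)%N) (d_gt0 : (0 < d)%N).
Hypothesis Znormal : iid_centered_normal Z N%:R^-1.
Variables t lambda : R.
Hypotheses (t0 : 0 < t) (l0 : 0 < lambda) (l1 : lambda < 1).

Let X w := mx_of (Z ^~ w).
Let mX : measurable_mx X. Proof. by apply: measurable_mx_of => j. Qed.
Let m w := mean_trace t (X w).
Let ms := mp_stieltjes lambda t.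
Let c : R := d%:R / N%:R.
Let tV : 0 < t^-1. Proof. by rewrite invr_gt0. Qed.
Let ms0 : 0 < ms. Proof. exact: mp_stieltjes_gt0 (ltW _). Qed.
Let msE : lambda * t * ms ^+ 2 + (1 + t - lambda) * ms = 1.
Proof. exact: mp_stieltjesE (ltW _). Qed.
Let mb w : 0 <= m w <= t^-1. Proof. exact: mean_trace_bounds. Qed.
Let mm : measurable_fun setT m. Proof. exact: measurable_mean_trace. Qed.

(** With [c] replaced by [lambda], the trace defect equals [(ms - m)] times a factor at least [t].
    Hence [t (m - ms)^2] is dominated by [(ms - m)] times the defect, whose expectation is a
    combination of the two loop estimates. *)
Lemma mean_trace_concentration :
  \int[P]_w ((m w - ms) ^+ 2) <=
    t^-1 * (ms * (N%:R^-1 * (1 + (2 * t)^-1))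
      + N%:R^-1 * (trace_error t * (1 + (2 * t)^-1))
      + `|lambda - c| * ((ms + t^-1) * t^-1)).
Proof.
pose TD w := trace_defect t (X w).
have mTD : measurable_fun setT TD.
  apply: measurable_funB; first by apply: measurable_funB => //; exact: measurable_funM.
  by apply: measurable_funM => //; exact: measurable_funX.
have e1 : `|\int[P]_w (TD w)| <= N%:R^-1 * (1 + (2 * t)^-1).
  under eq_Rintegral do rewrite -[TD _]mul1r.
  apply: (@average_estimate _ _ _ P N d Z d_gt0 t t0 (fun=> 1) 1) => //.
    by move=> Y; rewrite normr1.
  move=> b b1; under eq_Rintegral do rewrite mul1r.
  exact: loop_estimate_one.
have e2 : `|\int[P]_w (m w * TD w)| <= N%:R^-1 * (trace_error t * (1 + (2 * t)^-1)).
  apply: (@average_estimate _ _ _ P N d Z d_gt0 t t0 (mean_trace t) t^-1) => //.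
  - by move=> *; exact: measurable_mean_trace.
  - by move=> Y; have /andP[h1 h2] := mean_trace_bounds d_gt0 t0 Y; rewrite ger0_norm.
  - exact: loop_estimate_mean_trace.
have bTD w : `|TD w| <= 1 + `|1 + t - c| * t^-1 + `|c| * t * (t^-1) ^+ 2.
  have /andP[h1 h2] := mb w; rewrite /TD/trace_defect -/(m w) -/c.
  apply: le_trans (ler_normB _ _) _; apply: lerD.
    by apply: le_trans (ler_normB _ _) _; rewrite normr1 lerD2l normrM ler_wpM2l// ger0_norm.
  rewrite normrM normrM (ger0_norm (ltW t0)) ler_wpM2l//.
    by rewrite mulr_ge0// ltW.
  by rewrite normrX ger0_norm// lerXn2r// nnegrE// ltW.
have iTD : P.-integrable setT (EFin \o TD) by exact: bounded_integrable bTD.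
have imTD : P.-integrable setT (EFin \o (fun w => m w * TD w)).
  apply: (@bounded_integrable _ _ _ P _
      (t^-1 * (1 + `|1 + t - c| * t^-1 + `|c| * t * (t^-1) ^+ 2))) => [|w].
    exact: measurable_funM.
  by have /andP[h1 h2] := mb w; rewrite normrM (ger0_norm h1) ler_pM.
(* [Q] is the cost of replacing [c] by [lambda] in the defect multiplied by [ms - m]. *)
pose Q w := (lambda - c) * ((ms - m w) * (m w - t * m w ^+ 2)).
have mQ : measurable_fun setT Q.
  apply: measurable_funM => //; apply: measurable_funM; first exact: measurable_funB.
  by apply: measurable_funB => //; apply: measurable_funM => //; exact: measurable_funX.
have bQ w : `|Q w| <= `|lambda - c| * ((ms + t^-1) * t^-1).
  have /andP[h1 h2] := mb w; rewrite /Q normrM ler_wpM2l// normrM ler_pM//.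
    apply: le_trans (ler_normB _ _) _.
    by rewrite (ger0_norm (ltW ms0)) ger0_norm// lerD2l.
  have tm : t * m w <= 1 by rewrite -(@divff _ t) ?gt_eqF// ler_pM2l.
  have tm0 : 0 <= t * m w by rewrite mulr_ge0// ltW.
  rewrite (_ : m w - t * m w ^+ 2 = m w * (1 - t * m w)); last by ring.
  rewrite normrM ger0_norm// -[leRHS]mulr1 ler_pM// ger0_norm; lra.
have iQ : P.-integrable setT (EFin \o Q) by exact: bounded_integrable bQ.
have imsTD : P.-integrable setT (EFin \o (fun w => ms * TD w)).
  exact: (integrableZl measurableT ms iTD).
have imsB : P.-integrable setT (EFin \o (fun w => ms * TD w - m w * TD w)).
  exact: (integrableB measurableT imsTD imTD).
have isum : P.-integrable setT (EFin \o (fun w => ms * TD w - m w * TD w + Q w)).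
  exact: (integrableD measurableT imsB iQ).
have isum' : P.-integrable setT (EFin \o (fun w => t^-1 * (ms * TD w - m w * TD w + Q w))).
  exact: (integrableZl measurableT t^-1 isum).
have isq : P.-integrable setT (EFin \o (fun w => (m w - ms) ^+ 2)).
  apply: (@bounded_integrable _ _ _ P _ ((t^-1 + ms) ^+ 2)) => [|w].
    by apply: measurable_funX => //; exact: measurable_funB.
  have /andP[h1 h2] := mb w; rewrite normrX lerXn2r ?nnegrE ?addr_ge0 ?(ltW tV) ?(ltW ms0)//.
  by apply: le_trans (ler_normB _ _) _; rewrite (ger0_norm h1) (ger0_norm (ltW ms0)) lerD2r.
apply: (@le_trans _ _ (\int[P]_w (t^-1 * (ms * TD w - m w * TD w + Q w)))).
  apply: le_Rintegral => // w _; rewrite mulrC ler_pdivlMr//.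
  have /andP[h1 h2] := mb w; rewrite /TD /Q/trace_defect -/(m w) -/c.
  move: (m w) h1 h2 => x h1 h2.
  (* [m - ms] is a factor of the quadratic polynomial solved by [ms]. *)
  have -> : ms * (1 - (1 + t - c) * x - c * t * x ^+ 2) -
      x * (1 - (1 + t - c) * x - c * t * x ^+ 2) +
      (lambda - c) * ((ms - x) * (x - t * x ^+ 2)) =
     (ms - x) * (1 - (1 + t - lambda) * x - lambda * t * x ^+ 2) by ring.
  have -> : 1 - (1 + t - lambda) * x - lambda * t * x ^+ 2 =
    lambda * t * ms ^+ 2 + (1 + t - lambda) * ms - (1 + t - lambda) * x - lambda * t * x ^+ 2.
    by rewrite msE.
  have -> : (ms - x) * (lambda * t * ms ^+ 2 + (1 + t - lambda) * ms -
      (1 + t - lambda) * x - lambda * t * x ^+ 2) =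
    (x - ms) ^+ 2 * t + (x - ms) ^+ 2 * ((1 - lambda) + lambda * t * (ms + x)) by ring.
  rewrite lerDl mulr_ge0 ?sqr_ge0// addr_ge0 ?subr_ge0 ?(ltW l1)//.
  by rewrite !mulr_ge0 ?addr_ge0 ?(ltW l0) ?(ltW t0) ?(ltW ms0).
rewrite RintegralZl// ler_pM2l// RintegralD// RintegralB// RintegralZl//.
have e3 : \int[P]_w Q w <= `|lambda - c| * ((ms + t^-1) * t^-1).
  by apply: le_trans (ler_norm _) _; exact: le_bounded_expectation.
apply: lerD => //; apply: lerD.
  by rewrite ler_pM2l//; apply: le_trans (ler_norm _) _.
by apply: le_trans (ler_norm _) _; rewrite normrN.
Qed.

(** Expand [0 <= E (|g| - E |g|)^2]. *)
Lemma Rintegral_norm_sqr (g : T -> R) C : measurable_fun setT g ->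
  (forall w, `|g w| <= C) ->
  (\int[P]_w `|g w|) ^+ 2 <= \int[P]_w (g w ^+ 2).
Proof.
move=> mg gC; set a := \int[P]_w `|g w|.
have mag : measurable_fun setT (fun w => `|g w|) by exact: measurableT_comp.
have i1 : P.-integrable setT (EFin \o (fun w => `|g w|)).
  by apply: (@bounded_integrable _ _ _ P _ C) => // w; rewrite normr_id.
have i2 : P.-integrable setT (EFin \o (fun w => g w ^+ 2)).
  apply: (@bounded_integrable _ _ _ P _ (C ^+ 2)) => [|w]; first exact: measurable_funX.
  by rewrite normrX lerXn2r// nnegrE (le_trans _ (gC w)).
have i3 : P.-integrable setT (EFin \o (fun w => (2 * a) * `|g w|)).
  exact: (integrableZl measurableT (2 * a) i1).
have i4 : P.-integrable setT (EFin \o (fun w => g w ^+ 2 - (2 * a) * `|g w|)).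
  exact: (integrableB measurableT i2 i3).
have i5 : P.-integrable setT (EFin \o (fun w : T => a ^+ 2)).
  exact: finite_measure_integrable_cst.
have : 0 <= \int[P]_w (g w ^+ 2 - (2 * a) * `|g w| + a ^+ 2).
  apply: Rintegral_ge0 => w _; rewrite -(real_normK (num_real (g w))).
  by rewrite (_ : _ + _ = (`|g w| - a) ^+ 2) ?sqr_ge0//; ring.
rewrite RintegralD// RintegralB// RintegralZl// -/a expectation_const.
by move=> h; lra.
Qed.

Lemma mean_trace_error : `|\int[P]_w m w - ms| <= \int[P]_w `|m w - ms|.
Proof.
have im : P.-integrable setT (EFin \o m).
  exact: nneg_bounded_integrable mb.
have ic : P.-integrable setT (EFin \o (fun w : T => ms)).
  exact: finite_measure_integrable_cst.
rewrite -[X in _ - X](expectation_const P) -RintegralB//.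
by apply: le_normr_Rintegral => //; exact: (integrableB measurableT im ic).
Qed.

(** Once [m] is close to the constant [ms], the product [m u] decouples. [Q1] replaces [c] by
    [lambda], [Q2] replaces [m] by [ms], and [t u <= 1] lets the mean absolute deviation of [m]
    control the latter. *)
Lemma quad_resolvent_error b : dotc b b = 1 ->
  `|1 - (1 + t - lambda + lambda * t * ms) * \int[P]_w quad_resolvent t b (X w)| <=
  N%:R^-1 * (1 + (2 * t)^-1) + `|lambda - c| * t^-1 + lambda * \int[P]_w `|m w - ms|.
Proof.
move=> b1; pose u w := quad_resolvent t b (X w).
have mu : measurable_fun setT u by exact: measurable_quad_resolvent.
have ub w : 0 <= u w <= t^-1.
  by have := quad_resolvent_bounds t0 b (X w); rewrite b1 mul1r.
pose LD w := loop_defect t b (X w).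
have mLD : measurable_fun setT LD by exact: measurable_loop_defect.
have iLD : P.-integrable setT (EFin \o LD).
  by apply: bounded_integrable mLD _ => w; exact: loop_defect_bounded.
pose Q1 w := (lambda - c) * (u w * (1 - t * m w)).
have bt w : 0 <= t * m w <= 1.
  have /andP[h1 h2] := mb w; rewrite mulr_ge0 ?(ltW t0)//=.
  by rewrite -(@divff _ t) ?gt_eqF// ler_pM2l.
have bQ1 w : `|Q1 w| <= `|lambda - c| * t^-1.
  have /andP[h1 h2] := bt w; have /andP[u0 u1] := ub w.
  rewrite normrM ler_wpM2l// normrM ger0_norm// -[leRHS]mulr1 ler_pM// ger0_norm; lra.
have mQ1 : measurable_fun setT Q1.
  apply: measurable_funM => //; apply: measurable_funM => //.
  by apply: measurable_funB => //; exact: measurable_funM.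
have iQ1 : P.-integrable setT (EFin \o Q1) by exact: bounded_integrable bQ1.
pose Q2 w := lambda * (t * u w * (m w - ms)).
have mQ2 : measurable_fun setT Q2.
  apply: measurable_funM => //; apply: measurable_funM; first exact: measurable_funM.
  exact: measurable_funB.
have bmm w : `|m w - ms| <= t^-1 + ms.
  have /andP[h1 h2] := mb w.
  by apply: le_trans (ler_normB _ _) _; rewrite (ger0_norm h1) (ger0_norm (ltW ms0)) lerD2r.
have mmm : measurable_fun setT (fun w => m w - ms) by exact: measurable_funB.
have mnm : measurable_fun setT (fun w => `|m w - ms|) by exact: measurableT_comp.
have inm : P.-integrable setT (EFin \o (fun w => `|m w - ms|)).
  by apply: (@bounded_integrable _ _ _ P _ (t^-1 + ms)) => // w; rewrite normr_id.
have bQ2 w : `|Q2 w| <= lambda * `|m w - ms|.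
  have /andP[u0 u1] := ub w.
  have tu : 0 <= t * u w <= 1.
    rewrite mulr_ge0 ?(ltW t0)//=.
    by rewrite -(@divff _ t) ?gt_eqF// ler_pM2l.
  case/andP : tu => tu0 tu1.
  rewrite normrM (ger0_norm (ltW l0)) ler_pM2l// normrM (ger0_norm tu0).
  by rewrite ler_piMl.
have ilnm : P.-integrable setT (EFin \o (fun w => lambda * `|m w - ms|)).
  exact: (integrableZl measurableT lambda inm).
have iQ2 : P.-integrable setT (EFin \o Q2).
  apply: (@bounded_integrable _ _ _ P _ (lambda * (t^-1 + ms))) => // w.
  by apply: le_trans (bQ2 w) _; rewrite ler_pM2l.
have ianQ2 : P.-integrable setT (EFin \o (fun w => `|Q2 w|)).
  apply: (@bounded_integrable _ _ _ P _ (lambda * (t^-1 + ms))) => [|w].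
    exact: measurableT_comp.
  by rewrite normr_id; apply: le_trans (bQ2 w) _; rewrite ler_pM2l.
have iu : P.-integrable setT (EFin \o u) by exact: nneg_bounded_integrable ub.
set K := 1 + t - lambda + lambda * t * ms.
have iKu : P.-integrable setT (EFin \o (fun w => K * u w)).
  exact: (integrableZl measurableT K iu).
have i1 : P.-integrable setT (EFin \o (fun w : T => 1 : R)).
  exact: finite_measure_integrable_cst.
have i12 : P.-integrable setT (EFin \o (fun w => LD w + Q1 w)).
  exact: (integrableD measurableT iLD iQ1).
have -> : 1 - K * \int[P]_w u w = \int[P]_w LD w + \int[P]_w Q1 w + \int[P]_w Q2 w.
  rewrite -(expectation_const P 1) -RintegralZl// -RintegralB// -RintegralD// -RintegralD//.
  apply: eq_Rintegral => w _; rewrite /LD /Q1 /Q2 /loop_defect -/(u w) -/(m w) -/c /K.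
  ring.
apply: le_trans (ler_normD _ _) _; apply: lerD; first apply: le_trans (ler_normD _ _) _.
  apply: lerD; first exact: loop_estimate_one.
  exact: le_bounded_expectation.
apply: le_trans (le_normr_Rintegral measurableT iQ2) _.
by rewrite -RintegralZl//; exact: le_Rintegral.
Qed.

End concentration.

Section null_sequences.
Context {R : realType}.
Implicit Types u v : nat -> R.

Lemma cvg0_squeeze u v : (\forall k \near \oo, 0 <= u k <= v k) -> v @ \oo --> (0 : R) ->
  u @ \oo --> (0 : R).
Proof.
by move=> uv v0; apply: (squeeze_cvgr uv) v0; exact: cvg_cst.
Qed.

Lemma cvg0_sqr u v : (forall k, 0 <= u k) -> (forall k, u k ^+ 2 <= v k) ->
  v @ \oo --> (0 : R) -> u @ \oo --> (0 : R).
Proof.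
move=> u0 uv v0; have : (fun k => Num.sqrt (v k)) @ \oo --> (0 : R).
  rewrite -(@sqrtr0 R); apply: continuous_cvg => //; exact: sqrt_continuous.
apply: cvg0_squeeze; apply: nearW => k; rewrite u0/=.
by rewrite -[leLHS](ger0_norm (u0 k)) -sqrtr_sqr ler_wsqrtr.
Qed.

Lemma cvg_dist0 u (l : R) : (fun k => `|u k - l|) @ \oo --> (0 : R) -> u @ \oo --> l.
Proof. by move=> h; apply/subr_cvg0; exact: norm_cvg0. Qed.

Lemma dist0_cvg u (l : R) : u @ \oo --> l -> (fun k => `|u k - l|) @ \oo --> (0 : R).
Proof.
move=> h; rewrite -(@normr0 _ R); apply: cvg_norm.
by rewrite -(subrr l); apply: cvgB => //; exact: cvg_cst.
Qed.

Lemma cvg_inv_nat (N : nat -> nat) : N @ \oo --> \oo ->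
  (fun k => (N k)%:R^-1) @ \oo --> (0 : R).
Proof.
move=> NN; apply: (@cvg_comp _ _ _ N (fun n => (n%:R : R)^-1) _ _ _ NN).
apply/gtr0_cvgV0; last exact: cvgr_idn.
by near=> n; rewrite ltr0n; near: n; exact: nbhs_infty_gt.
Unshelve. all: by end_near. Qed.

End null_sequences.

Section limits.
Context {R : realType} (lambda : R) (N d : nat -> nat).
Hypotheses (l0 : 0 < lambda) (l1 : lambda < 1).
Hypotheses (N_gt0 : forall k, (0 < N k)%N) (d_gt0 : forall k, (0 < d k)%N).
Hypothesis cvgN : N @ \oo --> \oo.
Hypothesis cvg_ratio : (fun k => (d k)%:R / (N k)%:R : R) @ \oo --> lambda.
Context (disp : nat -> measure_display) (T : forall k, measurableType (disp k))
  (P : forall k, probability (T k) R)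
  (Z : forall k, 'I_(N k) * 'I_(d k) -> {RV (P k) >-> R}).
Arguments Z : clear implicits.
Hypothesis Znormal : forall k, iid_centered_normal (Z k) (N k)%:R^-1.

Let X k w := mx_of (Z k ^~ w).
Arguments X : clear implicits.

Section fixed_t.
Variable t : R.
Hypothesis t0 : 0 < t.
Let ms := mp_stieltjes lambda t.

Let ms0 : 0 < ms. Proof. exact: mp_stieltjes_gt0 (ltW _). Qed.

Let mb k w : 0 <= mean_trace t (X k w) <= t^-1.
Proof. exact: mean_trace_bounds. Qed.

Lemma mean_trace_L1 :
  (fun k => \int[P k]_w `|mean_trace t (X k w) - ms|) @ \oo --> (0 : R).
Proof.
apply: (cvg0_sqr _ (v := fun k => t^-1 * (ms * ((N k)%:R^-1 * (1 + (2 * t)^-1))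
      + (N k)%:R^-1 * (trace_error t * (1 + (2 * t)^-1))
      + `|lambda - (d k)%:R / (N k)%:R| * ((ms + t^-1) * t^-1)))).
- by move=> k; exact: Rintegral_ge0.
- move=> k; apply: le_trans (mean_trace_concentration (N_gt0 k) (d_gt0 k) (Znormal k) t0 l0 l1).
  apply: (@Rintegral_norm_sqr _ _ _ _ _ (t^-1 + ms)).
    apply: measurable_funB => //; apply: measurable_mean_trace.
    by apply: measurable_mx_of => j.
  move=> w; have /andP[h1 h2] := mb w.
  by apply: le_trans (ler_normB _ _) _; rewrite (ger0_norm h1) (ger0_norm (ltW ms0)) lerD2r.
- have n0 := cvg_inv_nat cvgN.
  have r0 : (fun k => `|lambda - (d k)%:R / (N k)%:R|) @ \oo --> (0 : R).
    by under eq_fun do rewrite distrC; exact: dist0_cvg.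
  have -> : (0 : R) = t^-1 * (ms * (0 * (1 + (2 * t)^-1))
      + 0 * (trace_error t * (1 + (2 * t)^-1)) + 0 * ((ms + t^-1) * t^-1)) by ring.
  apply: cvgM; first exact: cvg_cst.
  apply: cvgD; last by apply: cvgM; [exact: r0|exact: cvg_cst].
  apply: cvgD; last by apply: cvgM; [exact: n0|exact: cvg_cst].
  by apply: cvgM; [exact: cvg_cst|apply: cvgM; [exact: n0|exact: cvg_cst]].
Qed.

Lemma cvg_mean_trace :
  (fun k => \int[P k]_w mean_trace t (X k w)) @ \oo --> ms.
Proof.
apply: cvg_dist0; apply: (cvg0_squeeze _ mean_trace_L1); apply: nearW => k.
by rewrite normr_ge0 mean_trace_error.
Qed.

Lemma cvg_quad_resolvent (b : forall k, 'cV[R]_(d k)) :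
  (forall k, dotc (b k) (b k) = 1) ->
  (fun k => \int[P k]_w quad_resolvent t (b k) (X k w)) @ \oo --> ms.
Proof.
move=> b1; set K := 1 + t - lambda + lambda * t * ms.
have K0 : 0 < K.
  have : 0 <= lambda * t * ms by apply: mulr_ge0 (ltW ms0); apply: mulr_ge0; exact: ltW.
  by rewrite /K; move: l1 t0; lra.
(* The limiting quadratic equation says precisely that [ms] is the reciprocal of [K]. *)
have Kms : K * ms = 1 by rewrite -(mp_stieltjesE l0 l1 (ltW t0)) /K -/ms; ring.
apply: cvg_dist0; apply: (cvg0_squeeze (v := fun k => K^-1 *
   ((N k)%:R^-1 * (1 + (2 * t)^-1) + `|lambda - (d k)%:R / (N k)%:R| * t^-1
    + lambda * \int[P k]_w `|mean_trace t (X k w) - ms|))).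
  apply: nearW => k; rewrite normr_ge0 mulrC ler_pdivlMr//=.
  have := quad_resolvent_error (N_gt0 k) (d_gt0 k) (Znormal k) t0 l0 l1 (b1 k).
  apply: le_trans; rewrite -/K -/(X k) -Kms -mulrBr normrM (ger0_norm (ltW K0)).
  by rewrite mulrC distrC.
have n0 := cvg_inv_nat cvgN.
have r0 : (fun k => `|lambda - (d k)%:R / (N k)%:R|) @ \oo --> (0 : R).
  by under eq_fun do rewrite distrC; exact: dist0_cvg.
have -> : (0 : R) = K^-1 * (0 * (1 + (2 * t)^-1) + 0 * t^-1 + lambda * 0) by ring.
apply: cvgM; first exact: cvg_cst.
apply: cvgD; last by apply: cvgM; [exact: cvg_cst|exact: mean_trace_L1].
by apply: cvgD; apply: cvgM; [exact: n0|exact: cvg_cst|exact: r0|exact: cvg_cst].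
Qed.

End fixed_t.

End limits.

(** * Almost sure invertibility and the trace of the inverse *)

Section inverse_trace.
Context d0 (T : measurableType d0) {R : realType} (P : probability T R).
Context (N d : nat) (Z : 'I_N * 'I_d -> {RV P >-> R}).
Hypotheses (N0 : (0 < N)%N) (d_gt0 : (0 < d)%N).
Hypothesis Znormal : iid_centered_normal Z N%:R^-1.

Let X w := mx_of (Z ^~ w).
Let mX : measurable_mx X. Proof. by apply: measurable_mx_of => j. Qed.
Let c : R := d%:R / N%:R.
Let d1 : 0 < (d%:R : R). Proof. by rewrite ltr0n. Qed.
Let N1 : 0 < (N%:R : R). Proof. by rewrite ltr0n. Qed.
Let NV : 0 < (N%:R^-1 : R). Proof. by rewrite invr_gt0. Qed.

Section fixed_t.
Variable t : R.
Hypothesis t0 : 0 < t.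

(** In the exact loop identity the terms [t u] and [c t m u] are nonnegative and [gram_quad <= u].
    Discarding them leaves a bound free of [t]. *)
Lemma quad_resolvent_upper b : dotc b b = 1 ->
  (1 - c - N%:R^-1) * \int[P]_w quad_resolvent t b (X w) <= 1.
Proof.
move=> b1; pose u w := quad_resolvent t b (X w); pose q w := gram_quad t b (X w).
have ub w : 0 <= u w <= t^-1.
  by have := quad_resolvent_bounds t0 b (X w); rewrite b1 mul1r.
have iu : P.-integrable setT (EFin \o u).
  by apply: nneg_bounded_integrable ub; exact: measurable_quad_resolvent.
have iq : P.-integrable setT (EFin \o q).
  apply: nneg_bounded_integrable (fun w => gram_quad_bounds t0 (X w) b1).
  exact: measurable_gram_quad.
have iNq : P.-integrable setT (EFin \o (fun w => - (N%:R^-1 * q w))).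
  under eq_fun do rewrite -mulNr; exact: (integrableZl measurableT (- N%:R^-1) iq).
pose L w := loop_defect t b (X w).
have iL : P.-integrable setT (EFin \o L).
  apply: bounded_integrable; first exact: measurable_loop_defect.
  by move=> w; exact: loop_defect_bounded.
have i1 : P.-integrable setT (EFin \o (fun w : T => 1 : R)).
  exact: finite_measure_integrable_cst.
have i1L := integrableB measurableT i1 iL.
have iR := integrableD measurableT i1L iNq.
have iku := integrableZl measurableT (1 - c - N%:R^-1) iu.
have IR : \int[P]_w (1 - L w + - (N%:R^-1 * q w)) = 1.
  by rewrite RintegralD// RintegralB// loop_identity_one// expectation_const subrK.
rewrite -[leRHS]IR -RintegralZl//; apply: le_Rintegral => // w _.
have /andP[u0 u1] := ub w; have /andP[m0 _] := mean_trace_bounds d_gt0 t0 (X w).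
have qu : q w <= u w.
  by rewrite [leRHS](dotc_resolvent (X w) t0 b) lerDl mulr_ge0 ?dotc_ge0// ltW.
have Nqu : N%:R^-1 * q w <= N%:R^-1 * u w by rewrite ler_pM2l.
have tu : 0 <= t * u w by rewrite mulr_ge0// ltW.
have cmu : 0 <= c * t * mean_trace t (X w) * u w.
  have c0 : 0 <= c by rewrite divr_ge0.
  by apply: mulr_ge0 u0; apply: mulr_ge0 m0; exact: mulr_ge0 c0 (ltW t0).
rewrite /L /loop_defect -/(u w) -/c; move: Nqu tu cmu.
generalize (c * t * mean_trace t (X w) * u w) (N%:R^-1 * q w) (u w) (N%:R^-1 : R) c.
move=> e a x n y h1 h2 h3.
by rewrite !mulrBl mul1r !(mulrDl, mulrBl) mul1r; lra.
Qed.

Lemma mean_trace_upper :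
  (1 - c - N%:R^-1) * \int[P]_w mean_trace t (X w) <= 1.
Proof.
have ii j : P.-integrable setT (EFin \o (fun w => quad_resolvent t (delta_mx j 0) (X w))).
  apply: (@bounded_integrable _ _ _ P _ t^-1) => [|w]; first exact: measurable_quad_resolvent.
  have /andP[h1 h2] := quad_resolvent_bounds t0 (delta_mx j 0) (X w).
  by rewrite ger0_norm// (le_trans h2)// dotc_delta mul1r.
have [isum E] := Rintegral_sum (index_enum _) ii.
have -> : \int[P]_w mean_trace t (X w) = d%:R^-1 *
    \sum_j \int[P]_w quad_resolvent t (delta_mx j 0) (X w).
  rewrite -E -RintegralZl//; apply: eq_Rintegral => w _.
  exact: mean_traceE.
rewrite mulrCA mulrC ler_pdivrMr// mul1r mulr_sumr.
apply: (@le_trans _ _ (\sum_(j < d) 1)); last by rewrite sumr_const card_ord.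
by apply: ler_sum => j _; exact/quad_resolvent_upper/dotc_delta.
Qed.

End fixed_t.

Let sing := [set w | \det (gram (X w)) = 0].

Let msing : measurable sing.
Proof.
have mdet := measurable_det (measurable_gram mX).
rewrite (_ : sing = (fun w => \det (gram (X w))) @^-1` [set 0])//.
by rewrite -[X in measurable X]setTI; exact: mdet.
Qed.

Lemma mean_trace_eigval (Y : 'M[R]_(N, d)) t : 0 < t ->
  mean_trace t Y = d%:R^-1 * \sum_i (eigval (gram Y) i + t)^-1.
Proof.
by move=> t0; rewrite /mean_trace resolvent_fcalc// mxtrace_fcalc//; exact: trmx_gram.
Qed.

Lemma det_gram_eigval (Y : 'M[R]_(N, d)) :
  \det (gram Y) != 0 -> forall i, 0 < eigval (gram Y) i.
Proof.
move=> det0 i; rewrite lt_neqAle eigval_gram_ge0 andbT eq_sym; apply: contra det0 => /eqP e0.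
have [UU GE] := diagonalizationP (trmx_gram Y).
rewrite GE !det_mulmx det_diag (bigD1 i)//= -/(eigval (gram Y) i) e0.
by rewrite mul0r mulr0 mul0r.
Qed.

Lemma det_gram_eigval0 (Y : 'M[R]_(N, d)) :
  \det (gram Y) = 0 -> exists i, eigval (gram Y) i = 0.
Proof.
move=> det0; apply/not_existsP => h.
have := @fcalc_unitmx _ _ _ (trmx_gram Y) id (fun i => introN eqP (h i)).
by rewrite fcalc_id ?trmx_gram// unitmxE unitfE det0 eqxx.
Qed.

Hypothesis kappa0 : 0 < 1 - c - N%:R^-1.
Local Notation kappa := (1 - c - N%:R^-1).

Let mt t : 0 < t -> \int[P]_w mean_trace t (X w) <= kappa^-1.
Proof.
by move=> t0; rewrite -[leRHS]mul1r ler_pdivlMr// mulrC mean_trace_upper.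
Qed.

Let imt t : 0 < t -> P.-integrable setT (EFin \o (fun w => mean_trace t (X w))).
Proof.
move=> t0; apply: nneg_bounded_integrable (fun w => mean_trace_bounds d_gt0 t0 (X w)).
exact: measurable_mean_trace.
Qed.

(** On the singular event some eigenvalue vanishes, so the trace of the resolvent is at least [1/t].
    Thus [P sing <= t d E m], where [E m] is bounded uniformly in [t]; let [t] tend to [0]. *)
Lemma gram_singular_null : P sing = 0%E.
Proof.
have fP : P sing \is a fin_num by exact: fin_num_measure.
have key t : 0 < t -> fine (P sing) <= t * (d%:R * kappa^-1).
  move=> t0.
  have E : fine (P sing) = \int[P]_w (\1_sing w).
    by rewrite /Rintegral integral_indic// setIT.
  rewrite E; apply: (@le_trans _ _ (\int[P]_w (t * d%:R * mean_trace t (X w)))).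
    apply: le_Rintegral => //.
    - apply: (@bounded_integrable _ _ _ P _ 1) => [|w]; first exact: measurable_indic.
      by rewrite indicE; case: (_ \in _); rewrite ?normr1 ?normr0.
    - exact: (integrableZl measurableT (t * d%:R) (imt t0)).
    - move=> w _; rewrite indicE; case: (boolP (w \in sing)) => [|_]; last first.
        have /andP[h1 h2] := mean_trace_bounds d_gt0 t0 (X w).
        by apply: mulr_ge0 h1; rewrite mulr_ge0// ltW.
      rewrite inE => /det_gram_eigval0[i ei].
      rewrite mean_trace_eigval// -mulrA mulVKf ?gt_eqF// (bigD1 i)//= ei add0r mulrDr.
      rewrite divff ?gt_eqF// lerDl mulr_ge0 ?(ltW t0)// sumr_ge0// => j _.
      by rewrite invr_ge0 addr_ge0 ?eigval_gram_ge0// ltW.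
  rewrite RintegralZl//; last exact: imt.
  by rewrite -mulrA ler_pM2l// ler_pM2l// mt.
have B0 : 0 < d%:R * kappa^-1 by rewrite mulr_gt0// invr_gt0.
rewrite -(fineK fP); congr EFin; apply/eqP; rewrite eq_le fine_ge0// andbT.
apply/ler_addgt0Pl => e e0; rewrite addr0.
have := key (e / (d%:R * kappa^-1)) (divr_gt0 e0 B0).
by rewrite divfK// gt_eqF.
Qed.

Definition inverse_trace (Y : 'M[R]_(N, d)) : R := d%:R^-1 * \tr (invmx (gram Y)).

Lemma inverse_trace_eigval (Y : 'M[R]_(N, d)) : \det (gram Y) != 0 ->
  inverse_trace Y = d%:R^-1 * \sum_i (eigval (gram Y) i)^-1.
Proof.
move=> det0; have ev := det_gram_eigval det0.
rewrite /inverse_trace -{1}(fcalc_id (trmx_gram Y)) invmx_fcalc ?trmx_gram//.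
  by rewrite mxtrace_fcalc ?trmx_gram.
by move=> i; rewrite gt_eqF.
Qed.

(* [invmx] returns a singular matrix unchanged, so the value of [inverse_trace] there
   has to be overridden. *)
Lemma inverse_trace_integral :
  let h w := if \det (gram (X w)) == 0 then 0 else inverse_trace (X w) in
  [/\ P.-integrable setT (EFin \o h), \int[P]_w h w <= kappa^-1 &
      forall t, 0 < t -> \int[P]_w mean_trace t (X w) <= \int[P]_w h w].
Proof.
move=> h.
have mdet := measurable_det (measurable_gram mX).
have mifdet (g : T -> R) : measurable_fun setT g ->
    measurable_fun setT (fun w => if \det (gram (X w)) == 0 then 0 else g w).
  by move=> mg; apply: measurable_fun_ifT => //; exact: measurable_fun_eqr.
have mh : measurable_fun setT h.
  apply: mifdet; apply: measurable_funM => //; apply: measurable_mxtrace.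
  by apply: measurable_invmx; exact: measurable_gram.
have tn n : 0 < (n.+1%:R^-1 : R) by rewrite invr_gt0.
(* Regularization at [t = 1 / n.+1]: it increases to [h] with [n], and its integrals stay below
   [kappa^-1], so monotone convergence gives the integrability of [h]. *)
pose f n w := if \det (gram (X w)) == 0 then 0 else mean_trace n.+1%:R^-1 (X w).
have mf n : measurable_fun setT (f n) by apply: mifdet; exact: measurable_mean_trace.
have h0 w : 0 <= h w.
  rewrite /h; case: eqP => // /eqP /[dup] det0 /det_gram_eigval ev.
  rewrite inverse_trace_eigval// mulr_ge0 ?invr_ge0 ?(ltW d1)// sumr_ge0// => i _.
  by rewrite invr_ge0 ltW.
have f0 n w : 0 <= f n w.
  rewrite /f; case: eqP => // _.
  by have /andP[] := mean_trace_bounds d_gt0 (tn n) (X w).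
have mle t w : 0 < t -> \det (gram (X w)) != 0 -> mean_trace t (X w) <= h w.
  move=> t0 det0; rewrite /h (negbTE det0) inverse_trace_eigval// mean_trace_eigval//.
  rewrite ler_pM2l ?invr_gt0//; apply: ler_sum => i _.
  have ei := det_gram_eigval det0 i.
  by rewrite lef_pV2 ?posrE ?addr_gt0// lerDl ltW.
have fh w : (fun n => f n w) @ \oo --> h w.
  rewrite /f /h; case: eqP => [_|/eqP det0]; first exact: cvg_cst.
  have ev := det_gram_eigval det0.
  rewrite inverse_trace_eigval//.
  under eq_fun do rewrite mean_trace_eigval//.
  apply: cvgM; first exact: cvg_cst.
  apply: cvg_big => [|i _]; first exact: add_continuous.
  apply: cvgV; first by rewrite gt_eqF.
  rewrite -[X in _ --> X]addr0; apply: cvgD; first exact: cvg_cst.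
  exact: cvg_harmonic.
have fnd w : {homo (fun n => (f n w)%:E) : n m / (n <= m)%N >-> (n <= m)%E}.
  move=> n n' nn; rewrite lee_fin /f; case: eqP => // /eqP det0.
  rewrite !mean_trace_eigval// ler_pM2l ?invr_gt0//; apply: ler_sum => i _.
  have ei := det_gram_eigval det0 i.
  by rewrite lef_pV2 ?posrE ?addr_gt0// lerD2l lef_pV2 ?posrE// ler_nat.
have fle n : (\int[P]_w (f n w)%:E <= (kappa^-1)%:E)%E.
  apply: (@le_trans _ _ (\int[P]_w (mean_trace n.+1%:R^-1 (X w))%:E)%E).
    apply: ge0_le_integral => //.
    - by move=> w _; rewrite lee_fin.
    - exact/measurable_EFinP.
    - exact/measurable_EFinP/measurable_mean_trace.
    - move=> w _; rewrite lee_fin /f; case: eqP => // _.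
      by have /andP[] := mean_trace_bounds d_gt0 (tn n) (X w).
  have fin := integrable_fin_num measurableT (imt (tn n)).
  by rewrite -(fineK fin) lee_fin; exact: mt.
have cvi : (fun n => \int[P]_w (f n w)%:E)%E @ \oo --> (\int[P]_w (h w)%:E)%E.
  have := @cvg_monotone_convergence _ _ _ P _ measurableT (fun n w => (f n w)%:E).
  rewrite (eq_integral (fun w => (h w)%:E)) => [|w _]; last first.
    by apply/cvg_lim => //; apply: cvg_EFin; [exact: nearW|exact: fh].
  apply.
  - by move=> n; exact/measurable_EFinP.
  - by move=> n w _; rewrite lee_fin.
  - by move=> w _ n m; exact: fnd.
have hle : (\int[P]_w (h w)%:E <= (kappa^-1)%:E)%E.
  rewrite -(cvg_lim _ cvi)//; apply: lime_le; first by apply/cvg_ex; eexists; exact: cvi.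
  by apply: nearW.
have ih : P.-integrable setT (EFin \o h).
  apply/integrableP; split; first exact/measurable_EFinP.
  under eq_integral do rewrite /= ger0_norm//.
  by apply: le_lt_trans hle _; rewrite ltry.
have fin := integrable_fin_num measurableT ih.
split; [exact: ih|by rewrite -lee_fin /Rintegral fineK|].
move=> t t0; have fint := integrable_fin_num measurableT (imt t0).
rewrite -lee_fin /Rintegral !fineK//.
(* The comparison can fail on the singular event, where [h] was set to [0]; that event is null. *)
apply: ae_ge0_le_integral => //.
- by move=> w _; rewrite lee_fin; have /andP[] := mean_trace_bounds d_gt0 t0 (X w).
- exact/measurable_EFinP/measurable_mean_trace.
- by move=> w _; rewrite lee_fin.
- exact/measurable_EFinP.
- exists sing; split => //; first exact: gram_singular_null.
  move=> w /= hw; apply: contrapT => det0; apply: hw => _.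
  by rewrite lee_fin; apply: mle => //; exact/eqP.
Qed.

End inverse_trace.

(** * Integrals against the Marchenko-Pastur density *)

Section semicircle_integral.
Context {R : realType}.
Local Notation leb := (@lebesgue_measure R).

Lemma is_derive_add_cst (f : R -> R) (c x df : R) : is_derive x 1 f df ->
  is_derive x 1 (fun x => f x + c) df.
Proof.
move=> h; have := @is_deriveD _ _ _ f (fun=> c) x 1 df 0 h (is_derive_cst _ _ _).
by rewrite addr0; apply.
Qed.

Lemma is_derive_cst_sub (f : R -> R) (c x df : R) : is_derive x 1 f df ->
  is_derive x 1 (fun x => c - f x) (- df).
Proof.
move=> h; have := @is_deriveB _ _ _ (fun=> c) f x 1 0 df (is_derive_cst _ _ _) h.
by rewrite sub0r; apply.
Qed.

(* [2 atan (n / (L + 2 S)) = asin (n / L)] when [n ^ 2 + 4 S ^ 2 = L ^ 2]; unlike the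
   right-hand side, the left-hand side is visibly continuous up to [S = 0]. *)
Lemma is_derive_half_angle (n S : R -> R) (L x n1 S1 : R) : 0 < L -> 0 < S x ->
  n x ^+ 2 + 4 * S x ^+ 2 = L ^+ 2 -> n x * n1 + 4 * S x * S1 = 0 ->
  is_derive x 1 n n1 -> is_derive x 1 S S1 ->
  is_derive x 1 (fun x => 2 * atan (n x / (L + 2 * S x))) (n1 / (2 * S x)).
Proof.
move=> L0 S0 nS nS1 dn dS.
have D0 : 0 < L + 2 * S x by rewrite addr_gt0// mulr_gt0.
have dD : is_derive x 1 (fun x => L + 2 * S x) (2 * S1).
  have h1 : is_derive x 1 (fun x => 2 * S x) (2 * S1) by exact: is_deriveZ.
  have h2 : is_derive x 1 (fun=> L) 0 by exact: is_derive_cst.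
  by have := is_deriveD h2 h1; rewrite add0r.
have dV : is_derive x 1 (fun x => (L + 2 * S x)^-1) (- (L + 2 * S x) ^- 2 * (2 * S1)).
  exact: (@is_deriveV _ (fun x => L + 2 * S x) x _ 1 (lt0r_neq0 D0) dD).
have dq := is_derive_mul dn dV.
have da := @is_derive1_comp _ atan (fun x => n x / (L + 2 * S x)) x _ _ (is_derive1_atan _) dq.
have : is_derive x 1 (fun x => 2 * atan (n x / (L + 2 * S x)))
  (2 * ((1 + (n x / (L + 2 * S x)) ^+ 2)^-1 *
    (n1 * (L + 2 * S x)^-1 + n x * (- (L + 2 * S x) ^- 2 * (2 * S1))))).
  exact: is_deriveZ.
congr is_derive.
have -> : S1 = - (n x * n1) / (4 * S x).
  have S4 : 4 * S x != 0 by rewrite mulf_neq0// gt_eqF.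
  apply: (mulfI S4); rewrite [RHS]mulrC divfK//.
  by move: nS1; rewrite addrC => /eqP; rewrite addr_eq0 => /eqP.
have n2E : n x ^+ 2 = L ^+ 2 - 4 * S x ^+ 2 by rewrite -nS; ring.
have E : (L + 2 * S x) ^+ 2 + n x ^+ 2 = 2 * L * (L + 2 * S x).
  by rewrite n2E; ring.
have -> : 1 + (n x / (L + 2 * S x)) ^+ 2 = 2 * L / (L + 2 * S x).
  apply: (@mulIf _ ((L + 2 * S x) ^+ 2)); first by rewrite expf_neq0// gt_eqF.
  rewrite mulrDl mul1r -exprMn divfK ?gt_eqF// E; field.
  by rewrite gt_eqF.
have -> : n1 * (L + 2 * S x)^-1 + n x * (- (L + 2 * S x) ^- 2 * (2 * (- (n x * n1) / (4 * S x)))) =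
  n1 * (2 * S x * (L + 2 * S x) + n x ^+ 2) / ((L + 2 * S x) ^+ 2 * (2 * S x)).
  by field; rewrite !gt_eqF.
have -> : 2 * S x * (L + 2 * S x) + n x ^+ 2 = L * (L + 2 * S x).
  by rewrite n2E; ring.
by field; rewrite !gt_eqF.
Qed.

Variables (a b t : R).
Hypotheses (a0 : 0 < a) (ab : a < b) (t0 : 0 <= t).

Let s (x : R) := Num.sqrt ((b - x) * (x - a)).
Let g := Num.sqrt ((a + t) * (b + t)).
Let n1 (x : R) := 2 * x - a - b.
Let n2 (x : R) := (a + b + 2 * t) - 2 * g ^+ 2 / (x + t).
Let S2 (x : R) := g * s x / (x + t).
Let L := b - a.

Let A0 : 0 < a + t. Proof. by rewrite ltr_wpDr. Qed.
Let B0 : 0 < b + t. Proof. by rewrite ltr_wpDr// (lt_trans a0). Qed.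
Let g0 : 0 < g. Proof. by rewrite sqrtr_gt0 mulr_gt0. Qed.
Let g2 : g ^+ 2 = (a + t) * (b + t). Proof. by rewrite sqr_sqrtr// mulr_ge0// ltW. Qed.
Let L0 : 0 < L. Proof. by rewrite subr_gt0. Qed.

(** The classical primitive, with the arcsines of [n1 / L] and [n2 / L] in half-angle form. The
    second arises from the substitution [y = 1 / (x + t)], under which the radicand stays quadratic;
    [n2] is affine in [y]. *)
Definition semicircle_primitive (x : R) : R :=
  s x + (a + b + 2 * t) / 2 * (2 * atan (n1 x / (L + 2 * s x)))
  - g * (2 * atan (n2 x / (L + 2 * S2 x))).

Let ds x : a < x < b -> is_derive x 1 s ((a + b - 2 * x) / (2 * s x)).
Proof.
move=> /andP[ax xb].
have p0 : 0 < (b - x) * (x - a) by rewrite mulr_gt0// subr_gt0.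
have dp : is_derive x 1 (fun x => (b - x) * (x - a)) (a + b - 2 * x).
  have h1 : is_derive x 1 (fun x => b - x) (-1).
    exact: is_derive_cst_sub (is_derive_id _ _).
  have h2 : is_derive x 1 (fun x => x - a) 1.
    exact: is_derive_add_cst (is_derive_id _ _).
  have := is_derive_mul h1 h2; congr is_derive; ring.
have dsq := is_derive1_sqrt p0.
have := @is_derive1_comp _ Num.sqrt (fun x => (b - x) * (x - a)) x _ _ dsq dp; congr is_derive.
by rewrite mulrC.
Qed.

Lemma is_derive_semicircle_primitive x : a < x < b ->
  is_derive x 1 semicircle_primitive (s x / (x + t)).
Proof.
move=> axb; have /andP[ax xb] := axb.
have x0 : 0 < x by exact: lt_trans ax.
have y0 : 0 < x + t by rewrite ltr_wpDr.
have p0 : 0 < (b - x) * (x - a) by rewrite mulr_gt0// subr_gt0.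
have sx : 0 < s x by rewrite sqrtr_gt0.
have s2 : s x ^+ 2 = (b - x) * (x - a) by rewrite sqr_sqrtr// ltW.
have dsx := ds axb.
have d1 : is_derive x 1 (fun x => 2 * atan (n1 x / (L + 2 * s x))) (2 / (2 * s x)).
  apply: (is_derive_half_angle (S1 := (a + b - 2 * x) / (2 * s x))) => //.
  - by rewrite s2 /n1 /L; ring.
  - by rewrite /n1; field; rewrite gt_eqF.
  - have h : is_derive x 1 (fun x => 2 * x) (2 * 1) by apply: is_deriveZ; exact: is_derive_id.
    by rewrite mulr1 in h; do 2 apply: is_derive_add_cst.
have dy : is_derive x 1 (fun x => (x + t)^-1) (- (x + t) ^- 2).
  have h : is_derive x 1 (fun x => x + t) 1.
    exact: is_derive_add_cst (is_derive_id _ _).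
  have := @is_deriveV _ (fun x => x + t) x _ 1 (lt0r_neq0 y0) h.
  by rewrite /GRing.scale/= mulr1; apply.
have dn2 : is_derive x 1 n2 (2 * g ^+ 2 / (x + t) ^+ 2).
  have h : is_derive x 1 (fun x => 2 * g ^+ 2 * (x + t)^-1) (2 * g ^+ 2 * - (x + t) ^- 2).
    exact: is_deriveZ.
  by have := is_derive_cst_sub (a + b + 2 * t) h; rewrite mulrN opprK; apply.
pose S21 := g * ((a + b - 2 * x) / (2 * s x)) / (x + t) - g * s x / (x + t) ^+ 2.
have dS2 : is_derive x 1 S2 S21.
  have h : is_derive x 1 (fun x => g * s x) (g * ((a + b - 2 * x) / (2 * s x))).
    exact: is_deriveZ.
  by have := is_derive_mul h dy; rewrite mulrN; apply.
have S20 : 0 < S2 x by rewrite divr_gt0// mulr_gt0.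
have d2 : is_derive x 1 (fun x => 2 * atan (n2 x / (L + 2 * S2 x)))
    (2 * g ^+ 2 / (x + t) ^+ 2 / (2 * S2 x)).
  apply: (is_derive_half_angle (S1 := S21)) => //.
  - rewrite /n2 /S2 !exprMn s2 g2 /L; field; exact: lt0r_neq0.
  - have -> : 4 * S2 x * S21 = 2 * g ^+ 2 * (a + b - 2 * x) / (x + t) ^+ 2
        - 4 * g ^+ 2 * s x ^+ 2 / (x + t) ^+ 3.
      by rewrite /S2 /S21; field; rewrite !gt_eqF.
    by rewrite /n2 s2 g2; field; rewrite gt_eqF.
have e1 : is_derive x 1 (fun x => (a + b + 2 * t) / 2 * (2 * atan (n1 x / (L + 2 * s x))))
   ((a + b + 2 * t) / 2 * (2 / (2 * s x))) by exact: is_deriveZ.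
have e2 : is_derive x 1 (fun x => g * (2 * atan (n2 x / (L + 2 * S2 x))))
   (g * (2 * g ^+ 2 / (x + t) ^+ 2 / (2 * S2 x))) by exact: is_deriveZ.
have := is_deriveB (is_deriveD dsx e1) e2; congr is_derive.
have -> : g * (2 * g ^+ 2 / (x + t) ^+ 2 / (2 * S2 x)) = g ^+ 2 / ((x + t) * s x).
  by rewrite /S2; field; rewrite !gt_eqF.
apply: (@mulIf _ (s x)); first by rewrite gt_eqF.
have -> : s x / (x + t) * s x = (b - x) * (x - a) / (x + t) by rewrite -s2; field; rewrite gt_eqF.
by rewrite g2; field; rewrite !gt_eqF.
Qed.

Let cs : continuous s.
Proof.
move=> x; apply: (continuous_comp (f := fun x => (b - x) * (x - a))); last exact: sqrt_continuous.
apply: cvgM; apply: cvgB; [exact: cvg_cst|exact: cvg_id|exact: cvg_id|exact: cvg_cst].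
Qed.

Let cy x : 0 < x -> {for x, continuous (fun x => (x + t)^-1)}.
Proof.
move=> x0; apply: cvgV; first by rewrite gt_eqF// ltr_wpDr.
by apply: cvgD; [exact: cvg_id|exact: cvg_cst].
Qed.

Lemma continuous_semicircle_primitive x : 0 < x ->
  {for x, continuous semicircle_primitive}.
Proof.
move=> x0; have y0 : 0 < x + t by rewrite ltr_wpDr.
have S0 : 0 <= s x by exact: sqrtr_ge0.
have cat (n S : R -> R) : 0 <= S x -> {for x, continuous n} -> {for x, continuous S} ->
    {for x, continuous (fun x => 2 * atan (n x / (L + 2 * S x)))}.
  move=> Sx cn cS; apply: cvgM; first exact: cvg_cst.
  apply: (continuous_comp (f := fun x => n x / (L + 2 * S x))); last exact: continuous_atan.
  apply: cvgM => //; apply: cvgV; first by rewrite gt_eqF// ltr_pwDl// mulr_ge0.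
  by apply: cvgD; [exact: cvg_cst|apply: cvgM; [exact: cvg_cst|exact: cS]].
have cS2 : {for x, continuous S2}.
  apply: cvgM; last exact: cy.
  by apply: cvgM; [exact: cvg_cst|exact: cs].
have cn2 : {for x, continuous n2}.
  apply: cvgB; first exact: cvg_cst.
  by apply: cvgM; [exact: cvg_cst|exact: cy].
have cn1 : {for x, continuous n1}.
  apply: cvgB; last exact: cvg_cst; apply: cvgB; last exact: cvg_cst.
  by apply: cvgM; [exact: cvg_cst|exact: cvg_id].
apply: cvgB; first apply: cvgD; first exact: cs.
- by apply: cvgM; [exact: cvg_cst|apply: cat => //; exact: cs].
- apply: cvgM; [exact: cvg_cst|apply: cat => //].
  by rewrite divr_ge0// ?mulr_ge0// ltW.
Qed.

(** At the two edges the square root vanishes and both arctangents are taken at [-1] and [1], so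
    each angle increases by [pi]. *)
Lemma semicircle_integral :
  (\int[leb]_(x in `[a, b]) (Num.sqrt ((b - x) * (x - a)) / (x + t))%:E =
   (pi * ((a + b) / 2 + t - Num.sqrt ((a + t) * (b + t))))%:E)%E.
Proof.
rewrite (@continuous_FTC2 _ _ semicircle_primitive)//.
- rewrite -EFinB; congr EFin.
  have sa : s a = 0 by rewrite /s subrr mulr0 sqrtr0.
  have sb : s b = 0 by rewrite /s subrr mul0r sqrtr0.
  have za : n1 a / (L + 2 * s a) = -1.
    by rewrite sa mulr0 addr0 /n1 /L; field; rewrite subr_eq0 gt_eqF.
  have zb : n1 b / (L + 2 * s b) = 1.
    by rewrite sb mulr0 addr0 /n1 /L; field; rewrite subr_eq0 gt_eqF.
  have za2 : n2 a / (L + 2 * S2 a) = -1.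
    rewrite /S2 sa mulr0 mul0r mulr0 addr0 /n2 g2 /L; field.
    by rewrite subr_eq0 !gt_eqF.
  have zb2 : n2 b / (L + 2 * S2 b) = 1.
    rewrite /S2 sb mulr0 mul0r mulr0 addr0 /n2 g2 /L; field.
    by rewrite subr_eq0 !gt_eqF.
  by rewrite /semicircle_primitive za zb za2 zb2 sa sb atanN atan1 -/g; field.
- apply: continuous_in_subspaceT => x; rewrite inE/= in_itv/= => /andP[ax _].
  by apply: cvgM; [exact: cs|apply: cy; exact: lt_le_trans ax].
- split.
  + move=> x; rewrite in_itv/= => /is_derive_semicircle_primitive ?; exact: ex_derive.
  + by apply: cvg_at_right_filter; exact: continuous_semicircle_primitive.
  + by apply: cvg_at_left_filter; apply: continuous_semicircle_primitive; exact: lt_trans ab.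
- move=> x; rewrite in_itv/= => /is_derive_semicircle_primitive ?.
  by rewrite derive1E; exact: derive_val.
Qed.

End semicircle_integral.

Section marchenko_pastur_means.
Context {R : realType} (lambda : R).
Hypotheses (l0 : 0 < lambda) (l1 : lambda < 1).
Local Notation leb := (@lebesgue_measure R).
Local Notation a := (mp_left lambda).
Local Notation b := (mp_right lambda).
Local Notation pdf := (mp_pdf lambda).

Definition mp_mean (g : R -> R) : R := \int[leb]_x (g x * pdf x).

Let q0 : 0 < Num.sqrt lambda. Proof. by rewrite sqrtr_gt0. Qed.
Let q1 : Num.sqrt lambda < 1. Proof. by rewrite -(@sqrtr1 R) ltr_sqrt. Qed.
Let q2 : Num.sqrt lambda ^+ 2 = lambda. Proof. by rewrite sqr_sqrtr// ltW. Qed.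
Let pi0 : 0 < pi :> R. Proof. exact: pi_gt0. Qed.

Lemma mp_left_gt0 : 0 < a.
Proof. by rewrite exprn_gt0// subr_gt0. Qed.

Lemma mp_left_lt_right : a < b.
Proof.
rewrite /mp_left /mp_right -subr_gt0 (_ : _ - _ = 4 * Num.sqrt lambda); last by ring.
by rewrite mulr_gt0.
Qed.

Lemma mp_edges_sum : a + b = 2 * (1 + lambda).
Proof.
rewrite /mp_left /mp_right; move: q2; move: (Num.sqrt lambda) => q <-; ring.
Qed.

(** The right-hand side is the radicand of [mp_stieltjes]: the edges of the support are the zeros of
    the discriminant of the limiting equation, read at [t = - x]. *)
Lemma mp_edges_shift t :
  (a + t) * (b + t) = (1 + t - lambda) ^+ 2 + 4 * lambda * t.
Proof.
rewrite /mp_left /mp_right; move: q2; move: (Num.sqrt lambda) => q <-; ring.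
Qed.

Let s (x : R) := Num.sqrt ((b - x) * (x - a)).

Let ms : measurable_fun setT s.
Proof.
apply: measurableT_comp.
  by apply: continuous_measurable_fun => x; exact: sqrt_continuous.
by apply: measurable_funM; exact: measurable_funB.
Qed.

Lemma mp_integral_itv (g : R -> \bar R) :
  (\int[leb]_x (g x * (pdf x)%:E) = \int[leb]_(x in `[a, b]) (g x * (pdf x)%:E))%E.
Proof.
rewrite [RHS]integral_mkcond; apply: eq_integral => x _; rewrite patchE.
case: ifPn => //; rewrite /mp_pdf notin_setE/= => /negP xab.
by rewrite (negbTE xab) mule0.
Qed.

Let mker t : 0 <= t -> measurable_fun [set` `[a, b]] (fun x => (s x / (x + t))%:E).
Proof.
move=> t0; apply/measurable_EFinP; apply: measurable_funTS; apply: measurable_funM => //.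
apply: measurableT_comp; first exact: measurable_inv.
exact: measurable_funD.
Qed.

Let ker0 t x : 0 <= t -> x \in `[a, b] -> (0 <= (s x / (x + t))%:E)%E.
Proof.
move=> t0; rewrite in_itv/= => /andP[ax _]; rewrite lee_fin divr_ge0 ?sqrtr_ge0//.
by rewrite addr_ge0// (le_trans _ ax)// ltW// mp_left_gt0.
Qed.

Let kerI t : 0 <= t -> (\int[leb]_(x in `[a, b]) (s x / (x + t))%:E =
   (pi * (1 + lambda + t - Num.sqrt ((1 + t - lambda) ^+ 2 + 4 * lambda * t)))%:E)%E.
Proof.
move=> t0; rewrite (semicircle_integral mp_left_gt0 mp_left_lt_right t0).
by rewrite mp_edges_shift mp_edges_sum; congr ((pi * (_ + t - _))%:E); field.
Qed.

Let kerint t : 0 <= t -> leb.-integrable [set` `[a, b]] (fun x => (s x / (x + t))%:E).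
Proof.
move=> t0; apply/integrableP; split; first exact: mker.
under eq_integral => x /[!inE] xab do rewrite gee0_abs ?ker0//.
by rewrite kerI// ltry.
Qed.

(** The kernel integral at [t = 0]: for [lambda < 1] the square root is [1 - lambda], which leaves
    [2 pi lambda], the normalization of the density. *)
Lemma mp_pdf_integral : (\int[leb]_x (pdf x)%:E = 1)%E.
Proof.
under eq_integral do rewrite -[X in X%:E]mul1r EFinM.
rewrite mp_integral_itv.
transitivity (\int[leb]_(x in `[a, b]) ((2 * pi * lambda)^-1%:E * (s x / (x + 0))%:E))%E.
  apply: eq_integral => x; rewrite inE/= => xab; rewrite -!EFinM; congr EFin.
  move: (xab); rewrite in_itv/= => /andP[ax _].
  rewrite /mp_pdf xab addr0 mul1r /s; move: (pi : R) pi0 => p p0; field.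
  by rewrite !gt_eqF// (lt_le_trans mp_left_gt0).
rewrite integralZl//; last exact: kerint.
rewrite kerI// mulr0 !addr0 -EFinM; congr EFin.
rewrite sqrtr_sqr ger0_norm ?subr_ge0 ?(ltW l1)//.
by move: (pi : R) pi0 => p p0; field; rewrite !gt_eqF.
Qed.

Lemma mp_pdf_integrable : leb.-integrable setT (EFin \o pdf).
Proof.
apply/integrableP; split; first by apply/measurable_EFinP; exact: measurable_mp_pdf.
under eq_integral do rewrite /= ger0_norm ?mp_pdf_ge0//.
by rewrite mp_pdf_integral ltry.
Qed.

Lemma mp_bounded_integrable (g : R -> R) C : measurable_fun setT g ->
  (forall x, a <= x <= b -> `|g x| <= C) ->
  leb.-integrable setT (EFin \o (fun x => g x * pdf x)).
Proof.
move=> mg gC; apply: (@le_integrable _ _ _ leb _ measurableT _ (fun x => C%:E * (pdf x)%:E)%E).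
- by apply/measurable_EFinP; apply: measurable_funM => //; exact: measurable_mp_pdf.
- move=> x _ /=; rewrite lee_fin !normrM (ger0_norm (mp_pdf_ge0 _ _)).
  case: (boolP (x \in `[a, b])) => xab; last first.
    by rewrite /mp_pdf (negbTE xab) !mulr0.
  rewrite ler_wpM2r ?mp_pdf_ge0// (le_trans (gC x _)) ?ler_norm//.
- by apply: integrableZl => //; exact: mp_pdf_integrable.
Qed.

Lemma mp_mean_cst c : mp_mean (fun=> c) = c.
Proof.
rewrite /mp_mean RintegralZl//; last exact: mp_pdf_integrable.
by rewrite /Rintegral mp_pdf_integral mulr1.
Qed.

Lemma mp_meanD (f g : R -> R) : leb.-integrable setT (EFin \o (fun x => f x * pdf x)) ->
  leb.-integrable setT (EFin \o (fun x => g x * pdf x)) ->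
  mp_mean (fun x => f x + g x) = mp_mean f + mp_mean g.
Proof.
move=> fi gi; rewrite /mp_mean -RintegralD//.
by apply: eq_Rintegral => x _; rewrite mulrDl.
Qed.

Lemma mp_meanZ c (f : R -> R) : leb.-integrable setT (EFin \o (fun x => f x * pdf x)) ->
  mp_mean (fun x => c * f x) = c * mp_mean f.
Proof.
move=> fi; rewrite /mp_mean -RintegralZl//.
by apply: eq_Rintegral => x _; rewrite mulrA.
Qed.

Lemma mp_mean_dist (f g : R -> R) e : measurable_fun setT f -> measurable_fun setT g ->
  leb.-integrable setT (EFin \o (fun x => g x * pdf x)) ->
  (forall x, a <= x <= b -> `|f x - g x| <= e) ->
  `|mp_mean f - mp_mean g| <= e.
Proof.
move=> mf mg gi fg.
have mB : measurable_fun setT (fun x => f x - g x) by exact: measurable_funB.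
have bi := mp_bounded_integrable mB fg.
have fE : mp_mean f = mp_mean (fun x => f x - g x) + mp_mean g.
  rewrite -mp_meanD//; congr (mp_mean _); apply/funext => x.
  by rewrite subrK.
rewrite fE addrK /mp_mean; apply: le_trans (le_normr_Rintegral measurableT bi) _.
have ae : mp_mean (fun=> e) = e by exact: mp_mean_cst.
rewrite -[leRHS]ae; apply: le_Rintegral => //.
- have mnB : measurable_fun setT (fun x => `|f x - g x|) by exact: measurableT_comp.
  have := @mp_bounded_integrable (fun x => `|f x - g x|) e mnB.
  move=> /(_ _) h; rewrite (_ : (fun x => _) = (fun x => `|f x - g x| * pdf x)).
    by apply: h => x xab; rewrite normr_id fg.
  by apply/funext => x; rewrite normrM (ger0_norm (mp_pdf_ge0 _ _)).
- by apply: (@mp_bounded_integrable _ `|e|).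
- move=> x _; rewrite normrM (ger0_norm (mp_pdf_ge0 _ _)) /mp_pdf.
  case: ifP => [|_]; last by rewrite !mulr0.
  rewrite in_itv/= => xab; rewrite ler_wpM2r ?fg//.
  have := mp_pdf_ge0 lambda x; rewrite /mp_pdf ifT// in_itv/=.
Qed.

Lemma measurable_shift_inv (t : R) : measurable_fun setT (fun x : R => (x + t)^-1).
Proof.
by apply: measurableT_comp; [exact: measurable_inv|exact: measurable_funD].
Qed.

Lemma shift_inv_bounded t x : 0 <= t -> a <= x <= b -> `|(x + t)^-1| <= a^-1.
Proof.
move=> t0 /andP[ax _]; have a0 := mp_left_gt0.
have x0 : 0 < x by exact: lt_le_trans ax.
rewrite ger0_norm ?invr_ge0 ?addr_ge0 ?(ltW x0)//.
by rewrite lef_pV2 ?posrE ?ltr_wpDr// (le_trans ax)// lerDl.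
Qed.

(** Partial fractions, [1 / (x (x + t)) = (1/x - 1/(x + t)) / t], reduce this to the kernel integral
    at [0] and at [t]. Rationalizing the resulting difference gives the form of [mp_stieltjes]. *)
Lemma mp_mean_resolvent t : 0 < t -> mp_mean (fun x => (x + t)^-1) = mp_stieltjes lambda t.
Proof.
move=> t0; have t0' := ltW t0.
rewrite /mp_mean /Rintegral.
under eq_integral do rewrite EFinM.
rewrite mp_integral_itv.
transitivity (fine (\int[leb]_(x in `[a, b]) ((2 * pi * lambda * t)^-1%:E *
     ((s x / (x + 0))%:E - (s x / (x + t))%:E)))%E).
  congr fine; apply: eq_integral => x; rewrite inE/= => xab; rewrite -EFinB -!EFinM; congr EFin.
  move: (xab); rewrite in_itv/= => /andP[ax _].
  have x0 : 0 < x by exact: lt_le_trans mp_left_gt0 ax.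
  rewrite /mp_pdf xab addr0 /s; move: (pi : R) pi0 => p p0; field.
  by rewrite !gt_eqF// addr_gt0.
rewrite integralZl//; last by apply: integrableB => //; exact: kerint.
rewrite integralB//; [|exact: kerint|exact: kerint].
rewrite !kerI// mulr0 !addr0 -EFinB -EFinM/=.
rewrite sqrtr_sqr ger0_norm ?subr_ge0 ?(ltW l1)// /mp_stieltjes.
set A := 1 + t - lambda; set D := Num.sqrt _.
have A0 : 0 < A by rewrite /A; move: l1 t0; lra.
have D0 : 0 <= D by exact: sqrtr_ge0.
have DE : D ^+ 2 = A ^+ 2 + 4 * lambda * t.
  by rewrite sqr_sqrtr// addr_ge0 ?sqr_ge0// !mulr_ge0// ltW.
have AD : 0 < A + D by rewrite ltr_pwDl.
have -> : 2 / (A + D) = (D - A) / (2 * lambda * t).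
  apply: (@mulIf _ (A + D)); first by rewrite gt_eqF.
  rewrite divfK ?gt_eqF// mulrAC (_ : (D - A) * (A + D) = D ^+ 2 - A ^+ 2); last by ring.
  by rewrite DE; field; rewrite !gt_eqF.
by rewrite /A; move: (pi : R) pi0 => p p0; field; rewrite !gt_eqF.
Qed.

(** The limiting equation rearranges to [1 - (1 - lambda) m = t m + lambda t m^2]; in particular
    [m <= (1 - lambda)^-1], and substituting this bound for [m] gives the constant. *)
Lemma mp_stieltjes_dist t : 0 <= t -> 0 <= (1 - lambda)^-1 - mp_stieltjes lambda t <=
  t * (((1 - lambda)^-1 + lambda * (1 - lambda) ^- 2) / (1 - lambda)).
Proof.
move=> t0; have E := mp_stieltjesE l0 l1 t0; have m0 := mp_stieltjes_gt0 l1 t0.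
move: (mp_stieltjes lambda t) E m0 => m E m0.
have k0 : 0 < 1 - lambda by rewrite subr_gt0.
have lt0 : 0 <= lambda * t by rewrite mulr_ge0// ltW.
have h1 : 0 <= lambda * t * m ^+ 2 by rewrite mulr_ge0 ?sqr_ge0.
have h2 : 0 <= t * m by rewrite mulr_ge0// ltW.
have m1 : m <= (1 - lambda)^-1.
  rewrite -[leRHS]mul1r ler_pdivlMr//.
  have -> : m * (1 - lambda) = (lambda * t * m ^+ 2 + (1 + t - lambda) * m)
      - t * m - lambda * t * m ^+ 2 by ring.
  by rewrite E; lra.
have DE : (1 - lambda)^-1 - m = (t * m + lambda * t * m ^+ 2) / (1 - lambda).
  apply: (@mulIf _ (1 - lambda)); first by rewrite gt_eqF.
  rewrite mulrBl mulVf ?gt_eqF// divfK ?gt_eqF// -[X in X - _]E; ring.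
rewrite DE; apply/andP; split; first by apply: divr_ge0; [exact: addr_ge0|exact: ltW].
rewrite [leRHS]mulrA ler_pM2r ?invr_gt0// mulrDr lerD//; first exact: ler_wpM2l.
rewrite [leRHS]mulrA (mulrC t) ler_wpM2l//.
by rewrite -exprVn lerXn2r// nnegrE ?invr_ge0 ltW.
Qed.

Lemma mp_mean_inv : mp_mean (fun x => x^-1) = (1 - lambda)^-1.
Proof.
have a0 := mp_left_gt0.
(* The first term bounds the change of the integrand, as [1/x - 1/(x + t) <= t a^-2] on the support;
   the second is the constant of [mp_stieltjes_dist]. *)
pose K := a^-1 * a^-1 + ((1 - lambda)^-1 + lambda * (1 - lambda) ^- 2) / (1 - lambda).
have k0 : 0 < 1 - lambda by rewrite subr_gt0.
have K0 : 0 < K.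
  have aV : 0 < a^-1 by rewrite invr_gt0.
  have kV : 0 < (1 - lambda)^-1 by rewrite invr_gt0.
  apply: ltr_pwDl; first exact: mulr_gt0.
  apply: mulr_ge0 (ltW kV); apply: addr_ge0; first exact: ltW.
  by apply: mulr_ge0; [exact: ltW|rewrite invr_ge0 exprn_ge0// ltW].
have key t : 0 < t -> `|mp_mean (fun x => x^-1) - (1 - lambda)^-1| <= t * K.
  move=> t0; rewrite -(subrKA (mp_stieltjes lambda t)) mulrDr.
  apply: le_trans (ler_normD _ _) _; apply: lerD; last first.
    by have /andP[h1 h2] := mp_stieltjes_dist (ltW t0); rewrite distrC ger0_norm.
  rewrite -mp_mean_resolvent//; apply: mp_mean_dist.
  - exact: measurable_inv.
  - exact: measurable_shift_inv.
  - apply: (@mp_bounded_integrable _ a^-1); first exact: measurable_shift_inv.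
    by move=> x; exact/shift_inv_bounded/ltW.
  - move=> x xab; have /andP[ax xb] := xab; have x0 : 0 < x by exact: lt_le_trans ax.
    have -> : x^-1 - (x + t)^-1 = t * ((x + 0)^-1 * (x + t)^-1).
      by rewrite addr0; field; rewrite !gt_eqF// addr_gt0.
    rewrite normrM (ger0_norm (ltW t0)) ler_pM2l// normrM.
    by rewrite ler_pM// shift_inv_bounded// ltW.
apply/eqP; rewrite -subr_eq0 -normr_eq0 eq_le normr_ge0 andbT.
apply/ler_addgt0Pl => e e0; rewrite addr0.
by have := key (e / K) (divr_gt0 e0 K0); rewrite divfK// gt_eqF.
Qed.

End marchenko_pastur_means.

(** * The algebra generated by resolvent kernels *)

Section resolvent_closure.
Context {R : realType}.
Implicit Types (f g : R -> R) (c t : R).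

(* The closed linear span of constants and resolvent kernels, for the sup norm
   on [0, +oo). *)
Inductive resolvent_closure : (R -> R) -> Prop :=
| rc_cst c : resolvent_closure (fun=> c)
| rc_kernel t : 0 < t -> resolvent_closure (fun x => (x + t)^-1)
| rc_add f g : resolvent_closure f -> resolvent_closure g ->
    resolvent_closure (fun x => f x + g x)
| rc_scale c f : resolvent_closure f -> resolvent_closure (fun x => c * f x)
| rc_uniform f (g : nat -> R -> R) : measurable_fun [set: R] f ->
    (forall n, resolvent_closure (g n)) ->
    (forall n x, 0 <= x -> `|f x - g n x| <= n.+1%:R^-1) -> resolvent_closure f.

Lemma rc_measurable f : resolvent_closure f -> measurable_fun [set: R] f.
Proof.
elim=> {f} //.
- by move=> t _; exact: measurable_shift_inv.
- by move=> f g _ mf _ mg; exact: measurable_funD.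
- by move=> c f _ mf; exact: measurable_funM.
Qed.

Lemma rc_bounded f : resolvent_closure f ->
  exists2 C, 0 <= C & forall x, 0 <= x -> `|f x| <= C.
Proof.
elim=> {f}.
- by move=> c; exists `|c|.
- move=> t t0; exists t^-1 => [|x x0]; first by rewrite invr_ge0 ltW.
  rewrite ger0_norm ?invr_ge0 ?addr_ge0 ?(ltW t0)//.
  by rewrite lef_pV2 ?posrE ?ltr_wpDl// lerDr.
- move=> f g _ [C C0 fC] _ [D D0 gD]; exists (C + D) => [|x x0]; first exact: addr_ge0.
  by apply: le_trans (ler_normD _ _) _; rewrite lerD ?fC ?gD.
- move=> c f _ [C C0 fC]; exists (`|c| * C) => [|x x0]; first exact: mulr_ge0.
  by rewrite normrM ler_wpM2l// fC.
- move=> f g _ _ /(_ 0%N)[C C0 gC] /(_ 0%N) fg; exists (1 + C) => [|x x0]; first exact: addr_ge0.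
  rewrite -(subrK (g 0%N x) (f x)); apply: le_trans (ler_normD _ _) _.
  by rewrite lerD ?gC// (le_trans (fg x x0))// invr1.
Qed.

Lemma rc_limit f : measurable_fun [set: R] f ->
  (forall e, 0 < e -> exists2 g, resolvent_closure g &
     forall x, 0 <= x -> `|f x - g x| <= e) -> resolvent_closure f.
Proof.
move=> mf h.
have /choice[g gP] : forall n, exists g, resolvent_closure g /\
    forall x, 0 <= x -> `|f x - g x| <= n.+1%:R^-1.
  by move=> n; have [|g g1 g2] := h n.+1%:R^-1; [rewrite invr_gt0|exists g].
by apply: (@rc_uniform f g mf) => n; have [] := gP n.
Qed.

(** Values on the negative half-line are free as long as the function remains measurable, which is
    why [rc_uniform] asks for measurability of the limit. *)
Lemma rc_ext f g : measurable_fun [set: R] g -> (forall x, 0 <= x -> f x = g x) ->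
  resolvent_closure f -> resolvent_closure g.
Proof.
move=> mg fg rf; apply: rc_limit => // e e0; exists f => // x x0.
by rewrite fg// subrr normr0 ltW.
Qed.

Lemma rc_sub f g : resolvent_closure f -> resolvent_closure g ->
  resolvent_closure (fun x => f x - g x).
Proof.
move=> rf rg; have := rc_add rf (rc_scale (-1) rg).
by under eq_fun do rewrite mulN1r.
Qed.

(** Partial fractions settle two distinct kernels; the square of a kernel is a uniform limit of
    products of distinct ones. *)
Lemma rc_mul_kernel f t : 0 < t -> resolvent_closure f ->
  resolvent_closure (fun x => f x * (x + t)^-1).
Proof.
move=> t0; have mt := @measurable_shift_inv R t.
have kb x : 0 <= x -> 0 <= (x + t)^-1 <= t^-1.
  move=> x0; rewrite invr_ge0 addr_ge0 ?(ltW t0)//=.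
  by rewrite lef_pV2 ?posrE ?ltr_wpDl// lerDr.
have distinct s : 0 < s -> s != t -> resolvent_closure (fun x => (x + s)^-1 * (x + t)^-1).
  move=> s0 st.
  apply: (rc_ext _ _ (rc_scale (t - s)^-1 (rc_sub (rc_kernel s0) (rc_kernel t0)))).
    by apply: measurable_funM => //; exact: measurable_shift_inv.
  move=> x x0; have ts : t - s != 0 by rewrite subr_eq0 eq_sym.
  have xs : x + s != 0 by rewrite gt_eqF// ltr_wpDl.
  have xt : x + t != 0 by rewrite gt_eqF// ltr_wpDl.
  by field; rewrite ?ts ?xs ?xt.
elim=> {f}.
- by move=> c; exact/rc_scale/rc_kernel.
- move=> s s0; have [->|st] := eqVneq s t; last exact: distinct.
  apply: rc_limit => [|e e0]; first exact: measurable_funM.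
  (* The shift makes the error bound [(u - t) / t^3] exactly [e]. *)
  pose u := t + t ^+ 3 * e.
  have u0 : 0 < u by rewrite addr_gt0// mulr_gt0// exprn_gt0.
  have ut : t < u by rewrite ltrDl mulr_gt0// exprn_gt0.
  exists (fun x => (x + u)^-1 * (x + t)^-1); first by apply: distinct; rewrite ?gt_eqF.
  move=> x x0; have /andP[k1 k2] := kb x x0.
  have xt : x + t != 0 by rewrite gt_eqF// ltr_wpDl.
  have xu : x + u != 0 by rewrite gt_eqF// ltr_wpDl.
  have -> : (x + t)^-1 * (x + t)^-1 - (x + u)^-1 * (x + t)^-1 =
      (u - t) * ((x + t)^-1 * ((x + t)^-1 * (x + u)^-1)) by field; rewrite xt xu.
  have u1 : 0 <= (x + u)^-1 <= t^-1.
    apply/andP; split; first by rewrite invr_ge0 addr_ge0// ltW.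
    have xup : 0 < x + u by apply: ltr_wpDl.
    rewrite lef_pV2 ?posrE//.
    by apply: le_trans (ltW ut) _; rewrite lerDr.
  have /andP[u2 u3] := u1.
  rewrite ger0_norm; last by rewrite !mulr_ge0 ?subr_ge0 ?(ltW ut).
  apply: (@le_trans _ _ ((u - t) * (t^-1 * (t^-1 * t^-1)))).
    by rewrite ler_wpM2l ?subr_ge0 ?(ltW ut)// !ler_pM ?mulr_ge0.
  rewrite /u addrAC subrr add0r le_eqVlt; apply/orP; left; apply/eqP.
  by field; rewrite gt_eqF.
- move=> f g _ rf _ rg; have := rc_add rf rg.
  by under eq_fun do rewrite -mulrDl.
- move=> c f _ rf; have := rc_scale c rf.
  by under eq_fun do rewrite mulrA.
- move=> f g mf _ rg fg; apply: rc_limit => [|e e0]; first exact: measurable_funM.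
  have et : 0 < e * t by exact: mulr_gt0.
  have [n ne] : exists n, n.+1%:R^-1 <= e * t.
    by have [n] := ltr_add_invr et; rewrite add0r => /ltW h; exists n.
  exists (fun x => g n x * (x + t)^-1) => // x x0.
  have /andP[k1 k2] := kb x x0.
  rewrite -mulrBl normrM (ger0_norm k1).
  apply: (@le_trans _ _ (e * t * t^-1)); last by rewrite mulfK ?gt_eqF.
  by rewrite ler_pM// (le_trans (fg n x x0)).
Qed.

Lemma rc_mul f g : resolvent_closure f -> resolvent_closure g ->
  resolvent_closure (fun x => f x * g x).
Proof.
move=> rf; have [C C0 fC] := rc_bounded rf; have mf := rc_measurable rf.
elim=> {g}.
- by move=> c; have := rc_scale c rf; under eq_fun do rewrite mulrC.
- by move=> t t0; exact: rc_mul_kernel.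
- move=> g h _ rg _ rh; have := rc_add rg rh.
  by under eq_fun do rewrite -mulrDr.
- move=> c g _ rg; have := rc_scale c rg.
  by under eq_fun do rewrite mulrCA.
- move=> g h mg _ rh gh; apply: rc_limit => [|e e0]; first exact: measurable_funM.
  have C1 : 0 < C + 1 by rewrite ltr_wpDl.
  have [n ne] : exists n, n.+1%:R^-1 <= e / (C + 1).
    by have [n] := ltr_add_invr (divr_gt0 e0 C1); rewrite add0r => /ltW h'; exists n.
  exists (fun x => f x * h n x) => // x x0.
  rewrite -mulrBr normrM mulrC; apply: (@le_trans _ _ (e / (C + 1) * (C + 1))).
    by rewrite ler_pM ?(le_trans (gh n x x0))// (le_trans (fC x x0))// lerDl.
  by rewrite divfK// gt_eqF.
Qed.

Lemma rc_exp f n : resolvent_closure f -> resolvent_closure (fun x => f x ^+ n).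
Proof.
move=> rf; elim: n => [|n IH].
  by under eq_fun do rewrite expr0; exact: rc_cst.
by under eq_fun do rewrite exprS; exact: rc_mul.
Qed.

(** Geometric series: [f = D (1 - u)] with [0 <= u <= q < 1] on the half-line, and the remainder
    after [n] terms is [u^n / f]. *)
Lemma rc_inv f c : 0 < c -> (forall x, 0 <= x -> c <= f x) -> resolvent_closure f ->
  resolvent_closure (fun x => (f x)^-1).
Proof.
move=> c0 cf rf; have [C C0 fC] := rc_bounded rf; have mf := rc_measurable rf.
pose D := C + c; have D0 : 0 < D by rewrite ltr_wpDl.
pose u x := 1 - D^-1 * f x.
have ru : resolvent_closure u by apply: rc_sub; [exact: rc_cst|exact: rc_scale].
pose q := 1 - c / D.
have q1 : `|q| < 1.
  have cD : c / D <= 1 by rewrite ler_pdivrMr// mul1r lerDr.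
  rewrite ger0_norm /q; first by rewrite gtrBl divr_gt0.
  by rewrite subr_ge0.
have ub x : 0 <= x -> 0 <= u x <= q.
  move=> x0; have f0 := cf x x0; have f1 : f x <= C by apply: le_trans (ler_norm _) (fC x x0).
  rewrite /u /q; apply/andP; split.
    by rewrite subr_ge0 mulrC ler_pdivrMr// mul1r (le_trans f1)// lerDl ltW.
  by rewrite lerD2l lerN2 (mulrC c) ler_pM2l// invr_gt0.
apply: rc_limit => [|e e0]; first by apply: measurableT_comp mf; exact: measurable_inv.
(* The remainder is at most [q^n / c], because [c <= f]. *)
have [n qn] : exists n, `|q| ^+ n <= e * c.
  have := cvg_geometric 1 q1 => /cvgrPdist_le /(_ _ (mulr_gt0 e0 c0))[n _ /(_ n (leqnn _))].
  by rewrite sub0r normrN /geometric /= mul1r normrX => h; exists n.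
exists (fun x => D^-1 * \sum_(i < n) u x ^+ i).
  apply: rc_scale; elim: n {qn} => [|n IH].
    by under eq_fun do rewrite big_ord0; exact: rc_cst.
  by under eq_fun do rewrite big_ord_recr; apply: rc_add => //; exact: rc_exp.
move=> x x0; have /andP[u0 u1] := ub x x0; have f0 := cf x x0.
have fx0 : 0 < f x by exact: lt_le_trans f0.
have E : (f x)^-1 - D^-1 * \sum_(i < n) u x ^+ i = u x ^+ n / f x.
  have := subrX1 (u x) n; rewrite /u; set S := \sum_(i < n) _ => h.
  have -> : (1 - D^-1 * f x) ^+ n = 1 - D^-1 * f x * S.
    by apply/eqP; rewrite -subr_eq0; apply/eqP; move: h; rewrite addrAC subrr add0r; lra.
  by field; rewrite !gt_eqF.
rewrite E normrM normfV (ger0_norm (ltW fx0)) ler_pdivrMr// normrX.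
apply: le_trans (_ : e * c <= _); last by rewrite ler_wpM2l// ltW.
apply: le_trans qn; rewrite lerXn2r// ?nnegrE//.
by rewrite ger0_norm// (le_trans u1)// ler_norm.
Qed.

(** Bernoulli's inequality for [1 + h / a], multiplied by [a^(n+1)] so that [a = 0] is allowed. The
    induction runs on the sharper form that keeps the leading term. *)
Lemma bernoulli_ineq (a h : R) n : 0 <= a -> 0 <= h ->
  n%:R * a ^+ n * h <= a * (a + h) ^+ n.
Proof.
move=> a0 h0; suff : a ^+ n.+1 + n%:R * a ^+ n * h <= a * (a + h) ^+ n.
  by apply: le_trans; rewrite lerDr exprn_ge0.
elim: n => [|n IH]; first by rewrite !mul0r addr0 expr0 expr1 mulr1.
rewrite [(a + h) ^+ n.+1]exprSr mulrA.
apply: le_trans (ler_wpM2r (addr_ge0 a0 h0) IH).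
have p0 : 0 <= n%:R * a ^+ n * h ^+ 2 by rewrite !mulr_ge0// exprn_ge0.
rewrite -natr1 !exprS; move: p0; move: (a ^+ n) => p p0.
rewrite -subr_ge0 (_ : _ - _ = n%:R * p * h ^+ 2)//; ring.
Qed.

(* [y^n / (y^n + c^n)] tends to the indicator of [y > c], uniformly once
   multiplied by [y - c]. *)
Lemma rc_max_kernel t c : 0 < t -> 0 < c ->
  resolvent_closure (fun x => Num.max (x + t)^-1 c).
Proof.
move=> t0 c0; have mk := @measurable_shift_inv R t.
apply: rc_limit => [|e e0]; first exact: measurable_maxr.
(* On both sides of [c] the Bernoulli inequality bounds the error by [c / m], where [m = n.+1]. *)
have [n ne] : exists n, c * n.+1%:R^-1 <= e.
  have [n] := ltr_add_invr (divr_gt0 e0 c0); rewrite add0r => /ltW h; exists n.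
  by rewrite mulrC -ler_pdivlMr.
pose y x : R := (x + t)^-1; pose m := n.+1.
have ry : resolvent_closure y by exact: rc_kernel.
have y0 x : 0 <= x -> 0 < y x by move=> x0; rewrite invr_gt0 ltr_wpDl.
exists (fun x => c + (y x - c) * (y x ^+ m * (y x ^+ m + c ^+ m)^-1)).
  apply: rc_add; first exact: rc_cst.
  apply: rc_mul; first by apply: rc_sub => //; exact: rc_cst.
  apply: rc_mul; first exact: rc_exp.
  apply: (@rc_inv _ (c ^+ m)); first exact: exprn_gt0.
    by move=> x x0; rewrite lerDr exprn_ge0// ltW// y0.
  by apply: rc_add; [exact: rc_exp|exact: rc_cst].
move=> x x0; apply: le_trans ne; rewrite -/(y x) -/m.
have := y0 x x0; move: (y x) => z z0.
have m0 : 0 < (m%:R : R) by rewrite ltr0n.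
have zm : 0 < z ^+ m by exact: exprn_gt0.
have cm : 0 < c ^+ m by exact: exprn_gt0.
have S0 : 0 < z ^+ m + c ^+ m by exact: addr_gt0.
have [zc|cz] := leP z c.
  rewrite (_ : c - _ = (c - z) * z ^+ m / (z ^+ m + c ^+ m)); last by field; rewrite gt_eqF.
  rewrite ger0_norm; last by rewrite !mulr_ge0 ?invr_ge0 ?subr_ge0 ?(ltW S0) ?(ltW zm).
  rewrite ler_pdivrMr// mulrAC ler_pdivlMr//.
  have := @bernoulli_ineq z (c - z) m (ltW z0).
  rewrite subr_ge0 => /(_ zc); rewrite subrKC => h.
  have h2 : z * c ^+ m <= c * c ^+ m by rewrite ler_wpM2r// ltW.
  have h3 : 0 <= c * z ^+ m by rewrite mulr_ge0 ?ltW.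
  rewrite [leLHS](_ : _ = m%:R * z ^+ m * (c - z)); last by ring.
  by rewrite mulrDr; lra.
rewrite (_ : z - _ = (z - c) * c ^+ m / (z ^+ m + c ^+ m)); last by field; rewrite gt_eqF.
rewrite ger0_norm; last by rewrite !mulr_ge0 ?invr_ge0 ?subr_ge0 ?(ltW S0) ?(ltW cm) ?(ltW cz).
rewrite ler_pdivrMr// mulrAC ler_pdivlMr//.
have := @bernoulli_ineq c (z - c) m (ltW c0).
rewrite subr_ge0 => /(_ (ltW cz)); rewrite subrKC => h.
have h3 : 0 <= c * c ^+ m by rewrite mulr_ge0 ?ltW.
rewrite [leLHS](_ : _ = m%:R * c ^+ m * (z - c)); last by ring.
by rewrite mulrDr; lra.
Qed.

Section spectral_maps.
Variable alpha : R.
Hypothesis alpha0 : 0 < alpha.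

(** Under [y = 1 / (x + 1)] the threshold [alpha] becomes [c] and the order is reversed, so
    truncations of [x] at [alpha] become truncations of the kernel at [c]. *)
Let c : R := (alpha + 1)^-1.
Let c0 : 0 < c. Proof. by rewrite invr_gt0 addr_gt0. Qed.
Let c1 : c < 1. Proof. by rewrite invf_lt1 ?addr_gt0// ltrDr. Qed.

Let mmax : measurable_fun [set: R] (fun x => Num.max x alpha).
Proof. exact: measurable_maxr. Qed.

(** [v] is the minimum of [y = 1 / (x + 1)] and [c], that is [1 / (max x alpha + 1)]; the claim is
    then [v / (1 - v)], with [v] bounded away from [1]. *)
Lemma rc_inv_max : resolvent_closure (fun x => (Num.max x alpha)^-1).
Proof.
pose v x : R := (x + 1)^-1 + c - Num.max (x + 1)^-1 c.
have rv : resolvent_closure v.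
  apply: rc_sub; last exact: rc_max_kernel.
  by apply: rc_add; [exact: rc_kernel|exact: rc_cst].
have vE x : 0 <= x -> v x = (Num.max x alpha + 1)^-1.
  move=> x0; have x1 : 0 < x + 1 by rewrite ltr_wpDl.
  have a1 : 0 < alpha + 1 by rewrite addr_gt0.
  rewrite /v /c; have [xa|ax] := leP x alpha.
    rewrite max_l ?lef_pV2 ?posrE ?lerD2r//; ring.
  rewrite max_r ?lef_pV2 ?posrE ?lerD2r ?ltW//; ring.
have vc x : 0 <= x -> v x <= c.
  move=> x0; rewrite vE// lef_pV2 ?posrE ?addr_gt0// ?lt_max ?alpha0 ?orbT//.
  by rewrite lerD2r le_max lexx orbT.
have rw : resolvent_closure (fun x => (1 - v x)^-1).
  apply: (@rc_inv _ (1 - c)); first by rewrite subr_gt0.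
    by move=> x x0; rewrite lerD2l lerN2 vc.
  by apply: rc_sub => //; exact: rc_cst.
apply: rc_ext (rc_mul rv rw).
  by apply: measurableT_comp mmax; exact: measurable_inv.
move=> x x0; rewrite vE//.
have m0 : 0 < Num.max x alpha by rewrite lt_max alpha0 orbT.
move: (Num.max x alpha) m0 => m m0.
have m1 : m + 1 != 0 by rewrite gt_eqF// addr_gt0.
rewrite (_ : 1 - _ = m / (m + 1)); last by field.
by rewrite invfM invrK mulrCA mulVf// mulr1.
Qed.

(** The ratio is [min x alpha / alpha], and [min x alpha + 1] is the inverse of the maximum of
    [1 / (x + 1)] and [c]. *)
Lemma rc_ratio_max : resolvent_closure (fun x => x / Num.max x alpha).
Proof.
have rM := rc_max_kernel ltr01 c0.
have ri : resolvent_closure (fun x : R => (Num.max (x + 1)^-1 c)^-1).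
  by apply: (@rc_inv _ c) => // x x0; rewrite le_max lexx orbT.
apply: rc_ext (rc_scale alpha^-1 (rc_sub ri (rc_cst 1))).
  apply: measurable_funM => //.
  by apply: measurableT_comp mmax; exact: measurable_inv.
move=> x x0; have x1 : 0 < x + 1 by rewrite ltr_wpDl.
have a1 : 0 < alpha + 1 by rewrite addr_gt0.
rewrite /c; have [xa|ax] := leP x alpha.
  by rewrite max_l ?lef_pV2 ?posrE ?lerD2r// invrK addrK mulrC.
rewrite max_r ?lef_pV2 ?posrE ?lerD2r ?(ltW ax)// invrK addrK mulVf ?gt_eqF//.
by rewrite divff// gt_eqF// (lt_trans alpha0).
Qed.

Lemma rc_ratio_shift : resolvent_closure (fun x => x / (x + alpha)).
Proof.
apply: rc_ext (rc_sub (rc_cst 1) (rc_scale alpha (rc_kernel alpha0))).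
  by apply: measurable_funM => //; exact: measurable_shift_inv.
by move=> x x0; field; rewrite gt_eqF// ltr_wpDl.
Qed.

End spectral_maps.

End resolvent_closure.

(** * Spectral sums and their limits *)

Section spectral_sums.
Context {R : realType} d0 (T : measurableType d0) (n : nat).
Variables (wt ev : T -> 'I_n -> R).
Hypothesis ev0 : forall w i, 0 <= ev w i.
Hypothesis measurable_kernel : forall t, 0 < t ->
  measurable_fun [set: T] (fun w => \sum_i wt w i * (ev w i + t)^-1).
Hypothesis measurable_mass : measurable_fun [set: T] (fun w => \sum_i wt w i).

(** One form for [b^T f(G) b], for the normalized trace and, with signed weights, for an entry of
    [f(G)]. Weights and points are not assumed measurable, since they come from a choice; only their
    total mass and sums against kernels are. *)
Definition spectral_sum (f : R -> R) (w : T) : R := \sum_i wt w i * f (ev w i).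

Lemma spectral_sumD f g w :
  spectral_sum (fun x => f x + g x) w = spectral_sum f w + spectral_sum g w.
Proof. by rewrite -big_split; apply: eq_bigr => i _; rewrite mulrDr. Qed.

Lemma spectral_sumZ c f w : spectral_sum (fun x => c * f x) w = c * spectral_sum f w.
Proof. by rewrite mulr_sumr; apply: eq_bigr => i _; rewrite mulrCA. Qed.

Lemma spectral_sum_dist f g e w : (forall x, 0 <= x -> `|f x - g x| <= e) ->
  `|spectral_sum f w - spectral_sum g w| <= (\sum_i `|wt w i|) * e.
Proof.
move=> fg; rewrite /spectral_sum -sumrB mulr_suml; apply: le_trans (ler_norm_sum _ _ _) _.
by apply: ler_sum => i _; rewrite -mulrBr normrM ler_wpM2l// fg.
Qed.

(** The uniform-limit case only needs pointwise convergence, so the total variation of the weights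
    may depend on [w]. *)
Lemma measurable_spectral_sum f : resolvent_closure f ->
  measurable_fun [set: T] (spectral_sum f).
Proof.
elim=> {f}.
- move=> c; rewrite (_ : spectral_sum _ = fun w => (\sum_i wt w i) * c).
    exact: measurable_funM.
  by apply/funext => w; rewrite mulr_suml.
- exact: measurable_kernel.
- move=> f g _ mf _ mg; rewrite (_ : spectral_sum _ = spectral_sum f \+ spectral_sum g).
    exact: measurable_funD.
  by apply/funext => w; exact: spectral_sumD.
- move=> c f _ mf; rewrite (_ : spectral_sum _ = fun w => c * spectral_sum f w).
    exact: measurable_funM.
  by apply/funext => w; exact: spectral_sumZ.
- move=> f g _ _ mg fg.
  apply: (@measurable_fun_cvg _ _ _ _ (fun m => spectral_sum (g m))) => // w _.
  apply: cvg_dist0; apply: (cvg0_squeeze (v := fun m => (\sum_i `|wt w i|) * m.+1%:R^-1)).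
    apply: nearW => m; rewrite normr_ge0/= distrC.
    exact: spectral_sum_dist (fg m).
  move: (\sum_i _) => K.
  rewrite -[X in _ --> X](mulr0 K); apply: cvgM; [exact: cvg_cst|exact: cvg_harmonic].
Qed.

End spectral_sums.

Section spectral_limits.
Context {R : realType} (lambda : R).
Hypotheses (l0 : 0 < lambda) (l1 : lambda < 1).
Context (disp : nat -> measure_display) (T : forall k, measurableType (disp k))
  (P : forall k, probability (T k) R) (n : nat -> nat).
Variables (wt ev : forall k, T k -> 'I_(n k) -> R).
Arguments wt : clear implicits.
Arguments ev : clear implicits.
Hypothesis wt0 : forall k w i, 0 <= wt k w i.
Hypothesis wt1 : forall k w, \sum_i wt k w i = 1.
Hypothesis ev0 : forall k w i, 0 <= ev k w i.
Hypothesis measurable_kernel : forall k t, 0 < t ->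
  measurable_fun [set: T k] (spectral_sum (wt k) (ev k) (fun x => (x + t)^-1)).
Hypothesis cvg_kernel : forall t, 0 < t ->
  (fun k => \int[P k]_w spectral_sum (wt k) (ev k) (fun x => (x + t)^-1) w) @ \oo
    --> mp_stieltjes lambda t.

Local Notation F k := (spectral_sum (wt k) (ev k)).

Let mF f k : resolvent_closure f -> measurable_fun [set: T k] (F k f).
Proof.
apply: measurable_spectral_sum => //; first exact: measurable_kernel.
by rewrite (_ : (fun w => _) = fun=> 1)//; apply/funext => w; exact: wt1.
Qed.

Let Fdist f g e k w : (forall x, 0 <= x -> `|f x - g x| <= e) ->
  `|F k f w - F k g w| <= e.
Proof.
move=> /(spectral_sum_dist (wt k) (@ev0 k) w); rewrite (eq_bigr (wt k w)) ?wt1 ?mul1r// => i _.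
by rewrite ger0_norm.
Qed.

Lemma spectral_sum_bounded f : resolvent_closure f ->
  exists2 C, 0 <= C & forall k w, `|F k f w| <= C.
Proof.
move=> /rc_bounded[C C0 fC]; exists C => // k w.
have := @Fdist f (fun=> 0) C k w.
rewrite {2}/spectral_sum big1 ?subr0; last by move=> i _; rewrite mulr0.
by apply=> x x0; rewrite subr0 fC.
Qed.

Lemma spectral_sum_integrable f k : resolvent_closure f ->
  (P k).-integrable setT (EFin \o F k f).
Proof.
move=> rf; have [C _ FC] := spectral_sum_bounded rf.
by apply: (@bounded_integrable _ _ _ _ _ C) => [|w]; [exact: mF|exact: FC].
Qed.

(** Both the expectation and the limiting mean integrate against total mass one, so a uniform
    approximation of [f] costs the same in each, whatever [k]; a three-epsilon argument handles
    [rc_uniform]. *)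
Lemma cvg_spectral_sum f : resolvent_closure f ->
  (fun k => \int[P k]_w F k f w) @ \oo --> mp_mean lambda f.
Proof.
have mpi g : resolvent_closure g ->
    lebesgue_measure.-integrable setT (EFin \o (fun x => g x * mp_pdf lambda x)).
  move=> rg; have [C _ gC] := rc_bounded rg.
  apply: (mp_bounded_integrable l0 l1 (rc_measurable rg) (C := C)) => x /andP[ax _].
  by apply: gC; apply: le_trans ax; exact: ltW (mp_left_gt0 l1).
elim=> {f}.
- move=> c; rewrite mp_mean_cst//.
  under eq_fun => k.
    under eq_Rintegral do rewrite /spectral_sum -mulr_suml wt1 mul1r.
    rewrite expectation_const; over.
  exact: cvg_cst.
- by move=> t t0; rewrite mp_mean_resolvent//; exact: cvg_kernel.
- move=> f g rf cf rg cg; rewrite mp_meanD//; [|exact: mpi|exact: mpi].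
  under eq_fun => k.
    under eq_Rintegral do rewrite spectral_sumD.
    rewrite RintegralD//; last 2 first.
      exact: spectral_sum_integrable.
      exact: spectral_sum_integrable.
    over.
  exact: cvgD.
- move=> c f rf cf; rewrite mp_meanZ//; last exact: mpi.
  under eq_fun => k.
    under eq_Rintegral do rewrite spectral_sumZ.
    rewrite RintegralZl//; last exact: spectral_sum_integrable.
    over.
  by apply: cvgM => //; exact: cvg_cst.
- move=> f g mf rg cg fg.
  have rf : resolvent_closure f by exact: rc_uniform fg.
  apply/cvgrPdist_le => e e0.
  have e3 : 0 < e / 3 by exact: divr_gt0.
  have [m me] : exists m, m.+1%:R^-1 <= e / 3.
    by have [m] := ltr_add_invr e3; rewrite add0r => /ltW h; exists m.
  have fge x : 0 <= x -> `|f x - g m x| <= e / 3.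
    by move=> x0; apply: le_trans (fg m x x0) me.
  have h1 : `|mp_mean lambda f - mp_mean lambda (g m)| <= e / 3.
    apply: mp_mean_dist => //; [exact: rc_measurable (rg m)|exact: mpi|move=> x /andP[ax _]].
    by apply: fge; apply: le_trans ax; exact: ltW (mp_left_gt0 l1).
  have := cg m => /cvgrPdist_le /(_ _ e3); apply: filterS => k.
  have h2 : `|\int[P k]_w F k f w - \int[P k]_w F k (g m) w| <= e / 3.
    rewrite -RintegralB//; last 2 first.
    - exact: spectral_sum_integrable.
    - exact: spectral_sum_integrable.
    apply: le_bounded_expectation; first by apply: measurable_funB; exact: mF.
    by move=> w; exact: Fdist.
  move: h1 h2; move: (mp_mean _ _) (mp_mean _ _) (\int[_]_w _) (\int[_]_w _) => x y z u.
  rewrite !ler_norml => /andP[? ?] /andP[? ?] /andP[? ?]; apply/andP; split; lra.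
Qed.

End spectral_limits.

(** * The test error *)

Section test_point.
Context d0 (T : measurableType d0) {R : realType} (Q : probability T R).
Context (d : nat) (x : 'I_d -> {RV Q >-> R}) (v : R).
Hypotheses (v0 : 0 < v) (xnormal : iid_centered_normal x v).

Lemma test_mseE (b0 b : 'cV[R]_d) :
  test_mse x b0 b = (v * dotc (b0 - b) (b0 - b))%:E.
Proof.
set c := b0 - b; rewrite /test_mse unlock.
have E w : (dotc (random_vector x w) b0 - dotc (random_vector x w) b) ^+ 2 =
    \sum_i \sum_j (c i 0 * c j 0) * (x i w * x j w).
  rewrite -dotcBr -/c expr2 /dotc mulr_suml; apply: eq_bigr => i _.
  rewrite mulr_sumr; apply: eq_bigr => j _; rewrite !mxE; ring.
have ic i j : Q.-integrable setT (EFin \o (fun w => (c i 0 * c j 0) * (x i w * x j w))).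
  by apply: (integrableZl measurableT (c i 0 * c j 0) (gaussian_covariance v0 xnormal i j).1).
have [is1 Es1] := Rintegral_sum (index_enum 'I_d)
  (fun i => (Rintegral_sum (index_enum 'I_d) (ic i)).1).
under eq_integral do rewrite E.
rewrite -(fineK (integrable_fin_num measurableT is1)); congr EFin.
rewrite -/(Rintegral _ _ _) Es1 /dotc mulr_sumr; apply: eq_bigr => i _.
have [_ ->] := Rintegral_sum (index_enum _) (ic i).
rewrite (bigD1 i)//= big1 ?addr0 => [|j ji]; rewrite RintegralZl//;
  try exact: (gaussian_covariance v0 xnormal i _).1.
- by rewrite /Rintegral (gaussian_covariance v0 xnormal i i).2 eqxx mulr1n mulrC.
- by rewrite /Rintegral (gaussian_covariance v0 xnormal i j).2 eq_sym (negbTE ji) mulr0n mulr0.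
Qed.

End test_point.

Section noise.
Context d0 (T : measurableType d0) {R : realType} (P : probability T R).
Context (I : finType) (N d : nat) (Z : I -> {RV P >-> R}) (eps : 'I_N -> {RV P >-> R}).
Hypothesis eps_normal : iid_centered_normal eps 1.
Hypothesis Zeps : independent_families Z eps.

(** [T] with the sigma-algebra generated by the family. A function of the family is a map measurable
    on this type, and the identity into it turns independence of families into independence of a
    pair. *)
Definition family_type (J : finType) (W : J -> {RV P >-> R}) :=
  g_sigma_algebraType (\bigcup_(i in [set: J]) g_sigma_algebra_preimage (W i)).

Lemma measurable_family (J : finType) (W : J -> {RV P >-> R}) j :
  measurable_fun [set: family_type W] (W j).
Proof.
move=> _ B mB; rewrite setTI; apply: sub_sigma_algebra; exists j => //.
by exists B => //; rewrite setTI.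
Qed.

Definition to_family (J : finType) (W : J -> {RV P >-> R}) : T -> family_type W := id.

Lemma measurable_to_family (J : finType) (W : J -> {RV P >-> R}) :
  measurable_fun [set: T] (to_family W).
Proof.
move=> _ A mA; rewrite setTI.
apply: (smallest_sub (@sigma_algebra_measurable _ T) _ mA) => _ [j _ [B mB <-]].
exact: measurable_funP.
Qed.
HB.instance Definition _ (J : finType) (W : J -> {RV P >-> R}) :=
  isMeasurableFun.Build _ _ _ _ (to_family W) (@measurable_to_family J W).

Let ind A B : measurable A -> measurable B ->
  (P (to_family Z @^-1` A `&` to_family eps @^-1` B) =
   P (to_family Z @^-1` A) * P (to_family eps @^-1` B))%E.
Proof. exact: Zeps. Qed.

Variables (u : T -> 'cV[R]_d) (B : T -> 'M[R]_(d, N)) (sigma : R).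
Hypothesis mu : measurable_mx (u : family_type Z -> 'cV[R]_d).
Hypothesis mB : measurable_mx (B : family_type Z -> 'M[R]_(d, N)).
Hypothesis iu : P.-integrable setT (fun w => (dotc (u w) (u w))%:E).
Hypothesis iB : P.-integrable setT (fun w => (\tr (B w *m (B w)^T))%:E).

Let noise w := random_vector eps w.

Let toT (g : T -> R) : measurable_fun [set: family_type Z] g -> measurable_fun [set: T] g.
Proof. by move=> mg; apply: (measurableT_comp mg (@measurable_to_family _ Z)). Qed.

Let trE w : \tr (B w *m (B w)^T) = \sum_i \sum_j B w i j ^+ 2.
Proof.
by apply: eq_bigr => i _; rewrite mxE; apply: eq_bigr => j _; rewrite !mxE expr2.
Qed.

Let tr0 w : 0 <= \tr (B w *m (B w)^T).
Proof. by rewrite trE; do 2 (apply: sumr_ge0 => ? _); exact: sqr_ge0. Qed.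

Let entry_le w i j : B w i j ^+ 2 <= \tr (B w *m (B w)^T).
Proof.
rewrite trE (bigD1 i)//= (bigD1 j)//= -addrA lerDl addr_ge0//.
  by apply: sumr_ge0 => ? _; exact: sqr_ge0.
by do 2 (apply: sumr_ge0 => ? _); exact: sqr_ge0.
Qed.

Let norm_mul_le (a b : R) : `|a * b| <= a ^+ 2 + b ^+ 2.
Proof.
rewrite normrM -(real_normK (num_real a)) -(real_normK (num_real b)).
by move: `|a| `|b| => x y; have := sqr_ge0 (x - y); have := sqr_ge0 x; have := sqr_ge0 y; nra.
Qed.

(** The bound [|a b| <= a^2 + b^2] derives integrability of every product from that of the squared
    norm of [B]. *)
Let iBB i j k : P.-integrable setT (fun w => (B w k i * B w k j)%:E).
Proof.
apply: (@le_integrable _ _ _ P _ measurableT _ (fun w => 2%:E * (\tr (B w *m (B w)^T))%:E)%E).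
- by apply/measurable_EFinP; apply: toT; apply: measurable_funM; exact: mB.
- move=> w _ /=; rewrite lee_fin (le_trans (norm_mul_le _ _))// ger0_norm ?mulr_ge0//.
  by rewrite mulr_natl mulr2n lerD.
- exact: integrableZl.
Qed.

Let iuB i k : P.-integrable setT (fun w => (u w k 0 * B w k i)%:E).
Proof.
apply: (@le_integrable _ _ _ P _ measurableT _
  (fun w => (dotc (u w) (u w))%:E + (\tr (B w *m (B w)^T))%:E)%E).
- by apply/measurable_EFinP; apply: toT; apply: measurable_funM; [exact: mu|exact: mB].
- move=> w _ /=; rewrite lee_fin (le_trans (norm_mul_le _ _))// ger0_norm ?addr_ge0 ?dotc_ge0//.
  by rewrite lerD// sqr_entry_le_dotc.
- exact: integrableD.
Qed.

Let q i j w := \sum_k B w k i * B w k j.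
Let r i w := \sum_k u w k 0 * B w k i.

Let mq i j : measurable_fun [set: family_type Z] (q i j).
Proof. by apply: measurable_sum => k; apply: measurable_funM; exact: mB. Qed.
Let mr i : measurable_fun [set: family_type Z] (r i).
Proof. by apply: measurable_sum => k; apply: measurable_funM; [exact: mu|exact: mB]. Qed.
Let iq i j : P.-integrable setT (EFin \o (q i j : T -> R)).
Proof. by have [] := Rintegral_sum (index_enum _) (iBB i j). Qed.
Let ir i : P.-integrable setT (EFin \o (r i : T -> R)).
Proof. by have [] := Rintegral_sum (index_enum _) (iuB i). Qed.

Let dotcE2 w : dotc (u w - sigma *: (B w *m noise w)) (u w - sigma *: (B w *m noise w)) =
  dotc (u w) (u w) + ((- 2 * sigma) * (\sum_i r i w * eps i w) +
    sigma ^+ 2 * \sum_i \sum_j q i j w * (eps i w * eps j w)).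
Proof.
have E1 : dotc (u w) (B w *m noise w) = \sum_i r i w * eps i w.
  rewrite /dotc /r; under eq_bigr do rewrite mxE mulr_sumr.
  rewrite exchange_big; apply: eq_bigr => i _; rewrite mulr_suml.
  by apply: eq_bigr => k _; rewrite !mxE mulrA.
have E2 : dotc (B w *m noise w) (B w *m noise w) =
    \sum_i \sum_j q i j w * (eps i w * eps j w).
  transitivity (\sum_k \sum_i \sum_j B w k i * B w k j * (eps i w * eps j w)).
    apply: eq_bigr => k _; rewrite mxE mulr_suml; apply: eq_bigr => i _.
    by rewrite mulr_sumr; apply: eq_bigr => j _; rewrite !mxE; ring.
  rewrite exchange_big; apply: eq_bigr => i _.
  rewrite exchange_big; apply: eq_bigr => j _.
  by rewrite mulr_suml.
rewrite dotc_sqrB dotcZr (dotcC (sigma *: _)) dotcZr dotcZr E1 E2; ring.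
Qed.

(** The noise is centered and independent of [u] and [B], so the cross term vanishes; its identity
    covariance keeps only the diagonal of [B^T B]. *)
Lemma noise_average :
  P.-integrable setT (fun w => (dotc (u w - sigma *: (B w *m noise w))
    (u w - sigma *: (B w *m noise w)))%:E) /\
  \int[P]_w dotc (u w - sigma *: (B w *m noise w)) (u w - sigma *: (B w *m noise w)) =
  \int[P]_w dotc (u w) (u w) + sigma ^+ 2 * \int[P]_w \tr (B w *m (B w)^T).
Proof.
have ie i : P.-integrable setT (EFin \o ((eps i : family_type eps -> R) \o to_family eps)).
  exact: gaussian_integrable ltr01 eps_normal i.
have me i := @measurable_family _ eps i.
have mee i j : measurable_fun [set: family_type eps] (fun w => eps i w * eps j w).
  by apply: measurable_funM; exact: measurable_family.
have iee i j : P.-integrable setT (EFin \o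
    ((fun w : family_type eps => eps i w * eps j w) \o to_family eps)).
  exact: (gaussian_covariance ltr01 eps_normal i j).1.
have ire i : P.-integrable setT (EFin \o (fun w => r i w * eps i w)).
  exact: (integrable_joint_prod ind (mr i) (me i) (ir i) (ie i)).
have Ere i : \int[P]_w (r i w * eps i w) = 0.
  rewrite /Rintegral (integral_joint_prod ind (mr i) (me i) (ir i) (ie i)).
  by rewrite (gaussian_mean ltr01 eps_normal i) mule0.
have iqe i j : P.-integrable setT (EFin \o (fun w => q i j w * (eps i w * eps j w))).
  exact: (integrable_joint_prod ind (mq i j) (mee i j) (iq i j) (iee i j)).
have Eqe i j : \int[P]_w (q i j w * (eps i w * eps j w)) = (\int[P]_w q i j w) *+ (i == j).
  rewrite /Rintegral (integral_joint_prod ind (mq i j) (mee i j) (iq i j) (iee i j)).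
  rewrite fineM; [|exact: (integrable_fin_num measurableT (iq i j))
                  |exact: (integrable_fin_num measurableT (iee i j))].
  rewrite [X in _ * fine X](gaussian_covariance ltr01 eps_normal i j).2/=.
  by rewrite mulrnAr mulr1.
have [is1 E1] := Rintegral_sum (index_enum _) ire.
have is2' i : P.-integrable setT (EFin \o (fun w => \sum_j q i j w * (eps i w * eps j w))).
  by have [] := Rintegral_sum (index_enum _) (iqe i).
have [is2 E2] := Rintegral_sum (index_enum _) is2'.
have is1s : P.-integrable setT (EFin \o (fun w => (- 2 * sigma) * (\sum_i r i w * eps i w))).
  exact: (integrableZl measurableT (- 2 * sigma) is1).
have is2s : P.-integrable setT (EFin \o (fun w =>
    sigma ^+ 2 * \sum_i \sum_j q i j w * (eps i w * eps j w))).
  exact: (integrableZl measurableT (sigma ^+ 2) is2).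
have is12 := integrableD measurableT is1s is2s.
have iall := integrableD measurableT iu is12.
split.
  by move: iall; congr (integrable _ _ _); apply/funext => w; rewrite dotcE2.
under eq_Rintegral do rewrite dotcE2.
rewrite RintegralD// RintegralD// RintegralZl// RintegralZl// E1 E2.
rewrite [X in _ * X + _]big1// mulr0 add0r; congr (_ + _ * _).
transitivity (\sum_i \int[P]_w q i i w).
  apply: eq_bigr => i _; have [_ ->] := Rintegral_sum (index_enum _) (iqe i).
  rewrite (bigD1 i)//= Eqe eqxx mulr1n big1 ?addr0// => j ji.
  by rewrite Eqe eq_sym (negbTE ji).
have [_ <-] := Rintegral_sum (index_enum _) (fun i => iq i i).
apply: eq_Rintegral => w _; rewrite trE exchange_big.
by apply: eq_bigr => i _; apply: eq_bigr => k _; rewrite expr2.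
Qed.

End noise.

Section limit_error_mean.
Context {R : realType} (lambda beta sigma alpha : R) (p : penalty).
Hypotheses (l0 : 0 < lambda) (l1 : lambda < 1).
Variables (h1 h2 : R -> R) (C : R).
Hypotheses (mh1 : measurable_fun setT h1) (mh2 : measurable_fun setT h2).
Hypothesis h1C : forall x, mp_left lambda <= x <= mp_right lambda -> `|h1 x| <= C.
Hypothesis h2C : forall x, mp_left lambda <= x <= mp_right lambda -> `|h2 x| <= C.
Hypothesis h1E : forall x, 0 < x -> h1 x = (1 - x / spectral_map p alpha x) ^+ 2.
Hypothesis h2E : forall x, 0 < x -> h2 x = x / spectral_map p alpha x ^+ 2.

(** [h1] and [h2] need only match the integrand on [(0, +oo)], since the support lies there. This
    lets the singular case use functions that differ from it at [0]. *)
Lemma limit_errorE : limit_error p lambda beta sigma alpha =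
  (lambda * (beta ^+ 2 * mp_mean lambda h1 + sigma ^+ 2 * mp_mean lambda h2))%:E.
Proof.
have i1 := mp_bounded_integrable l0 l1 mh1 h1C.
have i2 := mp_bounded_integrable l0 l1 mh2 h2C.
have mf : measurable_fun [set: R] (spectral_map p alpha).
  case: p => /=; first exact: measurable_maxr.
  - exact: measurable_funD.
  - exact: measurable_funM.
pose g x := beta ^+ 2 * (1 - x / spectral_map p alpha x) ^+ 2
      + sigma ^+ 2 * (x / spectral_map p alpha x ^+ 2).
have minv (f : R -> R) : measurable_fun [set: R] f -> measurable_fun [set: R] (fun x => (f x)^-1).
  by move=> mf'; apply: measurableT_comp mf'; exact: measurable_inv.
have mg : measurable_fun [set: R] g.
  apply: measurable_funD; apply: measurable_funM => //.
    apply: measurable_funX; apply: measurable_funB => //.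
    by apply: measurable_funM => //; exact: minv.
  by apply: measurable_funM => //; apply: minv; exact: measurable_funX.
rewrite /limit_error EFinM; congr (_ * _)%E.
rewrite (integral_density (mu := lebesgue_measure) (mp_pdf_ge0 lambda)
  (measurable_mp_pdf lambda) _ mg)//.
have j1 : lebesgue_measure.-integrable setT
    (EFin \o (fun x => beta ^+ 2 * (h1 x * mp_pdf lambda x))).
  exact: (integrableZl measurableT (beta ^+ 2) i1).
have j2 : lebesgue_measure.-integrable setT
    (EFin \o (fun x => sigma ^+ 2 * (h2 x * mp_pdf lambda x))).
  exact: (integrableZl measurableT (sigma ^+ 2) i2).
rewrite /mp_mean -RintegralZl// -RintegralZl// -RintegralD//.
have iD := integrableD measurableT j1 j2.
rewrite /Rintegral fineK; last exact: (integrable_fin_num measurableT iD).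
apply: eq_integral => x _; congr EFin; rewrite /mp_pdf; case: ifP; last by rewrite !mulr0 addr0.
rewrite in_itv/= => /andP[ax _].
have x0 : 0 < x by exact: lt_le_trans (mp_left_gt0 l1) ax.
by rewrite h1E// h2E// /g; move: (_ / _) (Num.sqrt _ / _) => ? ?; ring.
Qed.

End limit_error_mean.

Section inverse_limit.
Context {R : realType} (lambda : R) (N d : nat -> nat).
Hypotheses (l0 : 0 < lambda) (l1 : lambda < 1).
Hypotheses (N_gt0 : forall k, (0 < N k)%N) (d_gt0 : forall k, (0 < d k)%N).
Hypothesis cvgN : N @ \oo --> \oo.
Hypothesis cvg_ratio : (fun k => (d k)%:R / (N k)%:R : R) @ \oo --> lambda.
Context (disp : nat -> measure_display) (T : forall k, measurableType (disp k))
  (P : forall k, probability (T k) R)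
  (Z : forall k, 'I_(N k) * 'I_(d k) -> {RV (P k) >-> R}).
Arguments Z : clear implicits.
Hypothesis Znormal : forall k, iid_centered_normal (Z k) (N k)%:R^-1.

Let X k w := mx_of (Z k ^~ w).
Arguments X : clear implicits.

Let kappa k : R := 1 - (d k)%:R / (N k)%:R - (N k)%:R^-1.

Let k0 : 0 < 1 - lambda. Proof. by rewrite subr_gt0. Qed.

Let cvg_kappa : kappa @ \oo --> 1 - lambda.
Proof.
have := cvgB (cvgB (@cvg_cst _ (1 : R) _ \oo _) cvg_ratio) (cvg_inv_nat (R := R) cvgN).
by rewrite subr0; apply.
Qed.

Lemma dimension_gap_gt0 : \forall k \near \oo, 0 < kappa k.
Proof. exact: (cvgr_gt _ cvg_kappa). Qed.

(** A sandwich between [E m] at a fixed small [t] and [kappa^-1]; both bounds have limits close to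
    [(1 - lambda)^-1]. *)
Lemma cvg_inverse_trace :
  (fun k => \int[P k]_w (if \det (gram (X k w)) == 0 then 0 else inverse_trace (X k w)))
    @ \oo --> (1 - lambda)^-1.
Proof.
pose h k w := if \det (gram (X k w)) == 0 then 0 else inverse_trace (X k w).
have cvg_kV : (fun k => (kappa k)^-1) @ \oo --> (1 - lambda)^-1.
  by apply: cvgV => //; rewrite gt_eqF.
apply/cvgrPdist_le => e e0.
set K := ((1 - lambda)^-1 + lambda * (1 - lambda) ^- 2) / (1 - lambda).
have K0 : 0 < K.
  by rewrite divr_gt0// addr_gt0 ?invr_gt0// mulr_gt0// invr_gt0 exprn_gt0.
have e2 : 0 < e / 2 by exact: divr_gt0.
(* Chosen so that the limit of the lower bound is within [e / 2] of the target. *)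
pose t := e / 2 / K.
have t0 : 0 < t by exact: divr_gt0.
have tK : t * K = e / 2 by rewrite divfK// gt_eqF.
have := cvg_kV => /cvgrPdist_le /(_ _ e0) H1.
have := cvg_mean_trace l0 l1 N_gt0 d_gt0 cvgN cvg_ratio Znormal t0.
move=> /cvgrPdist_le /(_ _ e2) H2.
have := mp_stieltjes_dist l0 l1 (ltW t0); rewrite -/K tK => D.
near=> k.
have kk : 0 < kappa k by near: k; exact: dimension_gap_gt0.
have [_ hu hl] := inverse_trace_integral (N_gt0 k) (d_gt0 k) (Znormal k) kk.
have {}hl := hl t t0.
have A1 : `|(1 - lambda)^-1 - (kappa k)^-1| <= e by near: k.
have A2 : `|mp_stieltjes lambda t - \int[P k]_w mean_trace t (X k w)| <= e / 2 by near: k.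
rewrite -[X in `|_ - X|]/(\int[P k]_w h k w).
have {}hu : \int[P k]_w h k w <= (kappa k)^-1 by exact: hu.
have {}hl : \int[P k]_w mean_trace t (X k w) <= \int[P k]_w h k w by exact: hl.
move: hu hl A1 A2 D; generalize (kappa k)^-1 (mp_stieltjes lambda t)
  (\int[P k]_w mean_trace t (X k w)) (\int[P k]_w h k w) (1 - lambda)^-1 => a m i j b.
rewrite !ler_norml => ? ? /andP[? ?] /andP[? ?] /andP[? ?]; apply/andP; split; lra.
Unshelve. all: by end_near. Qed.

End inverse_limit.

Section estimator_algebra.
Context {R : realType}.
Implicit Types (p : penalty) (alpha sigma : R).

Lemma biased_gram_fcalc p alpha N d (X : 'M[R]_(N, d)) :
  biased_gram p alpha (gram X) = fcalc (spectral_map p alpha) (gram X).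
Proof.
case: p => //=; first exact: gramD_fcalc.
rewrite -[in LHS](fcalc_id (trmx_gram X)) -fcalcZ.
by apply: eq_fcalc => i; rewrite mulrC.
Qed.

Lemma estimator_error p alpha sigma N d (X : 'M[R]_(N, d)) (b : 'cV[R]_d) (e : 'cV[R]_N) :
  let A := invmx (biased_gram p alpha (gram X)) in
  b - bias_constrained_estimator p alpha X (X *m b + sigma *: e) =
  (b - A *m gram X *m b) - sigma *: (A *m X^T *m e).
Proof.
move=> A; rewrite /bias_constrained_estimator -/A mulmxDr -scalemxAr opprD addrA.
by congr (_ - _ - _); rewrite !mulmxA.
Qed.

(** For [v = 0] any unit vector serves, and [0 < d] provides one. *)
Lemma unit_direction d (v : 'cV[R]_d) : (0 < d)%N ->
  exists b : 'cV[R]_d, dotc b b = 1 /\ v = Num.sqrt (dotc v v) *: b.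
Proof.
move=> d0; have [v0|v0] := eqVneq (dotc v v) 0.
  exists (delta_mx (Ordinal d0) 0); split; first exact: dotc_delta.
  by rewrite v0 sqrtr0 scale0r; apply/eqP; rewrite -dotc_eq0 v0.
have s0 : Num.sqrt (dotc v v) != 0 by rewrite gt_eqF// sqrtr_gt0 lt_neqAle eq_sym v0 dotc_ge0.
exists ((Num.sqrt (dotc v v))^-1 *: v); split; last by rewrite scalerA divff// scale1r.
rewrite dotcZr dotcC dotcZr mulrA -expr2 exprVn sqr_sqrtr ?dotc_ge0//.
by rewrite mulVf.
Qed.

Lemma spectral_weightZ d (G : 'M[R]_d) c b i :
  spectral_weight G (c *: b) i = c ^+ 2 * spectral_weight G b i.
Proof. by rewrite /spectral_weight -scalemxAr mxE exprMn. Qed.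

Section decomposition.
Variables (p : penalty) (alpha : R) (N d : nat) (X : 'M[R]_(N, d)).
Let f := spectral_map p alpha.
Let G := gram X.
Let A := invmx (biased_gram p alpha G).
Hypothesis f0 : forall i, f (eigval G i) != 0.

Let Gsym : G^T = G. Proof. exact: trmx_gram. Qed.

Let AE : A = fcalc (fun x => (f x)^-1) G.
Proof. by rewrite /A biased_gram_fcalc invmx_fcalc. Qed.

Let AGE : A *m G = fcalc (fun x => x / f x) G.
Proof.
rewrite AE -{2}(fcalc_id Gsym) fcalcM//; apply: eq_fcalc => i.
by rewrite mulrC.
Qed.

Lemma bias_spectral (b : 'cV[R]_d) :
  dotc (b - A *m G *m b) (b - A *m G *m b) =
  \sum_i spectral_weight G b i * (1 - eigval G i / f (eigval G i)) ^+ 2.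
Proof.
have -> : b - A *m G *m b = fcalc (fun x => 1 + -1 * (x / f x)) G *m b.
  by rewrite fcalcD fcalcZ fcalc_cst// AGE mulmxDl mul1mx -scalemxAl scaleN1r.
rewrite -dotcE trmx_mul trmx_fcalc -mulmxA (mulmxA (fcalc _ _)) fcalcM// dotcE.
rewrite dotc_fcalc//; apply: eq_bigr => i _.
by rewrite mulN1r expr2.
Qed.

Lemma variance_spectral :
  \tr (A *m X^T *m (A *m X^T)^T) = \sum_i eigval G i / f (eigval G i) ^+ 2.
Proof.
rewrite trmx_mul trmxK !mulmxA -(mulmxA A) -/(gram X) -/G AGE AE trmx_fcalc fcalcM//.
rewrite mxtrace_fcalc//; apply: eq_bigr => i _.
by rewrite -mulrA -expr2 exprVn.
Qed.

End decomposition.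

End estimator_algebra.

Section estimator_measurability.
Context {R : realType} d0 (S : measurableType d0) (N d : nat).
Variables (M : S -> 'M[R]_(N, d)) (p : penalty) (alpha : R).
Hypotheses (mM : measurable_mx M) (alpha0 : 0 <= alpha).

(** An entry of [fcalc f] is a spectral sum with signed weights [U i k * U j k], so measurability is
    inherited from the resolvent and not from the chosen eigenvectors. *)
Lemma measurable_fcalc f : resolvent_closure f ->
  measurable_mx (fun s => fcalc f (gram (M s))).
Proof.
move=> rf i j; pose U s := (diagonalization (gram (M s))).1.
pose wt s k := U s i k * U s j k; pose ev s k := eigval (gram (M s)) k.
have E g s : fcalc g (gram (M s)) i j = spectral_sum wt ev g s.
  by rewrite fcalc_entry; apply: eq_bigr => k _; rewrite mulrAC.
under eq_fun do rewrite E.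
apply: measurable_spectral_sum => // [s k|t t0|]; first exact: eigval_gram_ge0.
  rewrite -[X in measurable_fun _ X]/(spectral_sum wt ev (fun x => (x + t)^-1)).
  rewrite (_ : spectral_sum _ _ _ = fun s => resolvent (M s) t i j).
    exact: measurable_resolvent.
  by apply/funext => s; rewrite resolvent_fcalc// E.
(* The total mass of these weights is an entry of [U U^T = 1], hence constant. *)
rewrite (_ : (fun s => _) = fun=> (1%:M : 'M[R]_d) i j)//; apply/funext => s.
rewrite -(fcalc_cst (trmx_gram (M s)) 1) E; apply: eq_bigr => k _.
by rewrite mulr1.
Qed.

Lemma measurable_biased_inverse :
  measurable_mx (fun s => invmx (biased_gram p alpha (gram (M s)))).
Proof.
have mG := measurable_gram mM.
case: p => /=.
(* The closure argument requires a positive threshold; at [alpha = 0] the nuclear map fixes the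
   nonnegative spectrum and the Gram matrix is unchanged. *)
- have [->|a0] := eqVneq alpha 0.
    have E s : biased_gram Nuclear 0 (gram (M s)) = gram (M s).
      rewrite biased_gram_fcalc -[RHS](fcalc_id (trmx_gram (M s))).
      by apply: eq_fcalc => i; rewrite /= max_l// eigval_gram_ge0.
    by have := measurable_invmx mG; under eq_fun do rewrite -E.
  have ap : 0 < alpha by rewrite lt_neqAle eq_sym a0.
  have E s : invmx (biased_gram Nuclear alpha (gram (M s))) =
      fcalc (fun x => (Num.max x alpha)^-1) (gram (M s)).
    rewrite biased_gram_fcalc invmx_fcalc//; first exact: trmx_gram.
    by move=> i; rewrite gt_eqF//= lt_max ap orbT.
  by have := measurable_fcalc (rc_inv_max ap); under eq_fun do rewrite -E.
- apply: measurable_invmx; apply: measurable_addmx => //; exact: measurable_cstmx.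
- by apply: measurable_invmx; apply: measurable_scalemx.
Qed.

End estimator_measurability.

Section null_set.
Context d0 (T : measurableType d0) {R : realType} (P : probability T R).

(** Lets the explicit error formulas, valid only where the regularized Gram matrix is invertible,
    determine integrals whose integrands take default values on a null event. *)
Lemma null_set_integral (S : set T) (f g : T -> R) : measurable S -> P S = 0%E ->
  measurable_fun setT f -> P.-integrable setT (EFin \o g) ->
  (forall w, ~ S w -> f w = g w) ->
  P.-integrable setT (EFin \o f) /\ \int[P]_w f w = \int[P]_w g w.
Proof.
move=> mS PS mf ig fg.
have ae : ae_eq P setT (EFin \o f) (EFin \o g).
  exists S; split => // w /= h; apply: contrapT => Sw; apply: h => _.
  by rewrite fg.
have mg := measurable_int _ ig.
have mf' : measurable_fun setT (EFin \o f) by exact/measurable_EFinP.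
split.
  apply/integrableP; split => //.
  move/integrableP : ig => [_]; apply: le_lt_trans.
  rewrite le_eqVlt; apply/orP; left; apply/eqP.
  apply: ae_eq_integral => //; try exact: measurableT_comp.
  exists S; split => // w /= h; apply: contrapT => Sw; apply: h => _.
  by rewrite fg.
by congr fine; apply: ae_eq_integral.
Qed.

End null_set.

Section expected_error.
Context {R : realType} (p : penalty) (alpha sigma : R) (N d : nat).
Hypotheses (alpha0 : 0 <= alpha) (N_gt0 : (0 < N)%N).
Context d0 (T : measurableType d0) (P : probability T R)
  (Z : 'I_N * 'I_d -> {RV P >-> R}) (eps : 'I_N -> {RV P >-> R}).
Context d1 (T' : measurableType d1) (Q : probability T' R) (x : 'I_d -> {RV Q >-> R}).
Hypotheses (eps_normal : iid_centered_normal eps 1) (Zeps : independent_families Z eps).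
Hypothesis x_normal : iid_centered_normal x N%:R^-1.
Variable b : 'cV[R]_d.
Let X w := mx_of (Z ^~ w).
Let f := spectral_map p alpha.

(** [g1] and [g2] are integrable representatives of the squared bias and of the variance per unit
    noise, required to agree with them only off the null event [S]. *)
Lemma expected_mse (S : set T) (g1 g2 : T -> R) : measurable S -> P S = 0%E ->
  P.-integrable setT (EFin \o g1) -> P.-integrable setT (EFin \o g2) ->
  (forall w, ~ S w -> forall i, f (eigval (gram (X w)) i) != 0) ->
  (forall w, ~ S w -> \sum_i spectral_weight (gram (X w)) b i *
     (1 - eigval (gram (X w)) i / f (eigval (gram (X w)) i)) ^+ 2 = g1 w) ->
  (forall w, ~ S w -> \sum_i eigval (gram (X w)) i / f (eigval (gram (X w)) i) ^+ 2 = g2 w) ->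
  (\int[P]_w test_mse x b (bias_constrained_estimator p alpha (X w)
      (X w *m b + sigma *: random_vector eps w)) =
   (N%:R^-1 * (\int[P]_w g1 w + sigma ^+ 2 * \int[P]_w g2 w))%:E)%E.
Proof.
move=> mS PS ig1 ig2 f0 E1 E2.
have NV : 0 < (N%:R^-1 : R) by rewrite invr_gt0 ltr0n.
pose A w := invmx (biased_gram p alpha (gram (X w))).
pose u w := b - A w *m gram (X w) *m b.
pose B w := A w *m (X w)^T.
have mX : measurable_mx (X : family_type Z -> 'M[R]_(N, d)).
  by apply: measurable_mx_of => j; exact: measurable_family.
have mA : measurable_mx (A : family_type Z -> 'M[R]_d) by exact: measurable_biased_inverse.
have mB : measurable_mx (B : family_type Z -> 'M[R]_(d, N)).
  by apply: measurable_mulmx => //; exact: measurable_trmx.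
have mu : measurable_mx (u : family_type Z -> 'cV[R]_d).
  move=> i j; rewrite (_ : (fun w => _) = fun w => b i j - (A w *m gram (X w) *m b) i j).
    apply: measurable_funB => //; apply: measurable_mulmx; last exact: measurable_cstmx.
    by apply: measurable_mulmx => //; exact: measurable_gram.
  by apply/funext => w; rewrite !mxE.
have toT (g : T -> R) : measurable_fun [set: family_type Z] g -> measurable_fun [set: T] g.
  by move=> mg; apply: (measurableT_comp mg (@measurable_to_family _ _ _ _ _ Z)).
have [iu Iu] := @null_set_integral _ _ _ P S (fun w => dotc (u w) (u w)) g1 mS PS
  (toT _ (measurable_dotc mu mu)) ig1 (fun w Sw => etrans (bias_spectral (f0 w Sw) b) (E1 w Sw)).
have mtr : measurable_fun [set: family_type Z] (fun w => \tr (B w *m (B w)^T)).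
  by apply: measurable_mxtrace; apply: measurable_mulmx => //; exact: measurable_trmx.
have [iB IB] := @null_set_integral _ _ _ P S (fun w => \tr (B w *m (B w)^T)) g2 mS PS
  (toT _ mtr) ig2 (fun w Sw => etrans (variance_spectral (f0 w Sw)) (E2 w Sw)).
have [iE IE] := noise_average eps_normal Zeps sigma mu mB iu iB.
under eq_integral do rewrite (test_mseE NV x_normal) estimator_error.
rewrite -Iu -IB -IE -RintegralZl// /Rintegral fineK//.
by apply: (integrable_fin_num measurableT); exact: (integrableZl measurableT N%:R^-1 iE).
Qed.

End expected_error.

(** * Passage to the limit in the expected error *)

Section limit_of_expected_error.
Context {R : realType} (lambda beta sigma alpha : R) (p : penalty) (N d : nat -> nat).
Hypotheses (l0 : 0 < lambda) (l1 : lambda < 1) (alpha0 : 0 <= alpha).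
Hypotheses (N_gt0 : forall k, (0 < N k)%N) (d_gt0 : forall k, (0 < d k)%N).
Hypothesis cvgN : N @ \oo --> \oo.
Hypothesis cvg_ratio : (fun k => (d k)%:R / (N k)%:R : R) @ \oo --> lambda.
Variable beta0 : forall k, 'cV[R]_(d k).
Hypothesis cvg_beta0 : (fun k => dotc (beta0 k) (beta0 k) / (d k)%:R) @ \oo --> beta ^+ 2.
Context (disp : nat -> measure_display) (T : forall k, measurableType (disp k))
  (P : forall k, probability (T k) R)
  (Z : forall k, 'I_(N k) * 'I_(d k) -> {RV (P k) >-> R})
  (eps : forall k, 'I_(N k) -> {RV (P k) >-> R}).
Arguments Z : clear implicits.
Arguments eps : clear implicits.
Hypothesis Znormal : forall k, iid_centered_normal (Z k) (N k)%:R^-1.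
Hypothesis eps_normal : forall k, iid_centered_normal (eps k) 1.
Hypothesis Zeps : forall k, independent_families (Z k) (eps k).
Context (disp' : nat -> measure_display) (T' : forall k, measurableType (disp' k))
  (Q : forall k, probability (T' k) R) (x : forall k, 'I_(d k) -> {RV (Q k) >-> R}).
Arguments x : clear implicits.
Hypothesis x_normal : forall k, iid_centered_normal (x k) (N k)%:R^-1.

Let X k w := mx_of (Z k ^~ w).
Arguments X : clear implicits.
Let mX k : measurable_mx (X k). Proof. by apply: measurable_mx_of => j. Qed.
Let f := spectral_map p alpha.
Let d1 k : 0 < ((d k)%:R : R). Proof. by rewrite ltr0n. Qed.

Let err k := (\int[P k]_w test_mse (x k) (beta0 k) (bias_constrained_estimator p alpha (X k w)
      (X k w *m beta0 k + sigma *: random_vector (eps k) w)))%E.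

(** [a] is the bias average per unit of [|beta0|^2] and [v] the variance average per dimension, so
    the two factors [d / N] and [|beta0|^2 / d] with known limits split off. The identity is asked
    only eventually, because the dimension gap may be nonpositive for small [k]. *)
Let assemble (h1 h2 : R -> R) (C : R) (a v : nat -> R) :
  measurable_fun setT h1 -> measurable_fun setT h2 ->
  (forall y, mp_left lambda <= y <= mp_right lambda -> `|h1 y| <= C) ->
  (forall y, mp_left lambda <= y <= mp_right lambda -> `|h2 y| <= C) ->
  (forall y, 0 < y -> h1 y = (1 - y / f y) ^+ 2) ->
  (forall y, 0 < y -> h2 y = y / f y ^+ 2) ->
  a @ \oo --> mp_mean lambda h1 -> v @ \oo --> mp_mean lambda h2 ->
  (\forall k \near \oo, err k = ((N k)%:R^-1 *
     (dotc (beta0 k) (beta0 k) * a k + sigma ^+ 2 * ((d k)%:R * v k)))%:E) ->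
  err @ \oo --> limit_error p lambda beta sigma alpha.
Proof.
move=> mh1 mh2 h1C h2C h1E h2E ca cv errE.
rewrite (limit_errorE beta sigma l0 l1 mh1 mh2 h1C h2C h1E h2E).
pose r k := (d k)%:R / (N k)%:R * (dotc (beta0 k) (beta0 k) / (d k)%:R * a k + sigma ^+ 2 * v k).
have cr : r @ \oo --> lambda *
    (beta ^+ 2 * mp_mean lambda h1 + sigma ^+ 2 * mp_mean lambda h2).
  apply: cvgM => //; apply: cvgD; first exact: cvgM.
  by apply: cvgM cv; exact: cvg_cst.
apply: cvg_EFin; first by apply: filterS errE => k ->.
apply: cvg_trans cr; apply: near_eq_cvg; apply: filterS errE => k /= ->.
by rewrite /r/=; field; rewrite !gt_eqF// ltr0n.
Qed.

Lemma cvg_error_regular : 0 < alpha -> p <> Spectral ->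
  err @ \oo --> limit_error p lambda beta sigma alpha.
Proof.
move=> ap pS.
have fp y : 0 <= y -> 0 < f y.
  rewrite /f; case: p pS => //= _ y0; first by rewrite lt_max ap orbT.
  by rewrite ltr_wpDl.
have rV : resolvent_closure (fun y => (f y)^-1).
  by rewrite /f; case: p pS => //= _; [exact: rc_inv_max|exact: rc_kernel].
have rf : resolvent_closure (fun y => y / f y).
  by rewrite /f; case: p pS => //= _; [exact: rc_ratio_max|exact: rc_ratio_shift].
pose h1 y := (1 - y / f y) ^+ 2; pose h2 y := y / f y ^+ 2.
have r1 : resolvent_closure h1 by apply: rc_exp; apply: rc_sub => //; exact: rc_cst.
have r2 : resolvent_closure h2.
  rewrite (_ : h2 = fun y => y / f y * (f y)^-1); first exact: rc_mul.
  by apply/funext => y; rewrite /h2 -mulrA -expr2 exprVn.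
have [C1 C10 h1C] := rc_bounded r1; have [C2 C20 h2C] := rc_bounded r2.
have a0 y : mp_left lambda <= y <= mp_right lambda -> 0 <= y.
  by move=> /andP[+ _]; apply: le_trans; exact: ltW (mp_left_gt0 l1).
pose b k := sval (cid (unit_direction (beta0 k) (d_gt0 k))).
have b1 k : dotc (b k) (b k) = 1 by rewrite /b; case: cid => ? [].
have bE k : beta0 k = Num.sqrt (dotc (beta0 k) (beta0 k)) *: b k.
  by rewrite /b; case: cid => ? [].
pose ev k w i := eigval (gram (X k w)) i.
have ev0 k w i : 0 <= ev k w i by exact: eigval_gram_ge0.
(* Two systems of weights on the same eigenvalues: spectral weights along [beta0] for the bias,
   uniform weights for the variance. *)
pose wq k w i := spectral_weight (gram (X k w)) (b k) i.
pose wt k (w : T k) (i : 'I_(d k)) : R := (d k)%:R^-1.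
have qE k t w : 0 < t -> spectral_sum (wq k) (ev k) (fun y => (y + t)^-1) w =
    quad_resolvent t (b k) (X k w).
  move=> t0; rewrite /quad_resolvent resolvent_fcalc// dotc_fcalc//; exact: trmx_gram.
have tE k t w : 0 < t -> spectral_sum (wt k) (ev k) (fun y => (y + t)^-1) w =
    mean_trace t (X k w).
  move=> t0; rewrite /mean_trace resolvent_fcalc// mxtrace_fcalc; last exact: trmx_gram.
  by rewrite mulr_sumr.
have wq1 k w : \sum_i wq k w i = 1 by rewrite sum_spectral_weight ?b1//; exact: trmx_gram.
have wt1 k w : \sum_i wt k w i = 1.
  by rewrite sumr_const card_ord -[LHS]mulr_natr mulVf// gt_eqF.
have wq0 k w i : 0 <= wq k w i by exact: spectral_weight_ge0.
have wt0 k w i : 0 <= wt k w i by rewrite invr_ge0 ltW.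
have mq k t : 0 < t -> measurable_fun setT (spectral_sum (wq k) (ev k) (fun y => (y + t)^-1)).
  move=> t0; rewrite (_ : spectral_sum _ _ _ = fun w => quad_resolvent t (b k) (X k w)).
    exact: measurable_quad_resolvent.
  by apply/funext => w; rewrite qE.
have mt k t : 0 < t -> measurable_fun setT (spectral_sum (wt k) (ev k) (fun y => (y + t)^-1)).
  move=> t0; rewrite (_ : spectral_sum _ _ _ = fun w => mean_trace t (X k w)).
    exact: measurable_mean_trace.
  by apply/funext => w; rewrite tE.
have cq t : 0 < t -> (fun k => \int[P k]_w spectral_sum (wq k) (ev k) (fun y => (y + t)^-1) w)
    @ \oo --> mp_stieltjes lambda t.
  move=> t0; under eq_fun => k do rewrite (eq_Rintegral _ (fun w _ => qE k t w t0)).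
  exact: cvg_quad_resolvent.
have ct t : 0 < t -> (fun k => \int[P k]_w spectral_sum (wt k) (ev k) (fun y => (y + t)^-1) w)
    @ \oo --> mp_stieltjes lambda t.
  move=> t0; under eq_fun => k do rewrite (eq_Rintegral _ (fun w _ => tE k t w t0)).
  exact: cvg_mean_trace.
apply: (@assemble h1 h2 (C1 + C2) (fun k => \int[P k]_w spectral_sum (wq k) (ev k) h1 w)
  (fun k => \int[P k]_w spectral_sum (wt k) (ev k) h2 w)).
- exact: rc_measurable.
- exact: rc_measurable.
- by move=> y /a0 y0; apply: le_trans (h1C y y0) _; rewrite lerDl.
- by move=> y /a0 y0; apply: le_trans (h2C y y0) _; rewrite lerDr.
- by [].
- by [].
- exact: cvg_spectral_sum.
- exact: cvg_spectral_sum.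
- apply: nearW => k.
  have i1 := spectral_sum_integrable P wq0 wq1 ev0 mq k r1.
  have i2 := spectral_sum_integrable P wt0 wt1 ev0 mt k r2.
  rewrite -(RintegralZl _ measurableT i1) -(RintegralZl _ measurableT i2).
  apply: (expected_mse sigma alpha0 (N_gt0 k) (eps_normal k) (@Zeps k) (x_normal k)
    (S := set0)) => //.
  + exact: (integrableZl measurableT _ i1).
  + exact: (integrableZl measurableT _ i2).
  + by move=> w _ i; rewrite gt_eqF// fp// eigval_gram_ge0.
  + move=> w _; rewrite mulr_sumr; apply: eq_bigr => i _.
    by rewrite {1}bE spectral_weightZ sqr_sqrtr ?dotc_ge0// mulrA.
  + move=> w _; rewrite mulr_sumr; apply: eq_bigr => i _.
    by rewrite mulrA divff ?mul1r// gt_eqF.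
Qed.

(** When the spectral map is linear on the half-line, the estimator is least squares divided by [c]:
    the bias is the deterministic factor [1 - c^-1], and the variance involves only the trace of the
    inverse Gram matrix. *)
Lemma cvg_error_singular (c : R) : 0 < c -> (forall y, 0 <= y -> f y = c * y) ->
  err @ \oo --> limit_error p lambda beta sigma alpha.
Proof.
move=> c0 fE; have cN0 : c != 0 by rewrite gt_eqF.
pose h1 (y : R) := (1 - c^-1) ^+ 2; pose h2 (y : R) := c ^- 2 * y^-1.
have a0 := mp_left_gt0 l1.
have E1 y : 0 < y -> h1 y = (1 - y / f y) ^+ 2.
  move=> y0; rewrite fE ?(ltW y0)// /h1 invfM mulrCA divff ?mulr1//.
  by rewrite gt_eqF.
have E2 y : 0 < y -> h2 y = y / f y ^+ 2.
  move=> y0; rewrite fE ?(ltW y0)// /h2.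
  by field; rewrite cN0 gt_eqF.
have c2 : 0 <= c ^- 2 by rewrite invr_ge0 exprn_ge0// ltW.
pose v k := c ^- 2 * \int[P k]_w
  (if \det (gram (X k w)) == 0 then 0 else inverse_trace (X k w)).
have mi : measurable_fun [set: R] (@GRing.inv R) by exact: measurable_inv.
have iC y : mp_left lambda <= y <= mp_right lambda -> `|y^-1| <= (mp_left lambda)^-1.
  move=> /andP[ay _]; have y0 := lt_le_trans a0 ay.
  by rewrite ger0_norm ?invr_ge0 ?(ltW y0)// lef_pV2 ?posrE.
have ii := mp_bounded_integrable l0 l1 mi iC.
apply: (@assemble h1 h2 (`|(1 - c^-1) ^+ 2| + c ^- 2 * (mp_left lambda)^-1)
  (fun=> (1 - c^-1) ^+ 2) v) => //.
- exact: measurable_cst.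
- exact: measurable_funM.
- by move=> y _; rewrite lerDl mulr_ge0// invr_ge0 ltW.
- move=> y yab; rewrite normrM (ger0_norm c2); apply: le_trans (ler_wpM2l c2 (iC y yab)) _.
  by rewrite lerDr.
- rewrite /h1 mp_mean_cst//; exact: cvg_cst.
- rewrite /h2 mp_meanZ// mp_mean_inv//; apply: cvgM; first exact: cvg_cst.
  exact: cvg_inverse_trace.
- have := dimension_gap_gt0 l1 cvgN cvg_ratio; apply: filterS => k kk.
  have [ih _ _] := inverse_trace_integral (N_gt0 k) (d_gt0 k) (Znormal k) kk.
  have PS := gram_singular_null (N_gt0 k) (d_gt0 k) (Znormal k) kk.
  set S := [set w | _] in PS.
  have mS : measurable S.
    rewrite -[S]setTI.
    by apply: (measurable_det (measurable_gram (@mX k))) (measurable_set1 0).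
  pose h w := if \det (gram (X k w)) == 0 then 0 else inverse_trace (X k w).
  rewrite /v [(d k)%:R * _]mulrA -(RintegralZl _ measurableT ih).
  rewrite -[X in X + _](expectation_const (P k)).
  have ev w : ~ S w -> forall i, 0 < eigval (gram (X k w)) i.
    by move=> /eqP Sw; exact: det_gram_eigval.
  apply: (expected_mse sigma alpha0 (N_gt0 k) (eps_normal k) (@Zeps k) (x_normal k) mS PS) => //.
  + exact: finite_measure_integrable_cst.
  + exact: (integrableZl measurableT _ ih).
  + move=> w Sw i; rewrite -/f fE ?(ltW (ev w Sw i))// mulf_neq0// gt_eqF//.
    exact: ev.
  (* Every term of the bias sum carries the same constant, so the spectral weights add up to
     [|beta0|^2]. *)
  + move=> w Sw; rewrite -(sum_spectral_weight (trmx_gram (X k w))) mulr_suml.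
    by apply: eq_bigr => i _; rewrite -/f -E1//; exact: ev.
  + move=> w Sw; rewrite -/(h w) /h; have /eqP/negbTE -> : \det (gram (X k w)) <> 0 by exact: Sw.
    rewrite inverse_trace_eigval; last by apply/eqP; exact: Sw.
    rewrite mulrACA divff ?gt_eqF// mul1r mulr_sumr.
    by apply: eq_bigr => i _; rewrite -/f -E2//; exact: ev.
Qed.

End limit_of_expected_error.

Unset Implicit Arguments.
Set Strict Implicit.
Set Printing Implicit Defensive.

Theorem proposition2p1 (R : realType) (lambda beta sigma alpha : R)
  (p : penalty)
  (lambda_gt0 : 0 < lambda) (lambda_lt1 : lambda < 1)
  (beta_gt0 : 0 < beta) (sigma_ge0 : 0 <= sigma) (alpha_ge0 : 0 <= alpha)
  (* the sizes, indexed by k *)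
  (N d : nat -> nat)
  (N_gt0 : forall k, (0 < N k)%N) (d_gt0 : forall k, (0 < d k)%N)
  (cvgN : N @ \oo --> \oo) (cvgd : d @ \oo --> \oo)
  (cvg_ratio : (fun k => (d k)%:R / (N k)%:R : R) @ \oo --> lambda)
  (beta0 : forall k, 'cV[R]_(d k))
  (cvg_beta0 : (fun k => dotc (beta0 k) (beta0 k) / (d k)%:R) @ \oo
     --> beta ^+ 2)
  (* the probability spaces carrying the training data *)
  (disp : nat -> measure_display)
  (T : forall k, measurableType (disp k))
  (P : forall k, probability (T k) R)
  (X : forall k, 'I_(N k) -> 'I_(d k) -> {RV (P k) >-> R})
  (eps : forall k, 'I_(N k) -> {RV (P k) >-> R})
  (X_normal : forall k,
     iid_centered_normal (fun ij : 'I_(N k) * 'I_(d k) => X k ij.1 ij.2)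
       (N k)%:R^-1)
  (eps_normal : forall k, iid_centered_normal (eps k) 1)
  (X_eps_independent : forall k,
     independent_families (fun ij : 'I_(N k) * 'I_(d k) => X k ij.1 ij.2)
       (eps k))
  (* the probability spaces carrying the test point: separate from the
     previous ones, so that the inner expectation is at fixed (X, Y) *)
  (disp' : nat -> measure_display)
  (T' : forall k, measurableType (disp' k))
  (Q : forall k, probability (T' k) R)
  (x : forall k, 'I_(d k) -> {RV (Q k) >-> R})
  (x_normal : forall k, iid_centered_normal (x k) (N k)%:R^-1) :
  let design k w := random_matrix (X k) w in
  let response k w :=
    design k w *m beta0 k + sigma *: random_vector (eps k) w in
  let betahat k w :=
    bias_constrained_estimator p alpha (design k w) (response k w) in
  let MSE k w := test_mse (x k) (beta0 k) (betahat k w) in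
  (fun k => (\int[P k]_w MSE k w)%E) @ \oo
    --> limit_error p lambda beta sigma alpha.
Proof.
move=> design response betahat MSE.
pose Z k (ij : 'I_(N k) * 'I_(d k)) := X k ij.1 ij.2.
have designE k w : design k w = mx_of (Z k ^~ w).
  by apply/matrixP => i j; rewrite !mxE.
have -> : (fun k => (\int[P k]_w MSE k w)%E) = fun k =>
    (\int[P k]_w test_mse (x k) (beta0 k) (bias_constrained_estimator p alpha
       (mx_of (Z k ^~ w)) (mx_of (Z k ^~ w) *m beta0 k
          + sigma *: random_vector (eps k) w)))%E.
  by apply/funext => k; apply: eq_integral => w _; rewrite -designE.
clear MSE betahat; have [->|pS] := pselect (p = Spectral).
  apply: (cvg_error_singular lambda_gt0 lambda_lt1 alpha_ge0 N_gt0 d_gt0 cvgN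
    cvg_ratio cvg_beta0 X_normal eps_normal X_eps_independent x_normal (Z := Z) (c := 1 + alpha)).
    by rewrite ltr_pwDl.
  by move=> y _ /=; rewrite mulrC.
(* At [alpha = 0] the nuclear and ridge maps are the identity on nonnegative numbers, which is the
   linear case with slope [1]. *)
have [a0|a0] := eqVneq alpha 0.
  apply: (cvg_error_singular lambda_gt0 lambda_lt1 alpha_ge0 N_gt0 d_gt0 cvgN
    cvg_ratio cvg_beta0 X_normal eps_normal X_eps_independent x_normal (Z := Z) (c := 1)) => //.
  move=> y y0; rewrite mul1r a0; case: p pS => //= _; first by rewrite max_l.
  by rewrite addr0.
apply: (cvg_error_regular lambda_gt0 lambda_lt1 alpha_ge0 N_gt0 d_gt0 cvgN
    cvg_ratio cvg_beta0 X_normal eps_normal X_eps_independent x_normal (Z := Z)) => //.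
by rewrite lt_neqAle eq_sym a0.
Qed.
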